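(* Let $n\ge 1$ and let $A$ be an expansive real $n\times n$ matrix. Suppose that the transpose $A^{*}$ has a real eigenvalue $\lambda\in\mathbb{R}$ with an associated eigenvector $v\in\mathbb{R}^n\setminus\{0\}$. Let $\psi$ be a radial function on $\mathbb{R}^n$ satisfying the standing hypothesis with respect to $A$ (see context), with Fourier transform $\widehat{\psi}$ supported in the isotropic annulus $$\mathcal{A}(r,R)=\{\xi\in\mathbb{R}^n : r\le|\xi|\le R\},\qquad 0<r<R.$$ If $|\lambda|>R/r$, then the frame operator $U_{\psi,\psi}$ satisfies $$\bigl\|U_{\psi,\psi}-\mathrm{Id}\bigr\|_{H^p_A\to H^p_A}\ge 1\qquad\text{for every } p\in(0,1].$$ The lower bound $1$ is uniform in $p$ and independent of any further parameter of the pair $(A,\psi)$.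
   Context: Fourier transform: $\hat f(\xi)=\int_{\mathbb{R}^n} f(x)e^{-2\pi i x\cdot\xi}\,dx$. $\mathcal{S}(\mathbb{R}^n)$ and $\mathcal{S}'(\mathbb{R}^n)$ denote Schwartz functions and tempered distributions; $|\cdot|$ is the Euclidean norm on $\mathbb{R}^n$. A real $n\times n$ matrix $A$ is expansive if every eigenvalue $\mu$ of $A$ satisfies $|\mu|>1$. Put $b:=|\det A|>1$, and let $|\lambda_-|$ be the smallest modulus of an eigenvalue of $A$. $A^*$ is the transpose of $A$. Step homogeneous quasi-norm (Bownik): there is an open ellipsoid $\Delta$ centred at $0$ with $|\Delta|=1$ and $\Delta\subset t\Delta\subset A\Delta$ for some $t>1$; fix one, put $B_k:=A^k\Delta$ ($k\in\mathbb{Z}$), and set $\rho_A(x)=b^k$ for $x\in B_{k+1}\setminus B_k$, $\rho_A(0)=0$. Then $\rho_A(Ax)=b\,\rho_A(x)$ and $\rho_A(x+y)\le C(\rho_A(x)+\rho_A(y))$. An anisotropic annulus is a set $\{\xi : r_A\le\rho_A(\xi)\le R_A\}$ with $0<r_A<R_A<\infty$. Standing hypothesis on $\psi$: $\psi\in\mathcal{S}(\mathbb{R}^n)$ (this is the meaning given to ''anisotropic decay adapted to $\rho_A$''); $\psi$ has vanishing moments $\int x^\alpha\psi(x)\,dx=0$ for $|\alpha|\le\mathcal{N}_p(A):=\lfloor(\tfrac1p-1)\tfrac{\ln b}{\ln|\lambda_-|}\rfloor$, for every $p\in(0,1]$; and $\hat\psi$ is supported in an anisotropic annulus contained in $[-1/2,1/2]^n\setminus\{0\}$.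 Affine system and frame operator: $\psi_{j,k}(x):=b^{j/2}\psi(A^jx-k)$ for $j\in\mathbb{Z}$, $k\in\mathbb{Z}^n$, and $U_{\psi,\psi}f:=\sum_{j\in\mathbb{Z}}\sum_{k\in\mathbb{Z}^n}\langle f,\psi_{j,k}\rangle\psi_{j,k}$. Anisotropic Hardy space: for $0<p\le1$, $H^p_A(\mathbb{R}^n)$ is the space of $f\in\mathcal{S}'(\mathbb{R}^n)$ with $\|f\|_{H^p_A}:=\|M_Nf\|_{L^p}<\infty$, where $M_N$ is the grand maximal function $M_Nf(x)=\sup_{\varphi\in\mathcal{S}_N}\sup_{k\in\mathbb{Z}}\sup_{y\in x+B_k}|f*\varphi_k(y)|$, $\varphi_k(x)=b^{-k}\varphi(A^{-k}x)$, $\mathcal{S}_N=\{\varphi\in\mathcal{S}(\mathbb{R}^n):\sup_x\sup_{|\alpha|\le N}\max(1,\rho_A(x)^N)|\partial^\alpha\varphi(x)|\le1\}$, and $N=N(p,A)$ is any fixed sufficiently large integer (different choices give equivalent quasi-norms). For an operator $T$, $\|T\|_{H^p_A\to H^p_A}=\sup\{\|Tf\|_{H^p_A}/\|f\|_{H^p_A}: 0\ne f\in H^p_A\}$. *)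

(* Defs.v *)
(* A point of R^n is a column vector over [R : realType].  The dimension is
   written [n.+1], so that n >= 1 and ['M[R]_n.+1] is a unit ring, in which
   [A ^ k] makes sense for [k : int]. *)
From HB Require Import structures.
From mathcomp Require Import all_boot all_order all_algebra.
From mathcomp Require Import finmap complex.
From mathcomp Require Import all_classical all_reals all_analysis.
From mathcomp Require summability.

Set Implicit Arguments.
Unset Strict Implicit.
Unset Printing Implicit Defensive.

Import Order.TTheory GRing.Theory Num.Theory.
Import numFieldNormedType.Exports.

Local Open Scope classical_set_scope.
Local Open Scope ring_scope.
Local Open Scope complex_scope.

Section LebesgueMeasure.
Context {R : realType}.

Definition tcons n (z : measurableTypeR R * n.-tuple (measurableTypeR R)) :
  n.+1.-tuple (measurableTypeR R) := [tuple of z.1 :: z.2].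

Lemma measurable_tcons n : measurable_fun [set: _] (@tcons n).
Proof. exact: measurable_cons. Qed.

Definition tuncons n (t : n.+1.-tuple (measurableTypeR R)) :
  measurableTypeR R * n.-tuple (measurableTypeR R) :=
  (thead t, [tuple of behead t]).

Lemma measurable_tuncons n : measurable_fun [set: _] (@tuncons n).
Proof.
by apply: measurable_fun_pair; [exact: measurable_tnth|exact: measurable_behead].
Qed.

Lemma tconsK n : cancel (@tcons n) (@tuncons n).
Proof. by case=> x t; congr pair; apply/val_inj. Qed.

Section step.
Variables (n : nat)
  (mu : {sigma_finite_measure set (n.-tuple (measurableTypeR R)) -> \bar R}).

Definition lebesgue_step : set (n.+1.-tuple (measurableTypeR R)) -> \bar R :=
  pushforward (lebesgue_measure \x mu)%E (@tcons n).

Let step0 : lebesgue_step set0 = 0%E.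
Proof. by rewrite /lebesgue_step /pushforward preimage_set0 measure0. Qed.

Let step_ge0 A : (0 <= lebesgue_step A)%E.
Proof. by rewrite /lebesgue_step /pushforward; exact: measure_ge0. Qed.

Let step_sigma_additive : semi_sigma_additive lebesgue_step.
Proof.
have mt := @measurable_tcons n.
move=> F mF tF mUF; rewrite /lebesgue_step /pushforward preimage_bigcup.
apply: measure_semi_sigma_additive.
- by move=> i; rewrite -[X in measurable X]setTI; exact: mt.
- apply/trivIsetP => /= i j _ _ ij; rewrite -preimage_setI.
  by move/trivIsetP : tF => /(_ _ _ _ _ ij) ->//; rewrite preimage_set0.
- by rewrite -preimage_bigcup -[X in measurable X]setTI; exact: mt.
Qed.

HB.instance Definition _ := isMeasure.Build _ _ _ lebesgue_step
  step0 step_ge0 step_sigma_additive.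

Let step_sigma_finite : sigma_finite setT lebesgue_step.
Proof.
have [G GT Goo] := sigma_finiteT (@lebesgue_measure R).
have [H HT Hoo] := sigma_finiteT mu.
pose F (i : nat * nat) := @tuncons n @^-1` (G i.1 `*` H i.2).
exists (fun i => if choice.unpickle i is Some ij then F ij else set0).
  rewrite predeqE => t; split=> // _.
  have [i _ Gi] : (\bigcup_i G i) (tuncons t).1 by rewrite -GT.
  have [j _ Hj] : (\bigcup_i H i) (tuncons t).2 by rewrite -HT.
  by exists (choice.pickle (i, j)) => //; rewrite choice.pickleK.
move=> k; case: choice.unpickle => [[i j]|]; last first.
  by split; [exact: measurable0|rewrite step0 ltry].
have [mG Gi] := Goo i; have [mH Hj] := Hoo j; split.
  rewrite -[X in measurable X]setTI; apply: (@measurable_tuncons n) => //.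
  exact: measurableX.
rewrite /lebesgue_step /pushforward /F -comp_preimage.
rewrite (_ : _ \o _ = id); last by rewrite funeqE => z /=; rewrite tconsK.
by rewrite preimage_id product_measure1E// lte_mul_pinfty// ge0_fin_numE.
Qed.

HB.instance Definition _ := Measure_isSigmaFinite.Build _ _ _ lebesgue_step
  step_sigma_finite.

End step.

Let dirac_sigma_finite :
  sigma_finite setT (@dirac _ (0.-tuple (measurableTypeR R)) [tuple] R).
Proof.
exists (fun=> setT); first by rewrite bigcup_const//; exists 0%N.
by move=> i; split; [exact: measurableT|rewrite /dirac indicT ltry].
Qed.

HB.instance Definition _ := Measure_isSigmaFinite.Build _ _ _
  (@dirac _ (0.-tuple (measurableTypeR R)) [tuple] R) dirac_sigma_finite.

(* Lebesgue measure on R^n, the n-fold product of the one-dimensional one; it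
   lives on tuples because these carry the library's product sigma-algebra. *)
Fixpoint lebesgue n :
    {sigma_finite_measure set (n.-tuple (measurableTypeR R)) -> \bar R} :=
  match n with
  | 0 => @dirac _ (0.-tuple (measurableTypeR R)) [tuple] R
  | m.+1 => lebesgue_step (lebesgue m)
  end.

Definition vec n (t : n.-tuple (measurableTypeR R)) : 'cV[R]_n :=
  \col_i (tnth t i : R).

Definition vol n (X : set 'cV[R]_n) : \bar R := lebesgue n (@vec n @^-1` X).

Definition integR n (f : 'cV[R]_n -> R) : R :=
  (\int[lebesgue n]_t f (vec t))%R.

Definition integC n (f : 'cV[R]_n -> R[i]) : R[i] :=
  integR (fun x => complex.Re (f x)) +i* integR (fun x => complex.Im (f x)).

End LebesgueMeasure.

Notation normc := ComplexField.Normc.normc.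

Section Schwartz.
Context {R : realType} {n : nat}.
Local Notation E := 'cV[R]_n.+1.
Implicit Types (f phi psi : E -> R[i]) (x y xi : E).
Implicit Types (al be : 'I_n.+1 -> nat).

Definition dotv x y : R := \sum_i x i 0 * y i 0.

(* The norm `|x| which the library puts on matrices is the sup norm. *)
Definition enorm x : R := Num.sqrt (dotv x x).

Definition mlen al : nat := (\sum_i al i)%N.

Definition monom al x : R := \prod_i x i 0 ^+ al i.

Definition partialC (i : 'I_n.+1) f : E -> R[i] := fun x =>
  'D_(delta_mx i 0) (fun y => complex.Re (f y)) x
  +i* 'D_(delta_mx i 0) (fun y => complex.Im (f y)) x.

Definition pder al f : E -> R[i] :=
  foldr (fun i g => iter (al i) (partialC i) g) f (enum 'I_n.+1).

(* All iterated partial derivatives, in any order, exist and are continuous. *)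
Definition smooth f : Prop :=
  forall s : seq 'I_n.+1, let g := foldr partialC f s in
  [/\ continuous (fun x => complex.Re (g x)),
      continuous (fun x => complex.Im (g x)) &
      forall i x, derivable (fun y => complex.Re (g y)) x (delta_mx i 0) /\
                  derivable (fun y => complex.Im (g y)) x (delta_mx i 0)].

Definition schwartz f : Prop := smooth f /\
  forall al be, exists M : R, forall x,
    normc ((monom al x)%:C * pder be f x) <= M.

(* Convergence in the Frechet topology of the Schwartz space. *)
Definition schwartz_cvg (phi_ : nat -> E -> R[i]) phi : Prop :=
  forall al be (e : R), 0 < e -> \forall m \near \oo, forall x,
    normc ((monom al x)%:C * pder be (phi_ m \- phi) x) <= e.

(* A distribution is represented by a functional on all functions, of which
   only the values at Schwartz functions are ever used. *)
Definition distr := (E -> R[i]) -> R[i].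

Definition tempered (T : distr) : Prop :=
  (forall (a : R[i]) phi psi, schwartz phi -> schwartz psi ->
     T (fun x => a * phi x + psi x) = a * T phi + T psi) /\
  (forall (phi_ : nat -> E -> R[i]) phi,
     (forall m, schwartz (phi_ m)) -> schwartz phi -> schwartz_cvg phi_ phi ->
     normc (T (phi_ m) - T phi) @[m --> \oo] --> (0 : R)).

Definition distr_zero (T : distr) : Prop :=
  forall phi, schwartz phi -> T phi = 0.

Definition expi (t : R) : R[i] := cos t +i* sin t.

Definition fourier f xi : R[i] :=
  integC (fun x => f x * expi (- (2 * pi * dotv x xi))).

Definition supp f : set E := closure [set x | f x != 0].

Definition radial f : Prop := forall x y, enorm x = enorm y -> f x = f y.

End Schwartz.

Section Anisotropic.
Context {R : realType} {n : nat}.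
Local Notation E := 'cV[R]_n.+1.
Implicit Types (A : 'M[R]_n.+1) (D : set E).

Definition ceigenvalue A (mu : R[i]) : Prop :=
  eigenvalue (map_mx (fun a : R => a%:C) A) mu.

Definition expansive A : Prop := forall mu, ceigenvalue A mu -> 1 < normc mu.

Definition bdet A : R := `|\det A|.

(* The spectrum is finite and nonempty, so this infimum is a minimum. *)
Definition lambda_minus A : R := inf [set normc mu | mu in ceigenvalue A].

Definition step_ellipsoid A D : Prop :=
  [/\ exists2 P : 'M[R]_n.+1, P \in unitmx & D = [set x | enorm (P *m x) < 1],
      vol D = 1%E &
      exists2 t : R, 1 < t &
        D `<=` [set t *: x | x in D] /\
        [set t *: x | x in D] `<=` [set A *m x | x in D]].

Definition Bset A D (k : int) : set E := [set A ^ k *m x | x in D].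

(* [xget] selects the k with x in B_(k+1) \ B_k, which is unique for x != 0. *)
Definition rho A D (x : E) : R :=
  if x == 0 then 0
  else bdet A ^ xget 0 [set k : int | Bset A D (k + 1) x /\ ~ Bset A D k x].

Definition aniso_annulus A D (rA RA : R) : set E :=
  [set xi | rA <= rho A D xi <= RA].

Definition moment_order A (p : R) : int :=
  Num.floor ((p^-1 - 1) * (ln (bdet A) / ln (lambda_minus A))).

Definition standing A D (psi : E -> R[i]) : Prop :=
  [/\ schwartz psi,
      forall p : R, 0 < p <= 1 -> forall al : 'I_n.+1 -> nat,
        (mlen al)%:Z <= moment_order A p ->
        integC (fun x => (monom al x)%:C * psi x) = 0 &
      exists rA RA : R,
        [/\ 0 < rA, rA < RA,
            aniso_annulus A D rA RA `<=`
              [set xi | (forall i, `|xi i 0| <= 1 / 2) /\ xi <> 0] &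
            supp (fourier psi) `<=` aniso_annulus A D rA RA]].

Definition psi_jk A (psi : E -> R[i]) (j : int) (k : 'cV[int]_n.+1) :
  E -> R[i] := fun x =>
  (bdet A `^ (j%:~R / 2))%:C * psi (A ^ j *m x - map_mx (fun z => z%:~R) k).

(* <f, g> for a distribution f and a Schwartz function g, antilinear in g so as
   to extend the L^2 inner product. *)
Definition pairing (f : distr) (g : E -> R[i]) : R[i] :=
  f (fun x => (g x)^*).

Definition distr_of (g : E -> R[i]) : distr :=
  fun phi => integC (fun x => g x * phi x).

(* [frame_op A psi f g] states that U_{psi,psi} f = g: the frame series of f
   converges to g unconditionally over Z x Z^n, in the sense of tempered
   distributions. *)
Definition frame_op A (psi : E -> R[i]) (f g : distr) : Prop :=
  tempered g /\
  forall phi, schwartz phi ->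
    normc (@summability.partial_sum (int * 'cV[int]_n.+1)%type R[i]
      (fun jk => pairing f (psi_jk A psi jk.1 jk.2) *
                 distr_of (psi_jk A psi jk.1 jk.2) phi) J - g phi)
      @[J --> summability.totally] --> (0 : R).

Definition dilate A (k : int) (phi : E -> R[i]) : E -> R[i] :=
  fun x => (bdet A ^ (- k))%:C * phi (A ^ (- k) *m x).

Definition conv (f : distr) (phi : E -> R[i]) (y : E) : R[i] :=
  f (fun x => phi (y - x)).

Definition SN A D (N : nat) (phi : E -> R[i]) : Prop :=
  schwartz phi /\
  forall x (al : 'I_n.+1 -> nat), (mlen al <= N)%N ->
    Num.max 1 (rho A D x ^+ N) * normc (pder al phi x) <= 1.

Definition grand_max A D (N : nat) (f : distr) (x : E) : \bar R :=
  ereal_sup [set z | exists phi k y,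
    [/\ SN A D N phi, Bset A D k (y - x) &
        z = (normc (conv f (dilate A k phi) y))%:E]].

Definition Hnorm A D (N : nat) (p : R) (f : distr) : \bar R :=
  'N[lebesgue n.+1]_(p%:E)[grand_max A D N f \o @vec R n.+1].

Definition Hardy A D (N : nat) (p : R) : set distr :=
  [set f | tempered f /\ (Hnorm A D N p f < +oo)%E].

(* Quasi-norm on H^p_A of an operator given by its graph [T]; the supremum runs
   over the nonzero elements of H^p_A at which the operator is defined. *)
Definition opnorm A D (N : nat) (p : R) (T : distr -> distr -> Prop) : \bar R :=
  ereal_sup [set z | exists f h, [/\ Hardy A D N p f, ~ distr_zero f, T f h &
    z = (Hnorm A D N p h / Hnorm A D N p f)%E]].

Definition frame_defect A (psi : E -> R[i]) (f h : distr) : Prop :=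
  exists2 g, frame_op A psi f g & h = g \- f.

End Anisotropic.

(* Main.v *)
(* If |lambda| > R / r, some sphere |xi| = s meets the eigenline of A^T only at
   points that every dilate by A^T moves off the annulus.  Hence there is a point
   xi0 on that line and a cube around it on which the Fourier transforms of all
   psi (A^j x - k) vanish.  A wave packet F with spectrum in this cube is
   orthogonal to the whole affine system, so U F = 0 and |U F - F| = |F|.

   The packet is G(x) = exp(2 pi i x.xi0) prod_i sinc(c x_i)^(2m): multiplying by
   a sinc only averages Fourier transforms, so the orthogonality is checked
   without Fourier inversion.  G need not have vanishing moments, and is replaced
   by its L-th difference F with step half a wavelength.  This keeps the
   orthogonality, gives the grand maximal function of F enough decay to be in
   L^p, and keeps F nonzero since the differences add up in phase. *)
Require Import Defs.
From mathcomp Require Import all_boot all_order all_algebra perm.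
From mathcomp Require Import complex.
From mathcomp Require summability.
From mathcomp Require Import all_classical all_reals all_analysis.
From mathcomp Require Import measurable_realfun ring lra.

Set Implicit Arguments.
Unset Strict Implicit.
Unset Printing Implicit Defensive.

Import Order.TTheory GRing.Theory Num.Theory.
Import numFieldNormedType.Exports.
Local Open Scope classical_set_scope.
Local Open Scope ring_scope.

(** * Linear change of variables *)

Section Lint.
Context {R : realType}.
Implicit Types n : nat.
Local Notation TR := (measurableTypeR R).

(** The delicate point is the finiteness of the Hardy quasi-norm of F, since the grand maximal
    function involves all scales and p may be small. Sizes are measured in the gauge of the
    ellipsoid, in which A^-1 contracts by 1/t and A expands by at most some Lam > 1. At scales k <=
    0 the decay of F is enough. At scale m >= 0, comparing the weight at x with the weight at A^-m x
    loses Lam^(q m), where q is the order of decay wanted, whereas L differences moved onto the test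
    function gain t^(-L m); hence L is chosen with Lam^q <= t^L. The order q is large enough for the
    p-th power of the decay to be integrable. Finally N has to reach L, so that L derivatives of the
    test functions are controlled, and to be so large that their decay in rho yields the required
    powers of the gauge. These choices see only p, A and the ellipsoid, which is why N0 comes before
    psi and lambda. The affine system also requires linear substitutions in integrals; their
    Jacobian is derived from invariance under translations and reflections. *)

Definition tupv n (x : 'cV[R]_n) : n.-tuple TR := [tuple x i 0 | i < n].

Lemma tupvK n : cancel (@tupv n) (@vec R n).
Proof. by move=> x; apply/colP => i; rewrite mxE tnth_mktuple. Qed.

Definition lint n (f : 'cV[R]_n -> \bar R) : \bar R :=
  (\int[lebesgue n]_t f (vec t))%E.

(** Column vectors carry no sigma-algebra here; measurability is transported from tuples. *)
Definition measv n d (T : measurableType d) (f : 'cV[R]_n -> T) :=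
  measurable_fun setT (f \o @vec R n).

Lemma measv_comp n d (T : measurableType d) (f : 'cV[R]_n -> T)
    d1 (T1 : measurableType d1) (g : T1 -> 'cV[R]_n) :
  measv f -> (forall i, measurable_fun setT (fun x => g x i 0 : TR)) ->
  measurable_fun setT (f \o g).
Proof.
move=> mf mg; rewrite (_ : f \o g = (f \o @vec R n) \o (@tupv n \o g)).
  apply: measurableT_comp => //; apply/measurable_fun_tnthP => i.
  by rewrite (_ : _ \o _ = (fun x => g x i 0))//; apply/funext => x /=; rewrite tnth_mktuple.
by apply/funext => x /=; rewrite tupvK.
Qed.

Lemma measurable_coord n i : measurable_fun setT (fun t => @vec R n t i 0 : TR).
Proof.
rewrite (_ : (fun _ => _) = (@tnth n TR)^~ i); first exact: measurable_tnth.
by apply/funext => t; rewrite mxE.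
Qed.

Lemma vec_tcons n (x : TR) (t : n.-tuple TR) :
  vec (tcons (x, t)) = col_mx (x : R)%:M (vec t) :> 'cV[R]_(1 + n).
Proof.
apply/colP => i; case: (split_ordP i) => j ->.
  rewrite col_mxEu mxE (ord1 j) mxE eqxx mulr1n.
  by rewrite (_ : lshift n 0 = 0) ?tnth0//; apply/val_inj.
rewrite col_mxEd !mxE (_ : rshift 1 j = lift ord0 j) ?tnthS//.
exact/val_inj.
Qed.

Lemma measurable_col_mx d (T : measurableType d) n (g : T -> R) (h : T -> 'cV[R]_n) :
  measurable_fun setT (g : T -> TR) ->
  (forall i, measurable_fun setT (fun x => h x i 0 : TR)) ->
  forall i, measurable_fun setT
     (fun x => (col_mx (g x)%:M (h x) : 'cV[R]_(1 + n)) i 0 : TR).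
Proof.
move=> mg mh i; case: (split_ordP i) => j ->.
  rewrite (_ : (fun _ => _) = g)//; apply/funext => x.
  by rewrite col_mxEu (ord1 j) mxE eqxx mulr1n.
rewrite (_ : (fun _ => _) = (fun x => h x j 0))//; apply/funext => x.
by rewrite col_mxEd.
Qed.

Lemma ge0_lintS n (f : 'cV[R]_(1 + n) -> \bar R) :
  measv f -> (forall x, 0 <= f x)%E ->
  (lint (f : 'cV[R]_n.+1 -> _) =
    \int[lebesgue_measure]_x lint (fun v => f (col_mx (x : R)%:M v)))%E.
Proof.
move=> mf f0; rewrite /lint /=.
rewrite [LHS](ge0_integral_pushforward (@measurable_tcons R n))//=.
rewrite preimage_setT fubini_tonelli1.
- apply: eq_integral => x _; rewrite /fubini_F; apply: eq_integral => t _ /=.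
  by rewrite vec_tcons.
- apply: (measurableT_comp mf); exact: measurable_tcons.
- by move=> z; exact: f0.
Qed.

(** Translations and reflections are all that the Haar uniqueness argument uses; general matrices
    are deduced from it. The boolean [s] selects the sign. *)
Lemma ge0_integral_affine1 (f : TR -> \bar R) (s : bool) (a : R) :
  measurable_fun setT f -> (forall x, 0 <= f x)%E ->
  (\int[lebesgue_measure]_x f ((-1) ^+ s * (x : R) + a)%R = \int[lebesgue_measure]_x f x)%E.
Proof.
move=> mf f0.
have mN : measurable_fun setT (fun x : TR => (-1) ^+ s * (x : R) : TR).
  by apply: measurable_funM => //; exact: measurable_cst.
have mD : measurable_fun setT (fun x : TR => (x : R) + a : TR).
  by apply: measurable_funD => //; exact: measurable_cst.
have tr : (\int[lebesgue_measure]_x f x = \int[lebesgue_measure]_x f ((x : R) + a)%R)%E.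
  rewrite -[RHS](@ge0_integral_pushforward _ _ _ _ _ _ mD _ setT f)//.
  (* The translated measure agrees with Lebesgue measure on half-open intervals, hence
     everywhere. *)
  apply: eq_measure_integral => A mA _; apply: lebesgue_measure_unique => //.
  move=> _ [[b c]] _ <-.
  transitivity (lebesgue_measure (`]b - a, c - a] : set TR)).
    rewrite !lebesgue_measure_itv/= !lte_fin ltrD2r; case: ifP => // _.
    by rewrite -!EFinB; congr EFin; ring.
  rewrite /= /pushforward; congr lebesgue_measure.
  by apply/seteqP; split=> x /=; rewrite !in_itv/= ltrBlDr lerBrDr.
rewrite [RHS]tr; case: s mN => /= mN; last first.
  by apply: eq_integral => x _; rewrite expr0 mul1r.
have mf' : measurable_fun setT (fun x : TR => f ((x : R) + a)%R).
  exact: (measurableT_comp mf mD).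
rewrite expr1.
rewrite -[LHS](@ge0_integral_pushforward _ _ _ _ _ _ mN _ setT (fun x => f (x + a)%R))//.
apply: eq_measure_integral => A mA _.
rewrite -[RHS](lebesgue_measureN mA)/= /pushforward; congr lebesgue_measure.
by apply/seteqP; split=> x; rewrite /preimage/= ?mulN1r// mulN1r.
Qed.

Lemma ge0_lint_affine n (f : 'cV[R]_n -> \bar R) (s : bool) (a : 'cV[R]_n) :
  measv f -> (forall x, 0 <= f x)%E -> (lint (fun x => f ((-1) ^+ s *: x + a)%R) = lint f)%E.
Proof.
elim: n f a => [|n IH] f a mf f0.
  by apply: eq_integral => t _; congr f; apply/colP => -[].
have maff : measv (fun x : 'cV[R]_n.+1 => f ((-1) ^+ s *: x + a)).
  apply: (measv_comp mf) => i.
  rewrite (_ : (fun _ => _) = (fun t => (-1) ^+ s * (@vec R _ t) i 0 + a i 0)); last first.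
    by apply/funext => t; rewrite !mxE.
  apply: measurable_funD; last exact: measurable_cst.
  by apply: measurable_funM; [exact: measurable_cst|exact: measurable_coord].
have mcol x : measv (fun v : 'cV[R]_n => f (col_mx (x : R)%:M v : 'cV[R]_(1 + n))).
  apply: (measv_comp mf); apply: measurable_col_mx; first exact: measurable_cst.
  exact: measurable_coord.
rewrite (ge0_lintS maff) => [|x]; last exact: f0.
rewrite (ge0_lintS mf) => [|x]; last exact: f0.
have -> : a = col_mx (a 0 0)%:M (dsubmx (a : 'cV_(1 + n))) :> 'cV_(1 + n).
  rewrite -{1}[a](@vsubmxK _ 1 n); congr col_mx; apply/colP => i.
  by rewrite (ord1 i) !mxE eqxx mulr1n; congr (a _ _); apply/val_inj.
set a0 := a 0 0; set a' := dsubmx _.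
have E (x : R) : lint (fun v => f ((-1) ^+ s *: col_mx x%:M v + col_mx a0%:M a')) =
    lint (fun w => f (col_mx ((-1) ^+ s * x + a0)%:M w : 'cV[R]_(1 + n))).
  rewrite -[RHS](IH _ a')//; congr lint; apply/funext => v.
  by rewrite scale_col_mx add_col_mx scale_scalar_mx -raddfD.
under eq_integral do rewrite E.
apply: (@ge0_integral_affine1 (fun x => lint (fun v => f (col_mx (x : R)%:M v)))).
  have -> : (fun x : TR => lint (fun v => f (col_mx (x : R)%:M v))) =
    fubini_F (lebesgue n) (fun z => f (vec (tcons z))).
    by apply/funext => x; apply: eq_integral => t _; rewrite vec_tcons.
  apply: measurable_fun_fubini_tonelli_F => //.
  by apply: (measurableT_comp mf); exact: measurable_tcons.
by move=> x; apply: integral_ge0.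
Qed.

End Lint.

(** * Uniqueness of Haar measure *)

Section Jacobian.
Context {R : realType}.
Implicit Types n : nat.
Local Notation TR := (measurableTypeR R).

Lemma measv_mulmx n d (T : measurableType d) (f : 'cV[R]_n -> T) (M : 'M[R]_n)
    (a : 'cV[R]_n) : measv f -> measv (fun x => f (M *m x + a)).
Proof.
move=> mf; apply: (measv_comp mf) => i.
under eq_fun do rewrite !mxE.
apply: measurable_funD; last exact: measurable_cst.
apply: measurable_sum => j.
by apply: measurable_funM; [exact: measurable_cst|exact: measurable_coord].
Qed.

Lemma measv_mulmx0 n d (T : measurableType d) (f : 'cV[R]_n -> T) (M : 'M[R]_n) :
  measv f -> measv (fun x => f (M *m x)).
Proof.
by move=> /(measv_mulmx M 0); under [X in measv X]funext do rewrite addr0.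
Qed.

Lemma lint_ge0 n (f : 'cV[R]_n -> \bar R) : (forall x, 0 <= f x)%E -> (0 <= lint f)%E.
Proof. by move=> f0; exact: integral_ge0. Qed.

Lemma measurable_vec_fst n d (T : measurableType d) i :
  measurable_fun setT (fun z : n.-tuple TR * T => @vec R n z.1 i 0 : TR).
Proof. exact: (measurableT_comp (measurable_coord i) measurable_fst). Qed.

Lemma measurable_vec_snd n d (T : measurableType d) i :
  measurable_fun setT (fun z : T * n.-tuple TR => @vec R n z.2 i 0 : TR).
Proof. exact: (measurableT_comp (measurable_coord i) measurable_snd). Qed.

(* The uniqueness of Haar measure, by Tonelli's theorem for the integral of
   [f x * g (M y + x)]. *)
Lemma lint_mulmx_sym n (f g : 'cV[R]_n -> \bar R) (M : 'M[R]_n) :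
  M \in unitmx -> measv f -> measv g -> (forall x, 0 <= f x)%E -> (forall x, 0 <= g x)%E ->
  (lint f * lint (fun x => g (M *m x)%R) = lint g * lint (fun x => f (M *m x)%R))%E.
Proof.
move=> uM mf mg f0 g0.
have E1 x : lint (fun y => g (M *m y)) = lint (fun y => g (M *m y + x)).
  rewrite -[LHS](@ge0_lint_affine _ _ _ false (invmx M *m x)) //.
    by congr lint; apply/funext => y; rewrite scale1r mulmxDr mulKVmx.
  exact: measv_mulmx0.
have E2 x : lint (fun y => f (M *m y)) = lint (fun y => f (x - M *m y)).
  rewrite -[LHS](@ge0_lint_affine _ _ _ true (invmx M *m x)) //.
    congr lint; apply/funext => y.
    by rewrite expr1 scaleN1r mulmxDr mulKVmx// mulmxN addrC.
  exact: measv_mulmx0.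
have m2 (h : 'cV[R]_n -> \bar R) (a b : R) (N : 'M[R]_n) : measv h ->
    measurable_fun setT (fun z : n.-tuple TR * n.-tuple TR =>
      h (a *: vec z.1 + b *: (N *m vec z.2))).
  move=> mh; apply: (measv_comp mh) => i.
  rewrite (_ : (fun _ => _) = fun z : n.-tuple TR * n.-tuple TR =>
      a * vec z.1 i 0 + b * \sum_j N i j * vec z.2 j 0); last first.
    by apply/funext => z; rewrite mxE; congr (_ + _); rewrite mxE//; congr (_ * _); rewrite mxE.
  apply: measurable_funD; apply: measurable_funM; try exact: measurable_cst.
    exact: measurable_vec_fst.
  apply: measurable_sum => j; apply: measurable_funM; first exact: measurable_cst.
  exact: measurable_vec_snd.
transitivity (\int[lebesgue n]_x \int[lebesgue n]_y (f (vec x) * g (M *m vec y + vec x)%R))%E.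
  rewrite -ge0_integralZr//.
  - apply: eq_integral => x _; rewrite (E1 (vec x)) -ge0_integralZl//.
    exact: measv_mulmx.
  - exact: lint_ge0.
transitivity (\int[lebesgue n]_x \int[lebesgue n]_y (f (vec x - M *m vec y)%R * g (vec x)))%E.
  rewrite (fubini_tonelli (fun z => f (vec z.1) * g (M *m vec z.2 + vec z.1)%R)%E); last 2 first.
  - apply: emeasurable_funM.
      by have := m2 f 1 0 M mf; under eq_fun do rewrite scale1r scale0r addr0.
    by have := m2 g 1 1 M mg; under eq_fun do rewrite !scale1r addrC.
  - by move=> z; exact: mule_ge0.
  rewrite (fubini_tonelli (fun z => f (vec z.1 - M *m vec z.2)%R * g (vec z.1))%E); last 2 first.
  - apply: emeasurable_funM.
      by have := m2 f 1 (-1) M mf; under eq_fun do rewrite scale1r scaleN1r.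
    by have := m2 g 1 0 M mg; under eq_fun do rewrite scale1r scale0r addr0.
  - by move=> z; exact: mule_ge0.
  apply: eq_integral => y _ /=.
  rewrite -[LHS](@ge0_lint_affine _ _ (fun v => f v * g (M *m vec y + v)%R)%E false
    (- (M *m vec y))).
  - by apply: eq_integral => x _; rewrite expr0 scale1r [X in g X]addrC subrK.
  - apply: emeasurable_funM => //; under eq_fun do rewrite addrC.
    have := @measv_mulmx n _ _ g 1%:M (M *m vec y) mg.
    by rewrite /measv/=; under eq_fun do rewrite /= mul1mx.
  - by move=> x; exact: mule_ge0.
rewrite -ge0_integralZr//; last by exact: lint_ge0.
apply: eq_integral => x _; rewrite muleC (E2 (vec x)) -ge0_integralZr//.
have := @measv_mulmx n _ _ f (- M) (vec x) mf.
by rewrite /measv; under eq_fun do rewrite /= mulNmx addrC.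
Qed.

End Jacobian.

(** * Jacobian factors of matrices *)

Section JacobianDet.
Context {R : realType}.
Implicit Types n : nat.
Local Notation TR := (measurableTypeR R).

Lemma measv_prod n (h : R -> R) : measurable_fun setT (h : TR -> TR) ->
  measv (fun x : 'cV[R]_n => \prod_i h (x i 0) : TR).
Proof.
move=> mh; apply: measurable_prod => i _.
exact: (measurableT_comp mh (measurable_coord i)).
Qed.

Lemma lint_prod n (h : R -> R) (a : R) :
  measurable_fun setT (h : TR -> TR) -> (forall x, 0 <= h x) ->
  (\int[lebesgue_measure]_(x in [set: TR]) (h x)%:E = a%:E)%E ->
  lint (fun x : 'cV[R]_n => (\prod_i h (x i 0))%:E) = (a ^+ n)%:E.
Proof.
move=> mh h0 ha; elim: n => [|n IH].
  rewrite /lint; under eq_integral do rewrite big_ord0.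
  by rewrite integral_cst//= diracT mule1.
have p0 m (x : 'cV[R]_m) : (0 <= (\prod_i h (x i 0))%:E)%E.
  by rewrite lee_fin; apply: prodr_ge0.
rewrite ge0_lintS//; last by apply/measurable_EFinP; exact: measv_prod.
have E (x : R) : lint (fun v : 'cV[R]_n =>
    (\prod_(i < 1 + n) h ((col_mx x%:M v : 'cV_(1 + n)) i 0))%:E) =
    ((h x)%:E * (a ^+ n)%:E)%E.
  rewrite -IH -ge0_integralZl//; last by rewrite lee_fin.
    apply: eq_integral => t _; set v := vec t.
    rewrite big_split_ord/= big_ord1 EFinM col_mxEu mxE eqxx mulr1n.
    by congr (_ * _%:E)%E; apply: eq_bigr => i _; rewrite col_mxEd.
  by apply/measurable_EFinP; exact: measv_prod.
under eq_integral do rewrite E.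
rewrite ge0_integralZr//.
- by rewrite ha exprS.
- exact/measurable_EFinP.
- by move=> x _; rewrite lee_fin.
- by rewrite lee_fin exprn_ge0// -lee_fin -ha integral_ge0// => x _; rewrite lee_fin.
Qed.

Definition cube (K : R) n (x : 'cV[R]_n) : R := \prod_i \1_(`[- K, K] : set TR) (x i 0).

Lemma lint_cube n (K : R) : 0 <= K -> lint (fun x : 'cV[R]_n => (cube K x)%:E) = ((K *+ 2) ^+ n)%:E.
Proof.
move=> K0; apply: lint_prod => [|x|].
- by apply: measurable_indic; exact: measurable_itv.
- by rewrite indicE.
- rewrite integral_indic//= setIT lebesgue_measure_itv/= lte_fin.
  case: ltP => [_|]; first by rewrite -EFinB opprK mulr2n.
  by move=> KK; congr EFin; lra.
Qed.

Lemma measv_cube n (K : R) : measv (fun x : 'cV[R]_n => (cube K x)%:E).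
Proof.
apply/measurable_EFinP; apply: measv_prod.
by apply: measurable_indic; exact: measurable_itv.
Qed.

Lemma cube_ge0 n K (x : 'cV[R]_n) : 0 <= cube K x.
Proof. by apply: prodr_ge0 => i _; rewrite indicE. Qed.

Lemma cube_le1 n K (x : 'cV[R]_n) : cube K x <= 1.
Proof.
by apply: prodr_ile1 => i _; rewrite !indicE; case: (_ \in _); rewrite ?lexx ?ler01.
Qed.

Lemma cubeT n K (x : 'cV[R]_n) : (forall i, `|x i 0| <= K) -> cube K x = 1.
Proof.
move=> xK; apply: big1 => i _; rewrite indicE mem_set//=.
by rewrite in_itv/= -ler_norml.
Qed.

Lemma cube_neq0 n K (x : 'cV[R]_n) : cube K x != 0 -> forall i, `|x i 0| <= K.
Proof.
move=> /prodf_neq0 xK i; have := xK i isT; rewrite indicE.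
by case: (boolP (_ \in _)); rewrite ?eqxx// inE/= in_itv/= ler_norml.
Qed.

(** The factor is left as a parameter: its existence is known before it is identified with the
    inverse of the absolute determinant. *)
Definition jacobian n (M : 'M[R]_n) (c : R) := forall f : 'cV[R]_n -> \bar R,
  measv f -> (forall x, 0 <= f x)%E -> (lint (fun x => f (M *m x)) = c%:E * lint f)%E.

Let halfD : (2^-1 : R) *+ 2 = 1.
Proof. by rewrite mulr2n; lra. Qed.

(** The cube of half-side 1/2 has volume 1, so testing on it reads off the factor. *)
Lemma jacobian_lint n (M : 'M[R]_n) c : jacobian M c ->
  lint (fun x => (cube (2^-1) (M *m x))%:E) = c%:E.
Proof.
move=> /(_ (fun x => (cube (2^-1) x)%:E)) ->; last 2 first.
- exact: measv_cube.
- by move=> x; rewrite lee_fin cube_ge0.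
rewrite lint_cube// halfD expr1n mule1//.
Qed.

Lemma jacobian_uniq n (M : 'M[R]_n) c d : jacobian M c -> jacobian M d -> c = d.
Proof. by move=> /jacobian_lint + /jacobian_lint => -> []. Qed.

Lemma jacobianM n (M N : 'M[R]_n) c d : jacobian M c -> jacobian N d -> jacobian (M *m N) (c * d).
Proof.
move=> jM jN f mf f0.
under [X in lint X]funext do rewrite -mulmxA.
by rewrite (jN (fun y => f (M *m y)))// ?jM// ?muleA -?EFinM 1?mulrC//; exact: measv_mulmx0.
Qed.

Lemma jacobian1 n : jacobian (1%:M : 'M[R]_n) 1.
Proof. by move=> f _ _; under [X in lint X]funext do rewrite mul1mx; rewrite mul1e. Qed.

(** [lint_mulmx_sym] against the unit cube gives a factor in the extended reals; it remains to see
    that it is neither infinite nor zero. *)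
Lemma jacobian_ex n (M : 'M[R]_n) : M \in unitmx -> exists2 c, 0 < c & jacobian M c.
Proof.
move=> uM.
pose g : 'cV[R]_n -> \bar R := fun x => (cube (2^-1) x)%:E.
have g0 x : (0 <= g x)%E by rewrite lee_fin cube_ge0.
have mg : measv g by exact: measv_cube.
have g1 : lint g = 1%E by rewrite lint_cube// halfD expr1n.
have E (f : 'cV[R]_n -> \bar R) : measv f -> (forall x, 0 <= f x)%E ->
    (lint (fun x => f (M *m x)) = lint f * lint (fun x => g (M *m x)%R))%E.
  by move=> mf f0; rewrite lint_mulmx_sym// g1 mul1e.
set c := lint (fun x => g (M *m x)) in E.
have c0 : (0 <= c)%E by exact: lint_ge0.
have coo : (c < +oo)%E.
  (* The preimage of the unit cube under M lies in a cube whose size is bounded by the entries of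
     the inverse. *)
  pose K := \sum_i \sum_j `|invmx M i j|.
  have K0 : 0 <= K by do 2 apply: sumr_ge0 => ? _.
  apply: (@le_lt_trans _ _ (lint (fun x : 'cV[R]_n => (cube K x)%:E))); last first.
    by rewrite lint_cube// ltry.
  apply: ge0_le_integral => //.
  - exact: measv_mulmx0.
  - exact: measv_cube.
  move=> t _; rewrite lee_fin; set x := vec t.
  have [->|/cube_neq0 Mx] := eqVneq (cube 2^-1 (M *m x)) 0; first exact: cube_ge0.
  rewrite [leRHS]cubeT ?cube_le1// => i.
  rewrite -[x](mulKmx uM) mxE.
  apply: (le_trans (ler_norm_sum _ _ _)).
  rewrite /K [leRHS](bigD1 i)//=; apply: ler_wpDr.
    by apply: sumr_ge0 => j _; apply: sumr_ge0.
  apply: ler_sum => j _; rewrite normrM ler_piMr//.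
  by apply: (le_trans (Mx j)); rewrite invf_le1// ler1n.
have cfin : c = (fine c)%:E by rewrite fineK// ge0_fin_numE.
exists (fine c); last by move=> f mf f0; rewrite E// muleC -cfin.
rewrite fine_gt0// coo andbT lt0e c0 andbT.
(* A zero factor, applied to the unit cube composed with the inverse of M, would give the unit cube
   volume 0. *)
apply/eqP => cz; have /= := E (fun x => g (invmx M *m x)) (measv_mulmx0 _ mg) (fun=> g0 _).
under [X in lint X]funext do rewrite mulKmx//.
by rewrite g1 cz mule0 => /eqP; rewrite onee_eq0.
Qed.

Definition jacdet n (M : 'M[R]_n) := jacobian M `|\det M|^-1.

Lemma jacdetM n (M N : 'M[R]_n) : jacdet M -> jacdet N -> jacdet (M *m N).
Proof. by rewrite /jacdet det_mulmx normrM invfM => jM jN; exact: jacobianM. Qed.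

(** The factor and the absolute determinant are both nonnegative with square 1, so they agree
    without either being computed. *)
Lemma jacdet_invol n (M : 'M[R]_n) : M *m M = 1%:M -> jacdet M.
Proof.
move=> MM; have uM : M \in unitmx by case/mulmx1_unit: MM.
have [c c0 jM] := jacobian_ex uM; rewrite /jacdet.
have sq1 (x : R) : 0 <= x -> x * x = 1 -> x = 1.
  by move=> x0 /eqP; rewrite -expr2 sqrf_eq1 => /orP[] /eqP // xE; lra.
have -> : `|\det M| = 1.
  by apply: sq1 => //; rewrite -normrM -det_mulmx MM det1 normr1.
have := jacobianM jM jM; rewrite MM => /jacobian_uniq /(_ (@jacobian1 n)) cc.
by rewrite invr1 -(sq1 c)// ltW.
Qed.

(** The factors of both sides give s c = c c s, hence c = 1. This settles the unipotent matrices. *)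
Lemma jacdet_conj n (S N : 'M[R]_n) : S \in unitmx -> \det N = 1 ->
  S *m N = N *m N *m S -> jacdet N.
Proof.
move=> uS dN SN; have uN : N \in unitmx by rewrite unitmxE dN unitr1.
have [c c0 jN] := jacobian_ex uN; have [s s0 jS] := jacobian_ex uS.
have := jacobian_uniq (jacobianM jS jN); rewrite SN.
move=> /(_ _ (jacobianM (jacobianM jN jN) jS)) /eqP.
rewrite mulrC -subr_eq0 -mulrBl mulf_eq0 (gt_eqF s0) orbF subr_eq0 => /eqP cc.
rewrite /jacdet dN normr1 invr1 (_ : 1 = c)//.
by apply: (mulfI (lt0r_neq0 c0)); rewrite mulr1.
Qed.

End JacobianDet.

Section JacobianDetUnit.
Context {R : realType}.
Implicit Types n : nat.
Local Notation TR := (measurableTypeR R).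

Lemma cube_col_mx n K (x : R) (v : 'cV[R]_n) :
  cube K (col_mx x%:M v : 'cV_(1 + n)) = \1_(`[- K, K] : set TR) x * cube K v.
Proof.
rewrite /cube big_split_ord/= big_ord1 col_mxEu mxE eqxx mulr1n.
by congr (_ * _); apply: eq_bigr => i _; rewrite col_mxEd.
Qed.

Lemma integral_indic_scale (a : R) : a != 0 ->
  (\int[lebesgue_measure]_(x in [set: TR])
    (\1_(`[- 2^-1, 2^-1] : set TR) (a * x))%:E = `|a|^-1%:E)%E.
Proof.
move=> a0; have na0 : 0 < `|a| by rewrite normr_gt0.
transitivity (\int[lebesgue_measure]_(x in [set: TR])
    (\1_(`[- (2 * `|a|)^-1, (2 * `|a|)^-1] : set TR) x)%:E)%E.
  apply: eq_integral => x _; congr EFin; rewrite !indicE; congr (_%:R); congr nat_of_bool.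
  by apply/idP/idP; rewrite !inE/= !in_itv/= -!ler_norml normrM invfM
    ler_pdivlMr// [X in X <= _]mulrC.
rewrite integral_indic//= setIT lebesgue_measure_itv/= lte_fin.
rewrite ifT; last by rewrite -subr_gt0 opprK -mulr2n mulrn_wgt0// invr_gt0 mulr_gt0.
rewrite -EFinB opprK -mulr2n invfM -mulrnAl; congr EFin.
by rewrite (_ : 2^-1 *+ 2 = 1) ?mul1r// mulr2n; lra.
Qed.

(** Tested on the unit cube, the integral splits by Tonelli into a scaling of the line and the
    factor of [S]. *)
Lemma jacdet_block n (a : R) (S : 'M[R]_n) : a != 0 -> S \in unitmx -> jacdet S ->
  jacdet (block_mx a%:M 0 0 S : 'M[R]_(1 + n)).
Proof.
move=> a0 uS jS; set B := (block_mx _ _ _ _).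
have dB : \det B = a * \det S by rewrite /B det_ublock det_scalar1.
have uB : B \in unitmx by rewrite unitmxE dB unitrM unitfE a0 -unitmxE.
have [c c0 jB] := jacobian_ex uB.
rewrite /jacdet; suff -> : `|\det B|^-1 = c by [].
apply/esym/EFin_inj; rewrite -(jacobian_lint jB) dB normrM invfM.
have mcb m : measv (fun x : 'cV[R]_m => (cube (2^-1) x)%:E) by exact: measv_cube.
have cb0 m (x : 'cV[R]_m) : (0 <= (cube (2^-1) x)%:E)%E by rewrite lee_fin cube_ge0.
rewrite (ge0_lintS (f := fun x : 'cV[R]_(1 + n) => (cube 2^-1 (B *m x))%:E))//; last first.
  exact: (@measv_mulmx0 _ (1 + n) _ _ (fun x => (cube 2^-1 x)%:E)).
have E (x : R) : lint (fun v : 'cV[R]_n =>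
    (cube 2^-1 (B *m (col_mx x%:M v : 'cV_(1 + n)) : 'cV_(1 + n)))%:E) =
    ((\1_(`[- 2^-1, 2^-1] : set TR) (a * x))%:E * `|\det S|^-1%:E)%E.
  rewrite -(jacobian_lint jS) -ge0_integralZl//; last first.
    exact: (@measv_mulmx0 _ n _ _ (fun x => (cube 2^-1 x)%:E)).
  apply: eq_integral => t _.
  by rewrite mul_block_col !mul0mx addr0 add0r -scalar_mxM cube_col_mx EFinM.
under eq_integral do rewrite E.
rewrite ge0_integralZr//.
- by rewrite integral_indic_scale// -EFinM.
- apply/measurable_EFinP.
  have mi : measurable_fun setT (\1_(`[- 2^-1, 2^-1] : set TR) : TR -> TR).
    by apply: measurable_indic; exact: measurable_itv.
  have ma : measurable_fun setT (fun x : TR => a * (x : R) : TR).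
    by apply: measurable_funM => //; exact: measurable_cst.
  exact: (measurableT_comp mi ma).
Qed.

(* Block elimination; the two unipotent factors are conjugate to their squares
   by a dilation of one block. *)
Lemma jacdet_unit n (M : 'M[R]_n) : M \in unitmx -> jacdet M.
Proof.
elim: n M => [|n IH] M uM.
  rewrite (_ : M = 1%:M); last by apply/matrixP => -[].
  by rewrite /jacdet det1 normr1 invr1; exact: jacobian1.
have H (N : 'M[R]_(1 + n)) : N \in unitmx -> N 0 0 != 0 -> jacdet N.
  move=> uN a0; set a := N 0 0 in a0.
  pose w := dlsubmx N; pose r := ursubmx N; pose S := drsubmx N - a^-1 *: (w *m r).
  pose L : 'M[R]_(1 + n) := block_mx 1%:M 0 (a^-1 *: w) 1%:M.
  pose B : 'M[R]_(1 + n) := block_mx a%:M 0 0 S.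
  pose U : 'M[R]_(1 + n) := block_mx 1%:M (a^-1 *: r) 0 1%:M.
  have aE : ulsubmx N = a%:M.
    by apply/matrixP => i j; rewrite !ord1 !mxE eqxx mulr1n; congr (N _ _); exact/val_inj.
  have NE : N = L *m B *m U.
    rewrite /L /B /U !mulmx_block -[LHS]submxK.
    rewrite !(mulmx0, mul0mx, mul1mx, mulmx1, addr0, add0r) aE.
    rewrite mul_scalar_mx scalerA divff// scale1r.
    rewrite mul_mx_scalar scalerA divff// scale1r; congr block_mx.
    by rewrite -scalemxAr addrC subrK.
  have dL : \det L = 1 by rewrite /L det_lblock !det1 mulr1.
  have dU : \det U = 1 by rewrite /U det_ublock !det1 mulr1.
  have uS : S \in unitmx.
    move: uN; rewrite unitmxE NE !det_mulmx dL dU mul1r mulr1 /B det_ublock det_scalar1.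
    by rewrite unitrM => /andP[_]; rewrite -unitmxE.
  have jB : jacdet B by apply: jacdet_block => //; exact: IH.
  have two : (2 : R) \is a GRing.unit by rewrite unitfE.
  have jL : jacdet L.
    apply: (@jacdet_conj _ _ (block_mx 1%:M 0 0 2%:M : 'M[R]_(1 + n))) => //.
      by rewrite unitmxE det_ublock det1 mul1r det_scalar unitrX.
    rewrite /L !mulmx_block !(mulmx0, mul0mx, mul1mx, mulmx1, addr0, add0r).
    by rewrite mul_scalar_mx scaler_nat mulr2n.
  have jU : jacdet U.
    apply: (@jacdet_conj _ _ (block_mx 2%:M 0 0 1%:M : 'M[R]_(1 + n))) => //.
      by rewrite unitmxE det_ublock det1 mulr1 det_scalar unitrX.
    rewrite /U !mulmx_block !(mulmx0, mul0mx, mul1mx, mulmx1, addr0, add0r).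
    by rewrite mul_scalar_mx scaler_nat mulr2n.
  by rewrite NE; apply: jacdetM => //; exact: jacdetM.
(* Block elimination wants a nonzero pivot; a transposition of rows, which is an involution,
   provides it. *)
have [i Mi] : exists i, M i 0 != 0.
  apply/existsP; rewrite -negb_forall; apply/negP => /forallP M0.
  move: uM; rewrite unitmxE (expand_det_col M 0) big1 ?unitr0// => i _.
  by rewrite (eqP (M0 i)) mul0r.
have tt : tperm_mx i 0 *m tperm_mx i 0 = 1%:M :> 'M[R]_n.+1.
  by rewrite -perm_mxM tperm2 perm_mx1.
have ut : (tperm_mx i 0 : 'M[R]_n.+1) \in unitmx by case/mulmx1_unit: tt.
rewrite -(mul1mx M) -tt -mulmxA; apply: jacdetM; first exact: jacdet_invol.
apply: H; first by rewrite unitmx_mul ut.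
by rewrite -xrowE mxE tpermR.
Qed.

End JacobianDetUnit.

(** * Measurability of continuous maps and affine substitution *)

Section ComplexIntegral.
Context {R : realType}.
Implicit Types n : nat.
Local Notation TR := (measurableTypeR R).

(** Rounding the argument down to the grid of mesh 1/(m+1) makes f a pointwise limit of functions
    with countably many values, each taken on a union of boxes. This links the topology of column
    vectors to the product sigma-algebra of tuples. *)
Lemma continuous_measv n (f : 'cV[R]_n -> R) : continuous f -> measv (f : _ -> TR).
Proof.
move=> cf.
pose q m (x : 'cV[R]_n) : 'cV[R]_n :=
  \col_i ((Num.floor (m.+1%:R * x i 0))%:~R / m.+1%:R).
apply: (@measurable_fun_cvg _ _ _ _ (fun m t => f (q m (vec t)))) => [m|t _].
  move=> _ Y mY; rewrite setTI.
  pose c (k : {ffun 'I_n -> int}) : 'cV[R]_n := \col_i ((k i)%:~R / m.+1%:R).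
  pose F (k : {ffun 'I_n -> int}) : set (n.-tuple TR) :=
    if `[< Y (f (c k)) >] then
      \bigcap_(i in [set: 'I_n]) [set t | Num.floor (m.+1%:R * (vec t) i 0) = k i]
    else set0.
  rewrite (_ : _ @^-1` _ = \bigcup_k F k).
    apply: countable_bigcupT_measurable => [|k]; first exact: countableP.
    rewrite /F; case: ifPn => // _; apply: fin_bigcap_measurable => [|i _].
      exact: finite_finset.
    rewrite (_ : [set _ | _] = (fun t : n.-tuple TR => m.+1%:R * (vec t) i 0 : TR) @^-1`
        [set` `[(k i)%:~R, (k i + 1)%:~R[ ]).
      have mg : measurable_fun setT (fun t : n.-tuple TR => m.+1%:R * (vec t) i 0 : TR).
        by apply: measurable_funM; [exact: measurable_cst|exact: measurable_coord].
      rewrite -[_ @^-1` _]setTI; apply: (mg measurableT); exact: measurable_itv.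
    apply/seteqP; split => t /=; rewrite in_itv/= -floor_eq; first by move=> ->.
    by move/eqP.
  apply/seteqP; split=> [t /= Yt|t [k _]].
    exists [ffun i => Num.floor (m.+1%:R * (vec t) i 0)] => //.
    rewrite /F asboolT; first by move=> i _ /=; rewrite ffunE.
    by move: Yt; congr (Y (f _)); apply/colP => i; rewrite !mxE ffunE mxE.
  rewrite /F; case: asboolP => // Yk /= tk.
  move: Yk; congr (Y (f _)); apply/colP => i; rewrite !mxE.
  by have /= := tk i I; rewrite mxE => ->.
apply: (cvg_comp (fun m => q m (vec t)) f _ (cf (vec t))).
apply/cvgrPdist_lt => e e0; near=> m.
have me : m.+1%:R^-1 < e.
  near: m; exact: (@near_infty_natSinv_lt R (PosNum e0)).
apply: le_lt_trans me; rewrite [leLHS]mx_normrE.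
apply: bigmax_le => [|[i j] _ /=]; first by rewrite invr_ge0.
rewrite (ord1 j) !mxE; set y := tnth t i.
have m0 : 0 < m.+1%:R :> R by rewrite ltr0n.
have /andP[] := floor_itv (m.+1%:R * y); set z := Num.floor _; rewrite intrD => h1 h2.
have -> : y - z%:~R / m.+1%:R = (m.+1%:R * y - z%:~R) / m.+1%:R.
  by rewrite mulrBl mulrAC divff ?mul1r// gt_eqF.
rewrite normrM ger0_norm ?subr_ge0// gtr0_norm ?invr_gt0//.
rewrite ler_piMl ?invr_ge0// lerBlDr addrC ltW//.
Unshelve. all: by end_near. Qed.

Lemma ge0_lint_mulmx n (f : 'cV[R]_n -> \bar R) (M : 'M[R]_n) (a : 'cV[R]_n) :
  M \in unitmx -> measv f -> (forall x, 0 <= f x)%E ->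
  (lint (fun x => f (M *m x + a)%R) = `|\det M|^-1%:E * lint f)%E.
Proof.
move=> uM mf f0; rewrite -(@ge0_lint_affine _ _ f false a)//.
rewrite (@jacdet_unit _ _ M uM (fun x => f (x + a)))//.
  by under [X in (_ = _ * lint X)%E]funext do rewrite expr0 scale1r.
have := @measv_mulmx _ _ _ _ f 1%:M a mf.
by under [X in measv X]funext do rewrite mul1mx.
Qed.

Definition rint n (f : 'cV[R]_n -> R) :=
  (lebesgue n).-integrable setT (fun t => (f (vec t))%:E).

Definition cint n (f : 'cV[R]_n -> R[i]) :=
  rint (fun x => complex.Re (f x)) /\ rint (fun x => complex.Im (f x)).

Definition measC n (f : 'cV[R]_n -> R[i]) :=
  measv (fun x => complex.Re (f x) : TR) /\ measv (fun x => complex.Im (f x) : TR).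

Lemma cint_measC n (f : 'cV[R]_n -> R[i]) : cint f -> measC f.
Proof. by move=> [/measurable_int/measurable_EFinP ? /measurable_int/measurable_EFinP ?]. Qed.

Lemma rint_mulmx n (f : 'cV[R]_n -> R) (M : 'M[R]_n) a : M \in unitmx -> rint f ->
  rint (fun x => f (M *m x + a)) /\
  integR (fun x => f (M *m x + a)) = `|\det M|^-1 * integR f.
Proof.
move=> uM /integrableP[mf foo].
have mf' : measv (fun x => (f x)%:E) := mf.
have d0 : 0 <= `|\det M|^-1 by rewrite invr_ge0.
split.
  apply/integrableP; split; first exact: (@measv_mulmx _ _ _ _ (fun x => (f x)%:E)).
  have := @ge0_lint_mulmx n (fun x => `|(f x)%:E|)%E M a uM; rewrite /lint => ->//.
    by rewrite lte_mul_pinfty ?lee_fin.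
  exact: measurableT_comp.
rewrite /integR /Rintegral [in LHS]integralE [in RHS]integralE.
pose g x := (f x)%:E.
have fi : (lebesgue n).-integrable setT (g \o @vec R n) by apply/integrableP.
have fp := integrable_pos_fin_num measurableT fi.
have fn := integrable_neg_fin_num measurableT fi.
have := measurable_funepos mf; have := measurable_funeneg mf.
rewrite -[fun _ => (f (vec _))%:E]/(g \o @vec R n).
rewrite -[fun _ => (f (_ *m vec _ + _))%:E]/(g \o (fun t => M *m vec t + a)).
move: fp fn; rewrite !(funepos_comp g (@vec R n)) !(funeneg_comp g (@vec R n)).
rewrite (funepos_comp g (fun t => M *m vec t + a)) (funeneg_comp g (fun t => M *m vec t + a)).
move=> fp fn mn mp.
have := @ge0_lint_mulmx n g^\+%E M a uM mp (funepos_ge0 _); rewrite /lint => ->.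
have := @ge0_lint_mulmx n g^\-%E M a uM mn (funeneg_ge0 _); rewrite /lint => ->.
move: fp fn; rewrite /comp/=.
move=> /fineK <- /fineK <-.
by rewrite -!EFinM -!EFinB/= mulrBr.
Qed.

End ComplexIntegral.

Local Open Scope complex_scope.

(** * Complex-valued integrals *)

Section ComplexTools.
Context {R : realType}.
Implicit Types n : nat.
Local Notation TR := (measurableTypeR R).
Local Notation Re := complex.Re.
Local Notation Im := complex.Im.

Lemma cReD (z w : R[i]) : Re (z + w) = Re z + Re w. Proof. by case: z w => ? ? []. Qed.
Lemma cImD (z w : R[i]) : Im (z + w) = Im z + Im w. Proof. by case: z w => ? ? []. Qed.
Lemma cReN (z : R[i]) : Re (- z) = - Re z. Proof. by case: z. Qed.
Lemma cImN (z : R[i]) : Im (- z) = - Im z. Proof. by case: z. Qed.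
Lemma cReM (z w : R[i]) : Re (z * w) = Re z * Re w - Im z * Im w.
Proof. by case: z w => ? ? []. Qed.
Lemma cImM (z w : R[i]) : Im (z * w) = Re z * Im w + Im z * Re w.
Proof. by case: z w => ? ? []. Qed.
Lemma cReJ (z : R[i]) : Re (conjc z) = Re z. Proof. by case: z. Qed.
Lemma cImJ (z : R[i]) : Im (conjc z) = - Im z. Proof. by case: z. Qed.

Lemma complexP (z w : R[i]) : Re z = Re w -> Im z = Im w -> z = w.
Proof. by case: z w => ? ? [? ?] /= -> ->. Qed.

Lemma normc_ge0 (z : R[i]) : 0 <= normc z.
Proof. by case: z => a b; exact: sqrtr_ge0. Qed.

Lemma normcD (z w : R[i]) : normc (z + w) <= normc z + normc w.
Proof. exact: le_normcD. Qed.

Lemma normcNE (z : R[i]) : normc (- z) = normc z.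
Proof. exact: normcN. Qed.

Lemma normcM (z w : R[i]) : normc (z * w) = normc z * normc w.
Proof. exact: ComplexField.Normc.normcM. Qed.

Lemma normcB (z w : R[i]) : normc (z - w) <= normc z + normc w.
Proof. by rewrite -(normcNE w) normcD. Qed.

Lemma normcJE (z : R[i]) : normc (conjc z) = normc z.
Proof. by case: z => a b /=; rewrite sqrrN. Qed.

Lemma normcR (a : R) : normc a%:C = `|a|.
Proof. by rewrite /= expr0n addr0 sqrtr_sqr. Qed.

Lemma normc0E : normc (0 : R[i]) = 0.
Proof. exact: ComplexField.Normc.normc0. Qed.

Lemma normRe_le (z : R[i]) : `|Re z| <= normc z.
Proof. by case: z => a b /=; rewrite -sqrtr_sqr ler_wsqrtr// lerDl sqr_ge0. Qed.

Lemma normIm_le (z : R[i]) : `|Im z| <= normc z.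
Proof. by case: z => a b /=; rewrite -sqrtr_sqr ler_wsqrtr// lerDr sqr_ge0. Qed.

Lemma normc_le (z : R[i]) : normc z <= `|Re z| + `|Im z|.
Proof.
case: z => a b /=; rewrite -[leRHS]ger0_norm ?addr_ge0// -sqrtr_sqr ler_wsqrtr//.
by rewrite sqrrD !real_normK ?num_real// lerD2r lerDl mulrn_wge0 ?mulr_ge0.
Qed.

Lemma normc_expi (t : R) : normc (expi t) = 1.
Proof. by rewrite /= cos2Dsin2 sqrtr1. Qed.

Lemma expi0 : expi (0 : R) = 1.
Proof. by rewrite /expi cos0 sin0. Qed.

Lemma expiD (s t : R) : expi (s + t) = expi s * expi t.
Proof. by apply: complexP; rewrite ?cReM ?cImM /= ?cosD ?sinD//; ring. Qed.

Lemma conj_expi (t : R) : conjc (expi t) = expi (- t).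
Proof. by rewrite /expi cosN sinN. Qed.

Lemma measC_cst n (a : R[i]) : measC (fun _ : 'cV[R]_n => a).
Proof. by split; exact: measurable_cst. Qed.

Lemma measCD n (f g : 'cV[R]_n -> R[i]) : measC f -> measC g -> measC (fun x => f x + g x).
Proof.
move=> [f1 f2] [g1 g2]; split.
  by under [X in measv X]funext do rewrite cReD; exact: measurable_funD.
by under [X in measv X]funext do rewrite cImD; exact: measurable_funD.
Qed.

Lemma measCN n (f : 'cV[R]_n -> R[i]) : measC f -> measC (fun x => - f x).
Proof.
move=> [f1 f2]; split.
  by under [X in measv X]funext do rewrite cReN; exact: (measurableT_comp _ f1).
by under [X in measv X]funext do rewrite cImN; exact: (measurableT_comp _ f2).
Qed.

Lemma measCM n (f g : 'cV[R]_n -> R[i]) : measC f -> measC g -> measC (fun x => f x * g x).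
Proof.
move=> [f1 f2] [g1 g2]; split.
  under [X in measv X]funext do rewrite cReM.
  by apply: measurable_funB; exact: measurable_funM.
under [X in measv X]funext do rewrite cImM.
by apply: measurable_funD; exact: measurable_funM.
Qed.

Lemma measCJ n (f : 'cV[R]_n -> R[i]) : measC f -> measC (fun x => conjc (f x)).
Proof.
move=> [f1 f2]; split; first by under [X in measv X]funext do rewrite cReJ.
by under [X in measv X]funext do rewrite cImJ; exact: (measurableT_comp _ f2).
Qed.

Lemma measCR n (f : 'cV[R]_n -> R) : measv (f : _ -> TR) -> measC (fun x => (f x)%:C).
Proof. by move=> mf; split => //; exact: measurable_cst. Qed.

Lemma measC_mulmx n (f : 'cV[R]_n -> R[i]) (M : 'M[R]_n) a :
  measC f -> measC (fun x => f (M *m x + a)).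
Proof.
move=> [f1 f2]; split.
  exact: (@measv_mulmx _ _ _ _ (fun x => Re (f x) : TR)).
exact: (@measv_mulmx _ _ _ _ (fun x => Im (f x) : TR)).
Qed.

Lemma cint_dom n (f : 'cV[R]_n -> R[i]) (g : 'cV[R]_n -> R) :
  measC f -> (forall x, normc (f x) <= g x) -> rint g -> cint f.
Proof.
move=> [f1 f2] fg ig; split; apply: le_integrable ig => //.
- exact/measurable_EFinP.
- move=> t _; rewrite !abse_EFin lee_fin (le_trans (normRe_le _))// (le_trans (fg _))//.
  exact: ler_norm.
- exact/measurable_EFinP.
- move=> t _; rewrite !abse_EFin lee_fin (le_trans (normIm_le _))// (le_trans (fg _))//.
  exact: ler_norm.
Qed.

Lemma normr_integR n (f g : 'cV[R]_n -> R) :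
  measv (f : _ -> TR) -> (forall x, `|f x| <= g x) -> rint g -> `|integR f| <= integR g.
Proof.
move=> mf fg ig.
have g0 x : 0 <= g x by exact: le_trans (fg x).
have If : rint f.
  apply: le_integrable ig => //; first exact/measurable_EFinP.
  by move=> t _; rewrite !abse_EFin lee_fin (ger0_norm (g0 _)).
apply: (le_trans (le_normr_Rintegral _ If)) => //.
apply: le_Rintegral => //.
exact: integrable_norm.
Qed.

(** The factor 2 comes from bounding the real and imaginary parts separately. *)
Lemma normc_integC n (f : 'cV[R]_n -> R[i]) (g : 'cV[R]_n -> R) :
  measC f -> (forall x, normc (f x) <= g x) -> rint g -> normc (integC f) <= 2 * integR g.
Proof.
move=> [f1 f2] fg ig; apply: (le_trans (normc_le _)); rewrite /= mulr_natl mulr2n lerD//.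
  by apply: normr_integR => // x; exact: le_trans (normRe_le _) _.
by apply: normr_integR => // x; exact: le_trans (normIm_le _) _.
Qed.

Lemma cintD n (f g : 'cV[R]_n -> R[i]) : cint f -> cint g ->
  cint (fun x => f x + g x) /\ integC (fun x => f x + g x) = integC f + integC g.
Proof.
move=> [f1 f2] [g1 g2].
rewrite /cint /integC; under [fun x => Re _]funext do rewrite cReD.
under [fun x => Im _]funext do rewrite cImD.
split; first by split; [exact: (integrableD _ f1 g1)|exact: (integrableD _ f2 g2)].
by apply: complexP; rewrite ?cReD ?cImD/=; exact: RintegralD.
Qed.

Lemma cintZ n (a : R[i]) (f : 'cV[R]_n -> R[i]) : cint f ->
  cint (fun x => a * f x) /\ integC (fun x => a * f x) = a * integC f.
Proof.
move=> [f1 f2].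
have Z (b : R) (h : 'cV[R]_n -> R) : rint h -> rint (fun x => b * h x) /\
    integR (fun x => b * h x) = b * integR h.
  move=> ih; split; first exact: (integrableZl _ b ih).
  exact: RintegralZl.
have B (h k : 'cV[R]_n -> R) : rint h -> rint k -> rint (fun x => h x - k x) /\
    integR (fun x => h x - k x) = integR h - integR k.
  by move=> ih ik; split; [exact: (integrableB _ ih ik)|exact: RintegralB].
have D (h k : 'cV[R]_n -> R) : rint h -> rint k -> rint (fun x => h x + k x) /\
    integR (fun x => h x + k x) = integR h + integR k.
  by move=> ih ik; split; [exact: (integrableD _ ih ik)|exact: RintegralD].
rewrite /cint /integC; under [fun x => Re _]funext do rewrite cReM.
under [fun x => Im _]funext do rewrite cImM.
have [r1 e1] := Z (Re a) _ f1; have [r2 e2] := Z (Im a) _ f2.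
have [r3 e3] := Z (Re a) _ f2; have [r4 e4] := Z (Im a) _ f1.
have [r5 e5] := B _ _ r1 r2; have [r6 e6] := D _ _ r3 r4.
split=> //; apply: complexP; rewrite ?cReM ?cImM /=.
  by rewrite e5 e1 e2.
by rewrite e6 e3 e4.
Qed.

Lemma cintN n (f : 'cV[R]_n -> R[i]) : cint f ->
  cint (fun x => - f x) /\ integC (fun x => - f x) = - integC f.
Proof.
by move=> /(cintZ (-1)); rewrite mulN1r; under [fun x => _ * _]funext do rewrite mulN1r.
Qed.

Lemma cintB n (f g : 'cV[R]_n -> R[i]) : cint f -> cint g ->
  cint (fun x => f x - g x) /\ integC (fun x => f x - g x) = integC f - integC g.
Proof. by move=> cf /cintN[cg <-]; exact: cintD. Qed.

Lemma cint_mulmx n (f : 'cV[R]_n -> R[i]) (M : 'M[R]_n) a : M \in unitmx -> cint f ->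
  cint (fun x => f (M *m x + a)) /\
  integC (fun x => f (M *m x + a)) = (`|\det M|^-1)%:C * integC f.
Proof.
move=> uM [f1 f2].
have [r1 e1] := rint_mulmx a uM f1; have [r2 e2] := rint_mulmx a uM f2.
split=> //; rewrite /integC e1 e2; apply: complexP; rewrite ?cReM ?cImM/=; ring.
Qed.

Lemma cint_shift n (f : 'cV[R]_n -> R[i]) a : cint f ->
  cint (fun x => f (x + a)) /\ integC (fun x => f (x + a)) = integC f.
Proof.
move=> /(@cint_mulmx n _ 1%:M a); rewrite unitmx1 det1 normr1 invr1 mul1r => /(_ isT).
by under [fun x => f _]funext do rewrite mul1mx.
Qed.

(** Up to a constant, the product of Cauchy densities: an integrable majorant with factorised
    integral, against which every decay estimate is finally compared. *)
Definition bweight n (x : 'cV[R]_n) : R := \prod_i (1 + x i 0 ^+ 2)^-1.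

Lemma bweight_gt0 n (x : 'cV[R]_n) : 0 < bweight x.
Proof. by apply: prodr_gt0 => i _; rewrite invr_gt0 ltr_pwDl// sqr_ge0. Qed.

Lemma bweight_le1 n (x : 'cV[R]_n) : bweight x <= 1.
Proof.
apply: prodr_ile1 => i _.
by rewrite invr_ge0 invf_le1 ?addr_ge0 ?sqr_ge0// ?ltr_pwDl ?sqr_ge0// lerDl sqr_ge0.
Qed.

Lemma lint_bweight n : lint (fun x : 'cV[R]_n => (bweight x)%:E) = (pi ^+ n)%:E.
Proof.
have m1 : measurable_fun setT (fun x : TR => (1 + (x : R) ^+ 2)^-1 : TR).
  exact: (continuous_measurable_fun (@continuous_oneDsqrV R)).
have h0 (x : R) : 0 <= (1 + x ^+ 2)^-1 by rewrite invr_ge0 addr_ge0// sqr_ge0.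
apply: (@lint_prod _ _ (fun x => (1 + x ^+ 2)^-1)) => //.
have m1E : measurable_fun setT (fun x : TR => ((1 + (x : R) ^+ 2)^-1)%:E).
  exact/measurable_EFinP.
rewrite (_ : [set: TR] = `]-oo, 0%R] `|` `]0%R, +oo[); last first.
  by apply/seteqP; split=> // x _ /=; rewrite !in_itv/= andbT; case: (leP x 0); [left|right].
rewrite ge0_integral_setU//=.
- have e : (\int[lebesgue_measure]_(x in `[0%R, +oo[) ((1 + (x : R) ^+ 2)^-1)%:E =
      (pi / 2)%:E)%E := integral0y_oneDsqr R.
  rewrite integral_itv_obnd_cbnd; last exact: measurable_funS m1E.
  have : (\int[lebesgue_measure]_(x in `]-oo, 0%R]) ((1 + (x : R) ^+ 2)^-1)%:E = (pi / 2)%:E)%E.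
    rewrite -e (ge0_integration_by_substitution0 m1E)//.
    by apply: eq_integral => x _; rewrite sqrrN.
  move=> ->.
  rewrite [X in (_ + X)%E](_ : _ = (pi / 2)%:E)//.
  by rewrite -EFinD; congr EFin; lra.
- exact: measurable_funS m1E.
- by move=> x _; rewrite lee_fin.
- apply/disj_setPS => x []/=; rewrite !in_itv/= andbT => x0 x1.
  by have := le_lt_trans x0 x1; rewrite ltxx.
Qed.

Lemma measv_bweight n : measv (fun x : 'cV[R]_n => bweight x : TR).
Proof.
apply: (@measv_prod _ _ (fun x => (1 + x ^+ 2)^-1)).
exact: (continuous_measurable_fun (@continuous_oneDsqrV R)).
Qed.

Lemma rint_bweight n : rint (@bweight n).
Proof.
apply/integrableP; split; first by apply/measurable_EFinP; exact: measv_bweight.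
under eq_integral do rewrite abse_EFin ger0_norm ?ltW ?bweight_gt0//.
by have := @lint_bweight n; rewrite /lint => ->; rewrite ltry.
Qed.

Lemma rintZ n (a : R) (f : 'cV[R]_n -> R) : rint f -> rint (fun x => a * f x).
Proof. by move=> ih; exact: (integrableZl _ a ih). Qed.

End ComplexTools.

(** * Sinc multipliers and Fourier transforms *)

Section Sinc.
Context {R : realType}.
Local Notation TR := (measurableTypeR R).

Definition sinc (a : R) : R := if a == 0 then 1 else sin a / a.

(** Sinc as an average of cosines: this makes multiplication by a sinc an average of modulations,
    and it bounds sinc by 1. *)
Lemma integral_cos_sinc (a : R) :
  (\int[lebesgue_measure]_(s in `[0%R, 1%R]) (cos (a * s))%:E = (sinc a)%:E)%E.
Proof.
rewrite /sinc; case: eqVneq => [->|a0].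
  under eq_integral do rewrite mul0r cos0.
  rewrite integral_cst//= lebesgue_measure_itv/= lte_fin ltr01 mul1e.
  by rewrite -EFinB subr0.
have dF (x : R) : is_derive x 1 (fun s : R => sin (a * s) / a) (cos (a * x)).
  apply: is_derive_eq; rewrite ?scaler0 ?add0r /GRing.scale/= ?mulr1 ?addr0 ?mulr0 ?mul0r ?add0r.
  by field.
pose F (s : R) := sin (a * s) / a.
have cF : continuous F.
  by move=> x; apply/differentiable_continuous/derivable1_diffP; have [] := dF x.
rewrite (@continuous_FTC2 _ _ F)//.
- by rewrite /F mulr0 sin0 mul0r mulr1 sube0.
- apply: continuous_subspaceT => x.
  apply: (continuous_comp (f := fun s : R => a * s)); last exact: continuous_cos.
  by apply: continuousM; [exact: cst_continuous|exact: cvg_id].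
- split.
  + by move=> x _; have [] := dF x.
  + by apply: cvg_at_right_filter; exact: cF.
  + by apply: cvg_at_left_filter; exact: cF.
- by move=> x _; rewrite derive1E; apply: derive_val.
Qed.

Lemma measurable_sinc : measurable_fun setT (sinc : TR -> TR).
Proof.
rewrite -(setUv [set 0]); apply/measurable_funU => //.
  by apply: measurableC; exact: measurable_set1.
split; first exact: measurable_fun_set1.
apply: (@eq_measurable_fun _ _ _ _ _ (fun a : TR => sin a * a^-1)).
  by move=> a; rewrite inE/= /sinc => /eqP/negbTE ->.
apply: measurable_funM.
  exact: (measurable_funTS (continuous_measurable_fun (@continuous_sin R))).
apply: open_continuous_measurable_fun.
  exact/closed_openC/accessible_closed_set1/hausdorff_accessible/Rhausdorff.
by move=> x; rewrite inE/= => /eqP x0; exact: inv_continuous.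
Qed.

Lemma norm_sinc_le1 a : `|sinc a| <= 1.
Proof.
rewrite -lee_fin -abse_EFin -integral_cos_sinc.
apply: le_trans (le_abse_integral _ _ _) _ => //.
  apply/measurable_EFinP; apply: measurable_funTS.
  apply: continuous_measurable_fun => x.
  apply: (continuous_comp (f := fun s : R => a * s)); last exact: continuous_cos.
  by apply: continuousM; [exact: cst_continuous|exact: cvg_id].
apply: (@le_trans _ _ (\int[lebesgue_measure]_(s in `[0%R, 1%R]) (cst 1%E (s : TR)))%E).
  apply: ge0_le_integral => //.
    apply: measurableT_comp => //; apply/measurable_EFinP; apply: measurable_funTS.
    apply: continuous_measurable_fun => x.
    apply: (continuous_comp (f := fun s : R => a * s)); last exact: continuous_cos.
    by apply: continuousM; [exact: cst_continuous|exact: cvg_id].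
  by move=> s _; rewrite abse_EFin lee_fin cos_max.
by rewrite integral_cst//= lebesgue_measure_itv/= lte_fin ltr01 mul1e -EFinB subr0.
Qed.

(** Adds the squares of two quantities bounded by 1, namely [sinc a] and [a * sinc a], the latter
    being a sine. *)
Lemma sinc_sqr_le a : sinc a ^+ 2 <= 2 / (1 + a ^+ 2).
Proof.
rewrite ler_pdivlMr; last by rewrite ltr_pwDl// sqr_ge0.
rewrite mulrDr mulr1 -exprMn [2](_ : _ = 1 + 1); last by ring.
have h x : `|x| <= 1 -> x ^+ 2 <= 1 :> R.
  by move=> x1; rewrite -real_normK ?num_real// expr_le1.
apply: lerD; apply: h; first exact: norm_sinc_le1.
rewrite /sinc; case: eqVneq => [->|a0]; first by rewrite mulr0 normr0.
by rewrite divfK// sin_max.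
Qed.

Lemma sinc_sqr_gt0 a : `|a| <= 1 -> 0 < sinc a ^+ 2.
Proof.
move=> a1; suff s0 : sinc a != 0 by rewrite lt_neqAle sqr_ge0 andbT eq_sym expf_eq0.
rewrite /sinc; case: (eqVneq a 0) => [_|a0]; first by rewrite oner_eq0.
rewrite mulf_neq0 ?invr_eq0//.
have pi2 : 2 <= pi :> R by exact: pi_ge2.
have [ap|an] := ltP 0 a.
  rewrite gt_eqF// sin_gt0_pi// ap/=; move: a1; rewrite ler_norml => /andP[_]; lra.
rewrite -oppr_eq0 -sinN gt_eqF// sin_gt0_pi//; apply/andP; split.
  by rewrite oppr_gt0 lt_neqAle a0.
by move: a1; rewrite ler_norml => /andP[]; lra.
Qed.

Lemma integR_sinc n (r : 'cV[R]_n -> R) (i : 'I_n) (c : R) : rint r ->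
  (forall s, 0 <= s <= 1 -> integR (fun x => r x * cos (c * s * x i 0)) = 0) ->
  integR (fun x => r x * sinc (c * x i 0)) = 0.
Proof.
move=> ir h; have mr := measurable_int _ ir; have mr' := mr; move/measurable_EFinP in mr'.
(* The indicator of [0, 1] extends the average to the whole line, so that Fubini is applied on a
   full product space. *)
pose F (z : n.-tuple TR * TR) : \bar R :=
  (r (vec z.1) * cos (c * z.2 * (vec z.1) i 0) * \1_(`[0, 1] : set TR) z.2)%:E.
have mI : measurable_fun setT (\1_(`[0, 1] : set TR) : TR -> TR).
  by apply: measurable_indic; exact: measurable_itv.
have mcos : measurable_fun setT (cos : TR -> TR).
  exact: (continuous_measurable_fun (@continuous_cos R)).
have mF : measurable_fun setT F.
  apply/measurable_EFinP; apply: measurable_funM; last exact: (measurableT_comp mI measurable_snd).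
  apply: measurable_funM; first exact: (measurableT_comp mr' measurable_fst).
  apply: (measurableT_comp mcos); apply: measurable_funM; last exact: measurable_vec_fst.
  by apply: measurable_funM => //; exact: measurable_cst.
have iF : (lebesgue n \x lebesgue_measure)%E.-integrable setT F.
  apply/integrable12ltyP => //.
  have /integrableP[_] := ir; apply: le_lt_trans.
  apply: ge0_le_integral => //.
  - by move=> t _; exact: integral_ge0.
  - apply: (measurable_fun_fubini_tonelli_F (fun z => `|F z|%E)) => //.
    exact: measurableT_comp.
  - exact: measurableT_comp.
  move=> t _.
  apply: (@le_trans _ _ (\int[lebesgue_measure]_(s in [set: TR])
      (`|(r (vec t))%:E| * (\1_(`[0%R, 1%R] : set TR) s)%:E))%E).
    apply: ge0_le_integral => //.
    - by apply: measurableT_comp => //; exact: measurable_fun_pair2.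
    - apply: emeasurable_funM; first exact: measurable_cst.
      exact/measurable_EFinP.
    move=> s _; rewrite /F !abse_EFin -EFinM lee_fin !normrM/= [X in _ * X]ger0_norm ?indicE//.
    by rewrite ler_wpM2r// ler_piMr// cos_max.
  rewrite ge0_integralZl//; last exact/measurable_EFinP.
  rewrite integral_indic//= setIT lebesgue_measure_itv/= lte_fin ltr01 -EFinB subr0.
  by rewrite mule1.
have := Fubini iF.
rewrite [X in _ = X](_ : _ = 0%E).
  rewrite /integR /Rintegral => e.
  rewrite [X in fine X](_ : _ = (\int[lebesgue n]_x \int[lebesgue_measure]_y F (x, y))%E).
    by rewrite e.
  apply: eq_integral => t _; rewrite /F/= EFinM -integral_cos_sinc.
  rewrite [X in (_ * X)%E]integral_mkcond -integralZl//.
    apply: eq_integral => s _; rewrite patchE indicE.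
    rewrite [c * s * _]mulrAC; case: ifPn => _; first by rewrite mulr1 EFinM.
    by rewrite mulr0 mule0.
  apply: (proj1 (integrable_mkcond _ _)) => //.
  apply: (@continuous_compact_integrable _ (fun s => cos (c * (vec t) i 0 * s))).
    exact: segment_compact.
  apply: continuous_subspaceT => x.
  apply: (continuous_comp (f := fun s : R => (c * (vec t) i 0) * s)); last exact: continuous_cos.
  by apply: continuousM; [exact: cst_continuous|exact: cvg_id].
apply: integral0_eq => s _; rewrite /F/= indicE.
have [s01|_] := boolP (s \in _); last first.
  by rewrite integral0_eq// => t _; rewrite mulr0.
under eq_integral do rewrite mulr1.
have := h s; rewrite /integR /Rintegral; move: s01; rewrite inE/= in_itv/= => s01 /(_ s01).
set I := (\int[_]_x _)%E => I0.
suff : I \is a fin_num by move=> /fineK <-; rewrite I0.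
apply: integrable_fin_num => //.
apply: le_integrable ir => //.
  apply/measurable_EFinP; apply: measurable_funM => //.
  apply: (measurableT_comp mcos); apply: measurable_funM; first exact: measurable_cst.
  exact: measurable_coord.
by move=> t _; rewrite !abse_EFin lee_fin normrM ler_piMr// cos_max.
Qed.

End Sinc.

(** * Spectral holes under sinc multiplication and affine maps *)

Section FourierSupport.
Context {R : realType} {n : nat}.
Local Notation TR := (measurableTypeR R).
Local Notation E := 'cV[R]_n.+1.
Local Notation Re := complex.Re.
Local Notation Im := complex.Im.
Implicit Types (f g Phi psi : E -> R[i]) (x y xi eta kappa : E).

Lemma dotvDr x y z : dotv x (y + z) = dotv x y + dotv x z.
Proof. by rewrite /dotv -big_split; apply: eq_bigr => i _; rewrite mxE mulrDr. Qed.

Lemma dotvDl x y z : dotv (x + y) z = dotv x z + dotv y z.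
Proof. by rewrite /dotv -big_split; apply: eq_bigr => i _; rewrite mxE mulrDl. Qed.

Lemma dotvZr (a : R) x y : dotv x (a *: y) = a * dotv x y.
Proof. by rewrite /dotv mulr_sumr; apply: eq_bigr => i _; rewrite mxE mulrCA. Qed.

Lemma dotvC x y : dotv x y = dotv y x.
Proof. by rewrite /dotv; apply: eq_bigr => i _; rewrite mulrC. Qed.

Lemma dotvNl x y : dotv (- x) y = - dotv x y.
Proof. by rewrite /dotv -sumrN; apply: eq_bigr => i _; rewrite mxE mulNr. Qed.

Lemma dotv_delta x i : dotv x (delta_mx i 0) = x i 0.
Proof.
rewrite /dotv (bigD1 i)//= mxE !eqxx mulr1 big1 ?addr0// => j ji.
by rewrite mxE (negbTE ji) mulr0.
Qed.

Lemma dotvE x y : dotv x y = (x^T *m y) 0 0.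
Proof. by rewrite mxE; apply: eq_bigr => i _; rewrite mxE. Qed.

Lemma dotv_mulmx (M : 'M[R]_n.+1) x y : dotv (M *m x) y = dotv x (M^T *m y).
Proof. by rewrite !dotvE trmx_mul mulmxA. Qed.

Lemma measv_dotv eta : measv (fun x => dotv x eta : TR).
Proof.
apply: measurable_sum => i; apply: measurable_funM; last exact: measurable_cst.
exact: measurable_coord.
Qed.

Lemma measC_expi (a : R) eta : measC (fun x => expi (a * dotv x eta)).
Proof.
have m : measv (fun x => a * dotv x eta : TR).
  by apply: measurable_funM; [exact: measurable_cst|exact: measv_dotv].
by split; apply: (measurableT_comp _ m); apply: continuous_measurable_fun;
  [exact: continuous_cos|exact: continuous_sin].
Qed.

Lemma cintMb f g (K : R) : cint f -> measC g -> (forall x, normc (g x) <= K) ->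
  cint (fun x => f x * g x).
Proof.
move=> cf mg gK; have [f1 f2] := cf.
apply: (@cint_dom _ _ _ (fun x => K * (`|Re (f x)| + `|Im (f x)|))).
- by apply: measCM => //; exact: cint_measC.
- move=> x; rewrite normcM mulrC ler_pM ?normc_ge0//; exact: normc_le.
- apply: rintZ; have g1 : rint (fun x => `|Re (f x)|) by exact: integrable_norm f1.
  have g2 : rint (fun x => `|Im (f x)|) by exact: integrable_norm f2.
  exact: (integrableD measurableT g1 g2).
Qed.

Lemma Re_integC f : Re (integC f) = integR (fun x => Re (f x)). Proof. by []. Qed.

Lemma Im_integC f : Im (integC f) = integR (fun x => Im (f x)). Proof. by []. Qed.

Lemma ReMr (z : R[i]) (a : R) : Re (z * a%:C) = Re z * a.
Proof. by rewrite cReM/= mulr0 subr0. Qed.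

Lemma ImMr (z : R[i]) (a : R) : Im (z * a%:C) = Im z * a.
Proof. by rewrite cImM/= mulr0 add0r. Qed.

(** The hole is a cube in the sup norm because each sinc acts on a single coordinate and then
    shrinks it by a fixed amount. The sign of the exponential is the one suited to conjugates of
    psi. *)
Definition vanish Phi xi (a : R) := forall eta, (forall i, `|eta i 0 - xi i 0| <= a) ->
  integC (fun x => Phi x * expi (2 * pi * dotv x eta)) = 0.

Lemma cint_expi Phi (a : R) eta : cint Phi -> cint (fun x => Phi x * expi (a * dotv x eta)).
Proof.
move=> cP; apply: (cintMb (K := 1)) => //; first exact: measC_expi.
by move=> x; rewrite normc_expi.
Qed.

(* Multiplication by the sinc averages the Fourier transform over a segment of
   half-length [d], by [integral_cos_sinc]. *)
Lemma vanish_sinc Phi xi (a d : R) i : cint Phi -> 0 <= d -> vanish Phi xi a ->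
  vanish (fun x => Phi x * (sinc (2 * pi * d * x i 0))%:C) xi (a - d).
Proof.
move=> cP d0 vP eta eta_le.
have vcos (s : R) : 0 <= s <= 1 -> integC (fun x => Phi x * expi (2 * pi * dotv x eta) *
    (cos (2 * pi * d * s * x i 0))%:C) = 0.
  move=> /andP[s0 s1].
  (* Used with e = 1 and e = -1: the cosine is the half-sum of two modulations, and both shifted
     frequencies stay in the original cube. *)
  have H (e : R) : `|e| <= 1 ->
      integC (fun x => Phi x * expi (2 * pi * dotv x (eta + (e * s * d) *: delta_mx i 0))) = 0.
    move=> e1; apply: vP => k; rewrite !mxE eqxx andbT addrAC.
    apply: (le_trans (ler_normD _ _)); rewrite -[leRHS](subrK d) lerD//.
    rewrite !normrM (ger0_norm s0) (ger0_norm d0).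
    have k1 : `|(k == i)%:R| <= 1 :> R by case: (k == i); rewrite ?normr1 ?normr0.
    apply: (le_trans (ler_piMr _ k1)); first by rewrite !mulr_ge0.
    by apply: ler_piMl => //; exact: mulr_ile1.
  have c1 e := cint_expi (2 * pi) (eta + (e * s * d) *: delta_mx i 0) cP.
  have [c2 e2] := cintD (c1 1) (c1 (-1)).
  have [_ e3] := cintZ (2^-1) c2.
  rewrite !H ?normrN1 ?normr1// addr0 in e2; rewrite e2 mulr0 in e3.
  rewrite -[RHS]e3; congr integC; apply/funext => x.
  rewrite !dotvDr !dotvZr dotv_delta !(mulrDr (2 * pi)) !expiD.
  set z := Phi x; set w := expi (2 * pi * dotv x eta).
  have -> : 2 * pi * (1 * s * d * x i 0) = 2 * pi * d * s * x i 0 by ring.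
  have -> : 2 * pi * (-1 * s * d * x i 0) = - (2 * pi * d * s * x i 0) by ring.
  set t := _ * x i 0.
  have -> : (cos t)%:C = 2^-1 * (expi t + expi (- t)).
    apply: (mulfI (_ : 2 != 0 :> R[i])); first by rewrite pnatr_eq0.
    rewrite mulVKf ?pnatr_eq0//.
    apply: complexP; rewrite ?cReD ?cImD ?mulr_natl ?mulr2n ?cReD ?cImD/=.
      by rewrite cosN.
    by rewrite sinN; ring.
  by ring.
have ci := cint_expi (2 * pi) eta cP; have [i1 i2] := ci.
rewrite (_ : (fun x => _) = (fun x => Phi x * expi (2 * pi * dotv x eta) *
    (sinc (2 * pi * d * x i 0))%:C)); last by apply/funext => x; rewrite mulrAC.
apply: complexP; rewrite ?Re_integC ?Im_integC.
  under [X in integR X]funext do rewrite ReMr.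
  apply: (@integR_sinc _ _ (fun x => Re (Phi x * expi (2 * pi * dotv x eta)))) => // s s01.
  have /(congr1 (@complex.Re R)) := vcos s s01; rewrite Re_integC => e; rewrite -[RHS]/(Re 0) -e.
  by congr integR; apply/funext => x; rewrite ReMr.
under [X in integR X]funext do rewrite ImMr.
apply: (@integR_sinc _ _ (fun x => Im (Phi x * expi (2 * pi * dotv x eta)))) => // s s01.
have /(congr1 (@complex.Im R)) := vcos s s01; rewrite Im_integC => e; rewrite -[RHS]/(Im 0) -e.
by congr integR; apply/funext => x; rewrite ImMr.
Qed.

Lemma measv_sinc (d : R) i : measv (fun x => sinc (d * x i 0) : TR).
Proof.
apply: (measurableT_comp measurable_sinc); apply: measurable_funM; first exact: measurable_cst.
exact: measurable_coord.
Qed.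

Lemma vanish_prod Phi xi (a d : R) (s : seq 'I_n.+1) : cint Phi -> 0 <= d ->
  vanish Phi xi a ->
  vanish (fun x => Phi x * (\prod_(i <- s) sinc (2 * pi * d * x i 0))%:C) xi (a - (size s)%:R * d).
Proof.
elim: s Phi a => [|i s IH] Phi a cP d0 vP.
  rewrite mul0r subr0; under [X in vanish X]funext do rewrite big_nil mulr1.
  exact: vP.
rewrite (_ : a - _ = (a - d) - (size s)%:R * d); last by rewrite /= -natr1; ring.
under [X in vanish X]funext do rewrite big_cons rmorphM mulrA.
apply: IH => //; last exact: vanish_sinc.
apply: (cintMb (K := 1)) => //; first by apply: measCR; exact: measv_sinc.
by move=> x; rewrite normcR norm_sinc_le1.
Qed.

(** Even powers keep the weight nonnegative, so that integrals against it cannot cancel. *)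
Definition sincw (d : R) (m : nat) x : R := \prod_i (sinc (2 * pi * d * x i 0) ^+ 2) ^+ m.

(** Each of the n+1 coordinates contributes 2m factors and each factor costs d of the half-side; the
    hypothesis on d ensures that the centre xi survives. *)
Lemma vanish_sincw Phi xi (a d : R) m : cint Phi -> 0 <= d -> (n.+1 * m.*2)%:R * d <= a ->
  vanish Phi xi a ->
  integC (fun x => expi (2 * pi * dotv x xi) * (sincw d m x)%:C * Phi x) = 0.
Proof.
move=> cP d0 da vP.
pose s := flatten [seq nseq m.*2 i | i <- enum 'I_n.+1].
have ss : size s = (n.+1 * m.*2)%N.
  rewrite /s -[in RHS](size_enum_ord n.+1); elim: (enum _) => //= i l IH.
  by rewrite size_cat size_nseq IH mulSn.
have := @vanish_prod Phi xi a d s cP d0 vP xi.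
have -> // : (fun x => Phi x * (\prod_(i <- s) sinc (2 * pi * d * x i 0))%:C *
    expi (2 * pi * dotv x xi)) = (fun x => expi (2 * pi * dotv x xi) * (sincw d m x)%:C * Phi x).
  apply/funext => x; rewrite [LHS]mulrC mulrA mulrAC; congr (_ * _%:C * _).
  rewrite /s big_flatten big_map /sincw -big_enum/=; apply: eq_bigr => i _.
  by rewrite big_nseq iter_mulr_1 -exprM mul2n.
by apply => i; rewrite subrr normr0 ss subr_ge0.
Qed.

Lemma cintJ f : cint f ->
  cint (fun x => conjc (f x)) /\ integC (fun x => conjc (f x)) = conjc (integC f).
Proof.
move=> cf; have [f1 f2] := cf; have [[_ g2] /(congr1 (@complex.Im R)) e] := cintN cf; split.
  split; first by under [X in rint X]funext do rewrite cReJ.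
  by under [X in rint X]funext do rewrite cImJ -cImN.
apply: complexP; first by rewrite cReJ !Re_integC; congr integR; apply/funext => x; rewrite cReJ.
by rewrite cImJ -cImN -e !Im_integC; congr integR; apply/funext => x; rewrite cImJ cImN.
Qed.

Lemma pder0 psi : pder (fun=> 0%N) psi = psi.
Proof. by rewrite /pder; elim: (enum _). Qed.

(** The product of the 1 + x_i^2 expands into finitely many monomials, indexed by subsets of the
    coordinates, each controlled by one Schwartz seminorm. *)
Lemma schwartz_bweight psi : schwartz psi ->
  exists2 C : R, 0 <= C & forall x, normc (psi x) <= C * bweight x.
Proof.
move=> [_ dec].
pose al (b : {ffun 'I_n.+1 -> bool}) i : nat := if b i then 2 else 0.
have /choice[M HM] : forall b, exists M : R, forall x, normc ((monom (al b) x)%:C * psi x) <= M.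
  by move=> b; have [M] := dec (al b) (fun=> 0%N); rewrite pder0; exists M.
have M0 b : 0 <= M b by apply: le_trans (HM b 0); exact: normc_ge0.
exists (\sum_b M b); first exact: sumr_ge0.
move=> x.
have px : 0 < \prod_i (1 + x i 0 ^+ 2) by apply: prodr_gt0 => i _; rewrite ltr_pwDl// sqr_ge0.
rewrite /bweight prodfV ler_pdivlMr//.
have -> : \prod_i (1 + x i 0 ^+ 2) = \sum_b monom (al b) x.
  transitivity (\prod_i \sum_(b : bool) (if b then x i 0 ^+ 2 else 1)).
    by apply: eq_bigr => i _; rewrite big_bool/= addrC.
  rewrite bigA_distr_bigA; apply: eq_bigr => b _; apply: eq_bigr => i _.
  by rewrite /al; case: (b i); rewrite ?expr0.
rewrite mulr_sumr; apply: ler_sum => b _; apply: le_trans (HM b x).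
by rewrite normcM normcR mulrC ler_wpM2r ?normc_ge0// ler_norm.
Qed.

Lemma schwartz_measC psi : schwartz psi -> measC psi.
Proof. by move=> [/(_ [::]) /= [c1 c2 _] _]; split; exact: continuous_measv. Qed.

Lemma schwartz_cint psi : schwartz psi -> cint psi.
Proof.
move=> sp; have [C C0 h] := schwartz_bweight sp.
apply: cint_dom (schwartz_measC sp) h _; apply: rintZ; exact: rint_bweight.
Qed.

Lemma conjc_mul (z w : R[i]) : conjc (z * w) = conjc z * conjc w.
Proof. by apply: complexP; rewrite ?cReJ ?cImJ ?cReM ?cImM ?cReJ ?cImJ; ring. Qed.

(** Substituting y = M x - kappa turns the integral into a unimodular multiple of the conjugate of
    the Fourier transform at the transformed frequency, up to the Jacobian. *)
Lemma fourier_affine psi (M : 'M[R]_n.+1) kappa eta : schwartz psi -> M \in unitmx ->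
  fourier psi ((invmx M)^T *m eta) = 0 ->
  cint (fun x => conjc (psi (M *m x - kappa))) /\
  integC (fun x => conjc (psi (M *m x - kappa)) * expi (2 * pi * dotv x eta)) = 0.
Proof.
move=> sp uM f0; have cp := schwartz_cint sp.
have [c1 _] := cint_mulmx (- kappa) uM cp; have [c2 _] := cintJ c1; split=> //.
pose w : R := 2 * pi.
pose H y := psi y * expi (- w * dotv y ((invmx M)^T *m eta)).
have cH : cint H by exact: cint_expi.
have [c3 e3] := cint_mulmx (- kappa) uM cH.
pose u := expi (w * dotv (invmx M *m kappa) eta).
have -> : (fun x => conjc (psi (M *m x - kappa)) * expi (2 * pi * dotv x eta)) =
    (fun x => u * conjc (H (M *m x - kappa))).
  apply/funext => x; rewrite /H conjc_mul conj_expi mulrCA -expiD; congr (_ * expi _).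
  rewrite dotvDl dotvNl -!(dotv_mulmx (invmx M)) mulKmx// -/w; ring.
have [c4 e4] := cintJ c3; have [_ ->] := cintZ u c4; rewrite e4 e3.
suff -> : integC H = 0 by rewrite mulr0 conjc0 mulr0.
rewrite -f0; congr integC; apply/funext => y; rewrite /H; congr (_ * expi _).
by rewrite mulNr.
Qed.

End FourierSupport.

(** * Ellipsoid norms and the spectral gap *)

Section EuclideanNorm.
Context {R : realType} {n : nat}.
Local Notation E := 'cV[R]_n.+1.
Implicit Types (x y z : E) (M : 'M[R]_n.+1).

Lemma dotv_ge0 x : 0 <= dotv x x.
Proof. by apply: sumr_ge0 => i _; rewrite -expr2 sqr_ge0. Qed.

Lemma enorm_ge0 x : 0 <= enorm x.
Proof. exact: sqrtr_ge0. Qed.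

Lemma enorm_sqr x : enorm x ^+ 2 = dotv x x.
Proof. by rewrite sqr_sqrtr// dotv_ge0. Qed.

Lemma coord_le_enorm x i : `|x i 0| <= enorm x.
Proof.
rewrite -sqrtr_sqr ler_wsqrtr// /dotv (bigD1 i)//= -expr2 lerDl.
by apply: sumr_ge0 => j _; rewrite -expr2 sqr_ge0.
Qed.

Lemma enorm_eq0 x : enorm x = 0 -> x = 0.
Proof.
move=> x0; apply/colP => i; rewrite mxE; apply/eqP; rewrite -normr_eq0.
by rewrite eq_le normr_ge0 andbT -x0 coord_le_enorm.
Qed.

Lemma enorm0 : enorm (0 : E) = 0.
Proof. by rewrite /enorm /dotv big1 ?sqrtr0// => i _; rewrite mxE mul0r. Qed.

Lemma enormZ (a : R) x : enorm (a *: x) = `|a| * enorm x.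
Proof.
rewrite /enorm -sqrtr_sqr -sqrtrM ?sqr_ge0//; congr Num.sqrt.
by rewrite /dotv mulr_sumr; apply: eq_bigr => i _; rewrite mxE; ring.
Qed.

Lemma enormN x : enorm (- x) = enorm x.
Proof. by rewrite -scaleN1r enormZ normrN1 mul1r. Qed.

Lemma dotv_le x y : dotv x y <= enorm x * enorm y.
Proof.
have [/enorm_eq0 ->|y0] := eqVneq (enorm y) 0.
  rewrite enorm0 mulr0 /dotv big1// => i _; by rewrite mxE mulr0.
have yp : 0 < enorm y by rewrite lt_def y0 enorm_ge0.
have := dotv_ge0 (enorm y ^+ 2 *: x - dotv x y *: y).
have -> : dotv (enorm y ^+ 2 *: x - dotv x y *: y) (enorm y ^+ 2 *: x - dotv x y *: y) =
    enorm y ^+ 2 * (enorm x ^+ 2 * enorm y ^+ 2 - dotv x y ^+ 2).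
  rewrite dotvDr -scaleNr !dotvZr !(dotvC _ x) !(dotvC _ y) !dotvDr !dotvZr.
  by rewrite -!enorm_sqr (dotvC y x); ring.
rewrite pmulr_rge0 ?exprn_gt0// subr_ge0 -exprMn => h.
have : `|dotv x y| <= `|enorm x * enorm y|.
  by rewrite -!sqrtr_sqr ler_wsqrtr.
by rewrite [leRHS]ger0_norm ?mulr_ge0 ?enorm_ge0//; apply: le_trans; exact: ler_norm.
Qed.

Lemma enormD x y : enorm (x + y) <= enorm x + enorm y.
Proof.
rewrite -(@ler_pXn2r _ 2) ?nnegrE ?addr_ge0 ?enorm_ge0//.
rewrite enorm_sqr dotvDl !dotvDr (dotvC y x) sqrrD -!enorm_sqr.
by have := dotv_le x y; lra.
Qed.

Lemma enorm_le_sum x : enorm x <= \sum_i `|x i 0|.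
Proof.
rewrite -(@ler_pXn2r _ 2) ?nnegrE ?enorm_ge0 ?sumr_ge0//.
rewrite enorm_sqr expr2 mulr_suml; apply: ler_sum => i _.
rewrite (le_trans (ler_norm _))// normrM ler_wpM2l// (bigD1 i)//= lerDl.
exact: sumr_ge0.
Qed.

Definition mxnorm1 M : R := \sum_i \sum_j `|M i j|.

Lemma mxnorm1_ge0 M : 0 <= mxnorm1 M.
Proof. by do 2 apply: sumr_ge0 => ? _. Qed.

Lemma enorm_mulmx M x : enorm (M *m x) <= mxnorm1 M * enorm x.
Proof.
apply: (le_trans (enorm_le_sum _)); rewrite mulr_suml; apply: ler_sum => i _.
rewrite mxE (le_trans (ler_norm_sum _ _ _))// mulr_suml; apply: ler_sum => j _.
by rewrite normrM ler_wpM2l// coord_le_enorm.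
Qed.

(** By duality, |z|^2 = <y, M z> for z = M^T y. The ellipsoid speaks of A, whereas frequencies are
    moved by its transpose. *)
Lemma enorm_trmx M (C : R) y : (forall x, enorm (M *m x) <= C * enorm x) ->
  enorm (M^T *m y) <= C * enorm y.
Proof.
move=> MC; set z := M^T *m y.
have [z0|z0] := eqVneq (enorm z) 0.
  rewrite z0; have := MC y; have := enorm_ge0 (M *m y); have := enorm_ge0 y; lra.
have zp : 0 < enorm z by rewrite lt_def z0 enorm_ge0.
rewrite -(ler_pM2r zp) -expr2 enorm_sqr {1}/z -[M in M^T](trmxK M) trmxK.
rewrite dotv_mulmx trmxK; apply: (le_trans (dotv_le _ _)).
by rewrite mulrAC mulrC ler_wpM2r ?enorm_ge0.
Qed.

Lemma enorm_continuous : continuous (@enorm R n).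
Proof.
have h : continuous (fun x : E => dotv x x).
  apply: continuous_big => [|i _ x]; first exact: add_continuous.
  by apply: continuousM; exact: coord_continuous.
by move=> x; apply: (continuous_comp (h x)); exact: sqrt_continuous.
Qed.

End EuclideanNorm.

Section Ellipsoid.
Context {R : realType} {n : nat}.
Local Notation E := 'cV[R]_n.+1.
Context (A P : 'M[R]_n.+1) (t : R).
Context (uP : P \in unitmx) (t1 : 1 < t).
Local Notation D := [set x : E | enorm (P *m x) < 1].
Context (tDA : [set t *: x | x in D] `<=` [set A *m x | x in D]).
Implicit Types (x y z : E) (k : int).

(** The gauge of the ellipsoid, for which [tDA] says that A^-1 contracts by 1/t. *)
Definition pnorm x := enorm (P *m x).

Lemma pnorm_ge0 x : 0 <= pnorm x. Proof. exact: enorm_ge0. Qed.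

Lemma pnormD x y : pnorm (x + y) <= pnorm x + pnorm y.
Proof. by rewrite /pnorm mulmxDr enormD. Qed.

Lemma pnormZ (a : R) x : pnorm (a *: x) = `|a| * pnorm x.
Proof. by rewrite /pnorm -scalemxAr enormZ. Qed.

Lemma pnormN x : pnorm (- x) = pnorm x.
Proof. by rewrite /pnorm mulmxN enormN. Qed.

Lemma pnorm0 : pnorm 0 = 0.
Proof. by rewrite /pnorm mulmx0 enorm0. Qed.

Lemma pnorm_continuous : continuous pnorm.
Proof.
have h : continuous (fun x : E => P *m x).
  move=> x B [C HC CB].
  have c i : continuous (fun y : E => \sum_k P i k * y k 0).
    apply: continuous_big => [|k _ y]; first exact: add_continuous.
    by apply: continuousM; [exact: cst_continuous|exact: coord_continuous].
  have HC' i : nbhs x [set y : E | C i 0 (\sum_k P i k * y k 0)].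
    by apply: (c i x); have := HC i 0; rewrite mxE.
  apply: filterS (@filter_forall E _ _ (nbhs x) _ HC') => y Cy.
  suff : B (P *m y) by [].
  by apply: CB => i j /=; rewrite (ord1 j) mxE; exact: Cy.
by move=> x; apply: (continuous_comp (h x)); exact: enorm_continuous.
Qed.

Lemma pnorm_mulmx (M : 'M[R]_n.+1) x : pnorm (M *m x) <= mxnorm1 (P *m M *m invmx P) * pnorm x.
Proof. by rewrite /pnorm -{1}(mulKmx uP x) !mulmxA; rewrite -[X in enorm X]mulmxA enorm_mulmx. Qed.

Lemma enorm_pnorm x : enorm x <= mxnorm1 (invmx P) * pnorm x.
Proof. by rewrite -{1}(mulKmx uP x) enorm_mulmx. Qed.

Lemma pnorm_enorm x : pnorm x <= mxnorm1 P * enorm x.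
Proof. exact: enorm_mulmx. Qed.

Lemma t_gt0 : 0 < t. Proof. exact: lt_trans t1. Qed.

(** Homogeneity extends the inclusion of t D in A D from the unit ball of the gauge to balls of
    every radius. *)
Lemma expansive_preimage x (s : R) : pnorm x < s -> exists2 y, x = A *m y & pnorm y < s / t.
Proof.
move=> xs; have s0 : 0 < s by exact: le_lt_trans (pnorm_ge0 x) xs.
have [|y yD Ay] := @tDA (t *: (s^-1 *: x)).
  exists (s^-1 *: x) => //=; rewrite -/(pnorm _) pnormZ gtr0_norm ?invr_gt0//.
  by rewrite mulrC ltr_pdivrMr// mul1r.
exists ((s / t) *: y).
  have [s_n t_n] : s != 0 /\ t != 0 by rewrite !gt_eqF ?t_gt0.
  by rewrite -scalemxAr Ay !scalerA [X in X *: _](_ : _ = 1) ?scale1r//; field; rewrite s_n.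
rewrite pnormZ gtr0_norm ?divr_gt0 ?t_gt0//.
by rewrite -[ltRHS]mulr1 ltr_pM2l// divr_gt0 ?t_gt0.
Qed.

(** The inclusion makes A surjective; preimages of the basis vectors are the columns of a right
    inverse. *)
Lemma expansive_unit : A \in unitmx.
Proof.
have /choice[g gP] : forall x, exists y, x = A *m y.
  by move=> x; have [|y ? _] := @expansive_preimage x (pnorm x + 1); [rewrite ltrDl|exists y].
have : A *m (\matrix_(i, j) g (delta_mx j 0) i 0) = 1%:M.
  apply/matrixP => i j; have /matrixP/(_ i 0) := gP (delta_mx j 0).
  rewrite !mxE eqxx andbT => ->; apply: eq_bigr => k _; by rewrite mxE.
by move=> /mulmx1_unit[].
Qed.

Lemma pnorm_invA x : pnorm (invmx A *m x) <= pnorm x / t.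
Proof.
apply/ler_addgt0Pr => e e0.
have [|y -> yt] := @expansive_preimage x (pnorm x + e * t).
  by rewrite ltrDl mulr_gt0 ?t_gt0.
rewrite mulKmx ?expansive_unit//; apply/ltW.
by move: yt; rewrite mulrDl mulfK ?gt_eqF ?t_gt0.
Qed.

Lemma pnorm_invAn m x : pnorm (invmx (A ^+ m) *m x) <= pnorm x / t ^+ m.
Proof.
elim: m x => [|m IH] x; first by rewrite expr0 invmx1 mul1mx expr0 divr1.
have uA := expansive_unit.
rewrite exprSr -[A ^+ m * A]/(A ^+ m *m A).
have -> : invmx (A ^+ m *m A) = invmx A *m invmx (A ^+ m).
  rewrite -[invmx]/(@GRing.inv _) -[_ *m _]/(A ^+ m * A)  -[invmx A *m _]/(A^-1 * (A ^+ m)^-1).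
  by rewrite invrM// unitrX.
rewrite -mulmxA; apply: (le_trans (pnorm_invA _)).
by rewrite exprS invfM mulrA ler_pdivrMr ?t_gt0// mulrAC mulfVK ?gt_eqF ?t_gt0.
Qed.

(** Adding t to a bound for the operator norm of A in the gauge makes it exceed 1, so that its
    powers do not decrease. *)
Definition opA : R := mxnorm1 (P *m A *m invmx P) + t.

Lemma opA_gt1 : 1 < opA.
Proof. by rewrite /opA (lt_le_trans t1)// lerDr mxnorm1_ge0. Qed.

Lemma pnorm_A x : pnorm (A *m x) <= opA * pnorm x.
Proof.
apply: (le_trans (pnorm_mulmx _ _)); rewrite ler_wpM2r ?pnorm_ge0//.
by rewrite /opA lerDl ltW ?t_gt0.
Qed.

Lemma pnorm_An m x : pnorm (A ^+ m *m x) <= opA ^+ m * pnorm x.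
Proof.
elim: m => [|m IH]; first by rewrite !expr0 mul1mx mul1r.
rewrite exprS -[A * _]/(A *m _) -mulmxA; apply: (le_trans (pnorm_A _)).
by rewrite exprS -mulrA ler_wpM2l// ltW// (lt_trans _ opA_gt1).
Qed.

End Ellipsoid.

Section SpectralGap.
Context {R : realType} {n : nat}.
Local Notation TR := (measurableTypeR R).
Local Notation E := 'cV[R]_n.+1.
Context (A P : 'M[R]_n.+1) (t : R).
Context (uP : P \in unitmx) (t1 : 1 < t).
Local Notation D := [set x : E | enorm (P *m x) < 1].
Context (tDA : [set t *: x | x in D] `<=` [set A *m x | x in D]).
Implicit Types (x y z eta : E).

Let uA : A \in unitmx := expansive_unit t1 tDA.

Lemma measv_pnorm : measv (pnorm P : E -> TR).
Proof. by apply: continuous_measv; exact: pnorm_continuous. Qed.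

Lemma measurable_pball (x : E) (s : R) :
  measurable [set u : n.+1.-tuple TR | pnorm P (vec u - x) < s].
Proof.
have m : measurable_fun setT (fun u : n.+1.-tuple TR => pnorm P (vec u - x) : TR).
  have := @measv_mulmx _ _ _ _ _ 1%:M (- x) measv_pnorm.
  by under [X in measv X]funext do rewrite mul1mx.
rewrite (_ : [set _ | _] = (fun u : n.+1.-tuple TR => pnorm P (vec u - x)) @^-1` [set` `]-oo, s[]).
  by rewrite -[X in measurable X]setTI; apply: m => //; exact: measurable_itv.
by apply/seteqP; split => u /=; rewrite in_itv.
Qed.

Lemma lebesgue_pball (x : E) : vol D = 1%E ->
  lebesgue n.+1 [set u : n.+1.-tuple TR | pnorm P (vec u - x) < 1] = 1%E.
Proof.
move=> <-; rewrite /vol.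
have lE y : lebesgue n.+1 [set u : n.+1.-tuple TR | pnorm P (vec u - y) < 1] =
    lint (fun z : E => (\1_[set z : E | pnorm P (z - y) < 1] z)%:E).
  transitivity (\int[lebesgue n.+1]_u
      (\1_[set u : n.+1.-tuple TR | pnorm P (vec u - y) < 1] u)%:E)%E.
    by rewrite integral_indic ?setIT//; exact: measurable_pball.
  apply: eq_integral => u _; rewrite !indicE; congr ((_ : bool)%:R%:E).
have D0 : D = [set z : E | pnorm P (z - 0) < 1].
  by apply/seteqP; split => z /=; rewrite subr0.
rewrite D0 -[_ @^-1` _]/[set u : n.+1.-tuple TR | pnorm P (vec u - 0) < 1] !lE.
pose f (z : E) := (\1_[set z : E | pnorm P (z - 0) < 1] z)%:E : \bar R.
rewrite -[RHS](@ge0_lint_affine _ _ f false (- x)); last by move=> z; rewrite lee_fin indicE.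
- congr lint; apply/funext => z; rewrite /f expr0 scale1r !indicE; congr ((_ : bool)%:R%:E).
  by apply/idP/idP; rewrite !inE/= subr0.
- apply/measurable_EFinP; apply: measurable_indic; exact: measurable_pball.
Qed.

(** Since t |z| <= |A z| in the gauge, the preimage of D under A lies in its preimage under t;
    comparing volumes gives [t ^+ n.+1 <= bdet A]. *)
Lemma bdet_gt1 : vol D = 1%E -> 1 < bdet A.
Proof.
move=> vD; have l1 := lebesgue_pball 0 vD.
pose f (z : E) := (\1_[set z : E | pnorm P (z - 0) < 1] z)%:E : \bar R.
have mf : measv f by apply/measurable_EFinP; apply: measurable_indic; exact: measurable_pball.
have f0 z : (0 <= f z)%E by rewrite lee_fin indicE.
have lf : lint f = 1%E.
  transitivity (\int[lebesgue n.+1]_u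
      (\1_[set u : n.+1.-tuple TR | pnorm P (vec u - 0) < 1] u)%:E)%E.
    by apply: eq_integral => u _; rewrite /f !indicE; congr ((_ : bool)%:R%:E).
  by rewrite integral_indic ?setIT//; exact: measurable_pball.
have fE z : f z = ((pnorm P z < 1)%R : bool)%:R%:E.
  rewrite /f indicE; congr ((_ : bool)%:R%:E); apply/idP/idP.
    by rewrite inE/= subr0.
  by rewrite inE/= subr0.
have ut : (t%:M : 'M[R]_n.+1) \in unitmx.
  by rewrite unitmxE det_scalar unitrX// unitfE gt_eqF// t_gt0.
have le : (lint (fun z => f (A *m z)) <= lint (fun z => f (t%:M *m z)%R))%E.
  apply: ge0_le_integral => //; try exact: measv_mulmx0.
  move=> u _; set z := vec u; rewrite !fE lee_fin ler_nat.
  case: (ltP (pnorm P (A *m z)) 1) => // Az.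
  rewrite mul_scalar_mx pnormZ gtr0_norm ?t_gt0// (le_lt_trans _ Az)//.
  by have := pnorm_invA t1 tDA (A *m z); rewrite mulKmx// ler_pdivlMr ?t_gt0// mulrC.
move: le; rewrite (jacdet_unit uA)// (jacdet_unit ut)// lf !mule1 lee_fin det_scalar => le.
rewrite /bdet.
have d0 : 0 < `|\det A| by rewrite normr_gt0 -unitfE -unitmxE.
have tn : 1 < `|t ^+ n.+1| by rewrite ger0_norm ?exprn_ge0 ?ltW ?t_gt0// exprn_egt1.
apply: (lt_le_trans tn); rewrite -lef_pV2 ?posrE//; exact: lt_trans ltr01 tn.
Qed.

Let C : R := mxnorm1 (invmx P) * mxnorm1 P.

Lemma enorm_invAn m x : enorm (invmx (A ^+ m) *m x) <= C / t ^+ m * enorm x.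
Proof.
apply: (le_trans (enorm_pnorm uP _)).
rewrite /C -!mulrA ler_wpM2l ?mxnorm1_ge0//.
apply: (le_trans (pnorm_invAn t1 tDA _ _)); rewrite mulrCA mulrC ler_wpM2l ?pnorm_enorm//.
by rewrite invr_ge0 exprn_ge0// ltW ?t_gt0.
Qed.

Lemma enorm_invAn_tr m x : enorm ((invmx (A ^+ m))^T *m x) <= C / t ^+ m * enorm x.
Proof. by apply: enorm_trmx => y; exact: enorm_invAn. Qed.

Lemma enorm_An_tr m x : enorm x <= C / t ^+ m * enorm ((A ^+ m)^T *m x).
Proof.
have uAm : A ^+ m \in unitmx by rewrite -[_ \in unitmx]/(A ^+ m \is a GRing.unit) unitrX.
have uT : (A ^+ m)^T \in unitmx by rewrite unitmx_tr.
rewrite -{1}[x](mulKmx uT).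
by rewrite -trmx_inv; exact: enorm_invAn_tr.
Qed.

Lemma eigen_pow (lambda : R) (v : E) m : A^T *m v = lambda *: v ->
  (A ^+ m)^T *m v = lambda ^+ m *: v.
Proof.
move=> Av; elim: m => [|m IH]; first by rewrite !expr0 trmx1 mul1mx scale1r.
rewrite exprS -[A * _]/(A *m _) trmx_mul -mulmxA Av -scalemxAr IH scalerA.
by rewrite exprS.
Qed.

Lemma mulmx_enorm_continuous (M : 'M[R]_n.+1) : continuous (fun x : E => enorm (M *m x)).
Proof. exact: pnorm_continuous. Qed.

Lemma eventually_small (K e : R) : 0 < e -> exists J, forall m, (J <= m)%N -> K / t ^+ m <= e.
Proof.
move=> e0.
have : (fun m => K * (t^-1) ^+ m) @ \oo --> (K * 0 : R).
  apply: cvgMr; apply: cvg_expr.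
  by rewrite ger0_norm ?invr_ge0 ?ltW ?t_gt0// invf_lt1// t_gt0.
rewrite mulr0 => /cvgr0Pnorm_le /(_ e e0) [J _ HJ]; exists J => m Jm.
by have := HJ m Jm; rewrite exprVn; apply: le_trans; exact: ler_norm.
Qed.

(* No dilate of the annulus meets the sphere of radius s inside the eigenline;
   by expansiveness only finitely many dilates matter near a given point, so a
   whole neighbourhood is missed. *)
Lemma spectral_gap (lambda : R) (v : E) (r Rout : R) : v != 0 -> A^T *m v = lambda *: v ->
  0 < r -> r < Rout -> Rout / r < `|lambda| ->
  exists2 xi : E, xi != 0 & exists2 a : R, 0 < a &
    forall eta, (forall i, `|eta i 0 - xi i 0| <= a) -> forall m,
      ~~ (r <= enorm ((invmx (A ^+ m.+1))^T *m eta) <= Rout) /\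
      ~~ (r <= enorm ((A ^+ m)^T *m eta) <= Rout).
Proof.
move=> v0 Av r0 rR Rl.
have lr : Rout < `|lambda| * r by rewrite -ltr_pdivrMr.
(* Strictly between [Rout] and |lambda| r: nonnegative powers of lambda keep the radius s above
   [Rout], and negative ones bring it below r. *)
pose s := (Rout + `|lambda| * r) / 2.
have [s1 s2] : Rout < s /\ s < `|lambda| * r by rewrite /s; split; lra.
have R0 : 0 < Rout by exact: lt_trans rR.
have s0 : 0 < s by exact: lt_trans s1.
have l1 : 1 < `|lambda|.
  by rewrite (le_lt_trans _ Rl)// ler_pdivlMr// mul1r ltW.
have ev0 : 0 < enorm v.
  by rewrite lt_def enorm_ge0 andbT; apply: contra v0 => /eqP/enorm_eq0 ->.
pose xi := (s / enorm v) *: v.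
have sv : 0 < s / enorm v by exact: divr_gt0.
have exi : enorm xi = s by rewrite /xi enormZ (gtr0_norm sv) divfK// gt_eqF.
have Axi m : (A ^+ m)^T *m xi = lambda ^+ m *: xi.
  by rewrite /xi -scalemxAr (eigen_pow m Av) !scalerA mulrC.
have l0 : lambda != 0 by rewrite -normr_gt0 (lt_trans _ l1).
have iAxi m : (invmx (A ^+ m))^T *m xi = (lambda ^- m) *: xi.
  have uAm : A ^+ m \in unitmx by rewrite -[_ \in unitmx]/(A ^+ m \is a GRing.unit) unitrX.
  have e : xi = (A ^+ m)^T *m (lambda ^- m *: xi).
    by rewrite -scalemxAr Axi scalerA mulVf ?scale1r// expf_neq0.
  by rewrite {1}e trmx_inv mulKmx ?unitmx_tr.
exists xi; first by apply: contraTneq s0 => xi0; rewrite -exi xi0 enorm0 ltxx.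
pose U1 m := [set eta : E | ~~ (r <= enorm ((invmx (A ^+ m.+1))^T *m eta) <= Rout)].
pose U2 m := [set eta : E | ~~ (r <= enorm ((A ^+ m)^T *m eta) <= Rout)].
have N1 m : nbhs xi (U1 m).
  have c : enorm ((invmx (A ^+ m.+1))^T *m xi) < r.
    rewrite iAxi enormZ exi normrV ?unitfE ?expf_neq0// normrX.
    rewrite mulrC ltr_pdivrMr ?exprn_gt0 ?normr_gt0//.
    by apply: (lt_le_trans s2); rewrite mulrC ler_pM2l// exprS ler_peMr// exprn_ege1// ltW.
  have := (@mulmx_enorm_continuous ((invmx (A ^+ m.+1))^T) xi).
  move=> /cvgr_lt /(_ r c); apply: filterS => eta; rewrite /U1/= => h.
  by rewrite negb_and -ltNge h.
have N2 m : nbhs xi (U2 m).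
  have c : Rout < enorm ((A ^+ m)^T *m xi).
    rewrite Axi enormZ exi normrX (lt_le_trans s1)// ler_peMl ?(ltW s0)//.
    by rewrite exprn_ege1// ltW.
  have := (@mulmx_enorm_continuous ((A ^+ m)^T) xi).
  move=> /cvgr_gt /(_ Rout c); apply: filterS => eta; rewrite /U2/= => h.
  by rewrite negb_and -!ltNge h orbT.
(* One J serves a whole shell around the sphere: high powers of the inverse transpose carry it
   inside radius r, high powers of the transpose carry it beyond [Rout]. *)
have [J HJ] : exists J, forall m, (J <= m)%N -> forall eta, s / 2 < enorm eta < 2 * s ->
    U1 m eta /\ U2 m eta.
  have [J1 H1] := @eventually_small (C * (2 * s)) (r / 2) ltac:(by rewrite divr_gt0).
  have [J2 H2] := @eventually_small (C * (2 * Rout)) (s / 2) ltac:(by rewrite divr_gt0).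
  have C0 : 0 <= C by rewrite mulr_ge0 ?mxnorm1_ge0.
  exists (maxn J1 J2) => m; rewrite geq_max => /andP[m1 m2] eta /andP[e1 e2]; split.
    rewrite /U1/= negb_and -ltNge; apply/orP; left.
    apply: (le_lt_trans (enorm_invAn_tr _ _)).
    apply: (@le_lt_trans _ _ (C / t ^+ m.+1 * (2 * s))).
      apply: ler_wpM2l; last exact: ltW.
      by rewrite divr_ge0 ?exprn_ge0// ltW// t_gt0.
    rewrite mulrAC (le_lt_trans (H1 _ _)) ?(leqW m1)//.
    by rewrite ltr_pdivrMr// mulr_natr mulr2n ltrDl.
  rewrite /U2/= negb_and -!ltNge; apply/orP; right; rewrite ltNge; apply/negP => h.
  have := enorm_An_tr m eta; apply/negP; rewrite -ltNge.
  apply: le_lt_trans e1; apply: le_trans (H2 _ m2).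
  rewrite mulrAC; apply: ler_pM => //.
  - by rewrite mulr_ge0 ?enorm_ge0.
  - by rewrite invr_ge0 exprn_ge0// ltW ?t_gt0.
  - by rewrite ler_wpM2l// (le_trans h)// ler_peMl ?ler1n// ltW.
have N3 : nbhs xi [set eta : E | s / 2 < enorm eta < 2 * s].
  have h1 : s / 2 < enorm xi by rewrite exi; lra.
  have h2 : enorm xi < 2 * s by rewrite exi; lra.
  have /cvgr_gt/(_ _ h1) g1 := @enorm_continuous R n xi.
  have /cvgr_lt/(_ _ h2) g2 := @enorm_continuous R n xi.
  by apply: filterS (filterI g1 g2) => eta [/= -> ->].
have : nbhs xi [set eta : E | (forall i : 'I_J, U1 i eta /\ U2 i eta) /\ s / 2 < enorm eta < 2 * s].
  apply: filterI; last exact: N3.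
  apply: (@filter_forall E _ (fun (i : 'I_J) eta => U1 i eta /\ U2 i eta) (nbhs xi)) => i.
  exact: (filterI (N1 i) (N2 i)).
move=> /nbhs_ballP[a /= a0 aB].
(* Halved because the ball found is open and the cube asked for is closed. *)
exists (a / 2); first by rewrite divr_gt0.
move=> eta etaP m.
have [|h1 h2] := aB eta.
  split=> // i j; rewrite (ord1 j) /ball/= distrC (le_lt_trans (etaP i))//.
  by rewrite ltr_pdivrMr// mulr_natr mulr2n ltrDl.
by have [mJ|Jm] := ltnP m J; [exact: (h1 (Ordinal mJ))|exact: HJ].
Qed.

End SpectralGap.

(** * Differences and derivatives *)

Section Differences.
Context {R : realType} {n : nat}.
Local Notation E := 'cV[R]_n.+1.
Local Notation Re := complex.Re.
Local Notation Im := complex.Im.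
Implicit Types (f g : E -> R[i]) (h k x y u w : E) (s : seq 'I_n.+1).

Definition fdiff h f : E -> R[i] := fun x => f x - f (x - h).

Definition cstep h (i : 'I_n.+1) : E := h i 0 *: delta_mx i 0.

Definition diffs h s f := foldr (fun i g => fdiff (cstep h i) g) f s.

Lemma fdiffC h k f : fdiff h (fdiff k f) = fdiff k (fdiff h f).
Proof. by apply/funext => x; rewrite /fdiff (addrAC x (- k)); ring. Qed.

Lemma iter_diffC m h k f : iter m (fdiff h) (fdiff k f) = fdiff k (iter m (fdiff h) f).
Proof. by elim: m => //= m ->; rewrite fdiffC. Qed.

Lemma diffs_diff h k s f : diffs h s (fdiff k f) = fdiff k (diffs h s f).
Proof. by elim: s => //= i s ->; rewrite fdiffC. Qed.

Lemma diffs_perm h s s' f : perm_eq s s' -> diffs h s f = diffs h s' f.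
Proof.
have C s1 s2 g : diffs h s1 (diffs h s2 g) = diffs h s2 (diffs h s1 g).
  by elim: s2 => //= i s2 <-; rewrite diffs_diff.
move=> /(@catCA_perm_ind _ (fun s' => diffs h s f = diffs h s' f)); apply => //.
by move=> s1 s2 s3 ->; rewrite /diffs !foldr_cat; exact: C.
Qed.

Lemma fdiffD h k f x : fdiff (h + k) f x = fdiff h f x + fdiff k f (x - h).
Proof. by rewrite /fdiff opprD addrA; ring. Qed.

Lemma fdiff0 f x : fdiff 0 f x = 0.
Proof. by rewrite /fdiff subr0 subrr. Qed.

Definition box x h (m : nat) u := forall i, `|u i 0 - x i 0| <= m%:R * `|h i 0|.

(** Travel from x to x - h along one axis at a time; the intermediate points remain in the box. *)
Lemma diff_telescope f h x (K : R) :
  (forall i u, box x h 1 u -> normc (fdiff (cstep h i) f u) <= K) ->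
  normc (fdiff h f x) <= n.+1%:R * K.
Proof.
move=> HK.
have hE : h = \sum_i cstep h i.
  apply/colP => i; rewrite summxE (bigD1 i)//= big1 ?addr0.
    by rewrite !mxE !eqxx mulr1.
  by move=> j ji; rewrite !mxE eq_sym (negbTE ji) mulr0.
(* [y] holds the coordinates of h already subtracted, [s] lists those still to be moved. *)
have H (s : seq 'I_n.+1) y : uniq s -> (forall i, y i 0 = 0 \/ (y i 0 = h i 0 /\ i \notin s)) ->
    normc (fdiff (\sum_(i <- s) cstep h i) f (x - y)) <= (size s)%:R * K.
  elim: s y => [|i s IH] y; first by rewrite big_nil fdiff0 mul0r normc0E.
  rewrite big_cons fdiffD => /andP[/= is_ us] yP.
  rewrite -natr1 mulrDl mul1r [leRHS]addrC; apply: (le_trans (normcD _ _)); apply: lerD; last first.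
    rewrite -addrA -opprD; apply: IH => // j; rewrite !mxE.
    have [->|ji] := eqVneq j i; last first.
      rewrite mulr0 addr0; have [->|[-> js]] := yP j; [by left|right; split=> //].
      by move: js; rewrite inE negb_or => /andP[].
    right; split=> //; have [->|[_]] := yP i; first by rewrite eqxx mulr1 add0r.
    by rewrite inE eqxx.
  apply: HK => j; rewrite !mxE addrAC subrr add0r normrN mul1r.
  by have [->|[-> _]] := yP j; rewrite ?normr0.
have := H (enum 'I_n.+1) 0 (enum_uniq _); rewrite subr0 big_enum/= -hE => h'.
apply: (le_trans (h' _)) => [i|]; first by left; rewrite mxE.
by rewrite size_enum_ord.
Qed.

(** Each full difference is traded for n+1 coordinate differences, which commute with the remaining
    full ones; [s0] collects those already traded. *)
Lemma iter_diff_bound h m s0 f x (K : R) :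
  (forall s, size s = m -> forall u, box x h m u -> normc (diffs h (s ++ s0) f u) <= K) ->
  normc (iter m (fdiff h) (diffs h s0 f) x) <= n.+1%:R ^+ m * K.
Proof.
elim: m s0 x => [|m IH] s0 x HK.
  rewrite expr0 mul1r; apply: (HK [::]) => // i.
  by rewrite subrr normr0 mul0r.
rewrite iterS exprS -mulrA; apply: diff_telescope => i u xu.
rewrite -iter_diffC -[fdiff _ _]/(diffs h (i :: s0) f); apply: IH => s sm w uw.
rewrite -cat_rcons; apply: HK; first by rewrite size_rcons sm.
move=> j; rewrite -(subrKA (u j 0)) (le_trans (ler_normD _ _))// -natr1 mulrDl lerD//.
Qed.

Lemma derivable_shift (g : E -> R) x v k : derivable g (x - k) v ->
  derivable (fun y => g (y - k)) x v /\ 'D_v (fun y => g (y - k)) x = 'D_v g (x - k).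
Proof.
have e : (fun h : R => h^-1 *: (((fun y => g (y - k)) \o shift x) (h *: v) - g (x - k))) =
    (fun h : R => h^-1 *: ((g \o shift (x - k)) (h *: v) - g (x - k))).
  by apply/funext => h /=; rewrite addrA.
by rewrite /derivable /derive e.
Qed.

Lemma derivable_line (g : E -> R) y v (a : R) : derivable g (a *: v + y) v ->
  is_derive a 1 (fun b : R => g (b *: v + y)) ('D_v g (a *: v + y)).
Proof.
have e : (fun h : R => h^-1 *:
    (((fun b : R => g (b *: v + y)) \o shift a) (h *: (1 : R)) - g (a *: v + y))) =
    (fun h : R => h^-1 *: ((g \o shift (a *: v + y)) (h *: v) - g (a *: v + y))).
  by apply/funext => h /=; rewrite -[h%:A]/(h * 1) mulr1 scalerDl addrA.
by move=> dg; split; rewrite /derivable /derive e.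
Qed.

Lemma mean_value_line (g : E -> R) x v (c : R) : (forall y, derivable g y v) ->
  exists2 b : R, `|b| <= `|c| & g x - g (x - c *: v) = c * 'D_v g (x - b *: v).
Proof.
move=> dg; pose y := x - c *: v; pose phi (b : R) := g (b *: v + y).
have dphi (b : R) : is_derive b 1 phi ('D_v g (b *: v + y)) by exact: derivable_line.
have cphi : continuous phi.
  by move=> b; apply/differentiable_continuous/derivable1_diffP; have [] := dphi b.
have p0 : phi 0 = g y by rewrite /phi scale0r add0r.
have pc : phi c = g x by rewrite /phi /y addrC subrK.
have e b : b *: v + y = x - (c - b) *: v by rewrite /y scalerBl opprB addrCA.
have [c0|c0] := leP 0 c.
  have [b] := @MVT_segment R phi _ 0 c c0 (fun b _ => dphi b) (continuous_subspaceT cphi).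
  rewrite in_itv/= => /andP[b0 bc]; rewrite subr0 pc p0 e => ->; exists (c - b).
    by rewrite !ger0_norm ?subr_ge0// lerBlDr lerDl.
  by rewrite mulrC.
have [b] := @MVT_segment R phi _ c 0 (ltW c0) (fun b _ => dphi b) (continuous_subspaceT cphi).
rewrite in_itv/= => /andP[b0 bc]; rewrite sub0r pc p0 e => gE; exists (c - b).
  by rewrite !ler0_norm; lra.
by rewrite -[LHS]opprB gE; ring.
Qed.

(** The factor 2 arises because the mean value theorem gives different points for the real and
    imaginary parts. *)
Lemma mean_value_diff g i h x (K : R) :
  (forall y, derivable (fun z => Re (g z)) y (delta_mx i 0)) ->
  (forall y, derivable (fun z => Im (g z)) y (delta_mx i 0)) ->
  (forall u, box x h 1 u -> normc (partialC i g u) <= K) ->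
  normc (fdiff (cstep h i) g x) <= 2 * `|h i 0| * K.
Proof.
move=> d1 d2 HK; apply: (le_trans (normc_le _)).
have B (b : R) : `|b| <= `|h i 0| -> box x h 1 (x - b *: delta_mx i 0).
  move=> bh j; rewrite !mxE addrAC subrr add0r normrN mul1r eqxx andbT.
  by have [->|_] := eqVneq j i; rewrite ?mulr1// mulr0 normr0.
rewrite [leRHS](_ : _ = `|h i 0| * K + `|h i 0| * K); last by ring.
rewrite /fdiff cReD cImD cReN cImN /cstep; apply: lerD.
  have [b bh ->] := mean_value_line x (h i 0) d1.
  rewrite normrM ler_wpM2l// (le_trans _ (HK _ (B b bh)))//.
  exact: (normRe_le (partialC i g _)).
have [b bh ->] := mean_value_line x (h i 0) d2.
rewrite normrM ler_wpM2l// (le_trans _ (HK _ (B b bh)))//.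
exact: (normIm_le (partialC i g _)).
Qed.

Lemma smooth_partialC i f : smooth f -> smooth (partialC i f).
Proof. by move=> sf s; have := sf (rcons s i); rewrite foldr_rcons. Qed.

Definition pderivable i g := forall y,
  derivable (fun z => Re (g z)) y (delta_mx i 0) /\ derivable (fun z => Im (g z)) y (delta_mx i 0).

Lemma partialC_diff i k g : pderivable i g ->
  pderivable i (fdiff k g) /\ partialC i (fdiff k g) = fdiff k (partialC i g).
Proof.
move=> pg.
have H y : (derivable (fun z => Re (fdiff k g z)) y (delta_mx i 0) /\
     'D_(delta_mx i 0) (fun z => Re (fdiff k g z)) y = Re (fdiff k (partialC i g) y)) /\
    (derivable (fun z => Im (fdiff k g z)) y (delta_mx i 0) /\
     'D_(delta_mx i 0) (fun z => Im (fdiff k g z)) y = Im (fdiff k (partialC i g) y)).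
  have [d1 d2] := pg y; have [e1 e2] := pg (y - k).
  have [f1 F1] := derivable_shift e1; have [f2 F2] := derivable_shift e2.
  split.
    rewrite (_ : (fun z => _) = (fun z => Re (g z)) \- (fun z => Re (g (z - k)))); last first.
      by apply/funext => z; rewrite /fdiff cReD cReN.
    split; first exact: (derivableB d1 f1).
    by rewrite (deriveB d1 f1) F1 /fdiff cReD cReN.
  rewrite (_ : (fun z => _) = (fun z => Im (g z)) \- (fun z => Im (g (z - k)))); last first.
    by apply/funext => z; rewrite /fdiff cImD cImN.
  split; first exact: (derivableB d2 f2).
  by rewrite (deriveB d2 f2) F2 /fdiff cImD cImN.
split; first by move=> y; have [[? _] [? _]] := H y.
by apply/funext => y; have [[_ e1] [_ e2]] := H y; apply: complexP; rewrite -?e1 -?e2.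
Qed.

Lemma partialC_diffs i h s g : pderivable i g ->
  pderivable i (diffs h s g) /\ partialC i (diffs h s g) = diffs h s (partialC i g).
Proof.
move=> pg; elim: s => //= j s [IH1 IH2].
by have [? ->] := partialC_diff (cstep h j) IH1; rewrite IH2.
Qed.

(** The outermost difference is converted first, and its derivative passes through the other
    differences onto f; hence the reversed order of differentiation. *)
Lemma diffs_mean_value h s f x (K : R) : smooth f ->
  (forall u, box x h (size s) u -> normc (foldr partialC f (rev s) u) <= K) ->
  normc (diffs h s f x) <= (\prod_(i <- s) (2 * `|h i 0|)) * K.
Proof.
elim: s f x => [|i s IH] f x sf HK.
  rewrite big_nil mul1r; apply: (HK x) => i; by rewrite subrr normr0 mul0r.
have pf : pderivable i f by move=> y; have [_ _ /(_ i y)] := sf [::].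
have [pd e] := partialC_diffs h s pf.
rewrite big_cons -mulrA /=; apply: mean_value_diff => [y|y|u xu].
- by have [] := pd y.
- by have [] := pd y.
rewrite e; apply: IH => [|w uw]; first exact: smooth_partialC.
have -> : foldr partialC (partialC i f) (rev s) = foldr partialC f (rev (i :: s)).
  by rewrite rev_cons foldr_rcons.
apply: HK => j; rewrite -(subrKA (u j 0)) (le_trans (ler_normD _ _))//= -natr1 mulrDl lerD//.
Qed.

Definition alflat (al : 'I_n.+1 -> nat) := flatten [seq nseq (al i) i | i <- enum 'I_n.+1].

Lemma pder_alflat al f : pder al f = foldr partialC f (alflat al).
Proof.
rewrite /pder /alflat; elim: (enum _) => //= i s ->; rewrite foldr_cat.
by elim: (al i) => //= m ->.
Qed.

Lemma perm_alflat s : perm_eq s (alflat (fun i => count_mem i s)).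
Proof.
apply/allP => i _ /=; apply/eqP.
rewrite /alflat count_flatten -map_comp.
transitivity (\sum_(j <- enum 'I_n.+1) count_mem i (nseq (count_mem j s) j)); last first.
  by rewrite sumnE big_map.
rewrite big_enum/= (bigD1 i)//= count_nseq/= eqxx mul1n big1 => [|j ji].
  by rewrite [RHS]addn0.
by rewrite count_nseq/= (negbTE ji).
Qed.

Lemma mlen_count s : mlen (fun i => count_mem i s) = size s.
Proof.
rewrite (perm_size (perm_alflat s)) /alflat size_flatten /shape -map_comp sumnE big_map big_enum/=.
by apply: eq_bigr => i _; rewrite size_nseq.
Qed.

(** [pder] differentiates in a fixed order of the coordinates. The list is brought into that order
    while it still consists of differences, which commute by plain computation. *)
Lemma iter_diff_le h m f x (H K : R) : smooth f -> (forall i, `|h i 0| <= H) ->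
  (forall al u, mlen al = m -> box x h m.*2 u -> normc (pder al f u) <= K) ->
  normc (iter m (fdiff h) f x) <= (n.+1%:R * (2 * H)) ^+ m * K.
Proof.
move=> sf hH HK.
have H0 : 0 <= H by apply: le_trans (hH 0).
rewrite exprMn -mulrA; apply: (@iter_diff_bound h m [::]) => s sm u xu; rewrite cats0.
pose s' := rev (alflat (fun i => count_mem i s)).
have ss : perm_eq s s' by rewrite (perm_trans (perm_alflat s))// perm_sym perm_rev.
have K0 w : normc (pder (fun i => count_mem i s) f w) >= 0 by exact: normc_ge0.
rewrite (diffs_perm h f ss).
have size_s' : size s' = m by rewrite -(perm_size ss).
have HK' w : box u h m w -> normc (foldr partialC f (rev s') w) <= K.
  move=> uw; rewrite /s' revK -pder_alflat; apply: HK; first by rewrite mlen_count.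
  (* Radius 2m: m steps from the telescoping and m from the mean values. *)
  move=> j; rewrite -(subrKA (u j 0)) (le_trans (ler_normD _ _))// -addnn natrD mulrDl.
  exact: lerD.
apply: (@le_trans _ _ ((\prod_(i <- s') (2 * `|h i 0|)) * K)).
  by apply: diffs_mean_value; rewrite ?size_s'.
apply: ler_wpM2r.
  by apply: le_trans (HK' u _); [exact: normc_ge0|move=> j; rewrite subrr normr0 mulr_ge0].
rewrite -[in leRHS]size_s'; elim: (s') => [|i l IH]; first by rewrite big_nil expr0.
rewrite big_cons exprS; apply: ler_pM => //.
- by apply: prodr_ge0 => j _; exact: mulr_ge0.
- exact: ler_wpM2l.
Qed.

End Differences.

(** * Modulated Gaussians *)

Section Gaussian.
Context {R : realType} {n : nat}.
Local Notation E := 'cV[R]_n.+1.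
Local Notation Re := complex.Re.
Local Notation Im := complex.Im.
Implicit Types (f g : E -> R[i]) (x y xi : E).

(** Scaled copies serve as test functions bounding the grand maximal function from below. *)
Definition gauss xi : E -> R[i] :=
  fun x => (expR (- dotv x x))%:C * expi (2 * pi * dotv x xi).

(* Polynomial multiples of the modulated Gaussian; a class closed under partial
   derivatives and under multiplication by coordinates. *)
Inductive gclass xi : (E -> R[i]) -> Prop :=
| gclass_gauss : gclass xi (gauss xi)
| gclassD f g : gclass xi f -> gclass xi g -> gclass xi (fun x => f x + g x)
| gclassZ (a : R[i]) f : gclass xi f -> gclass xi (fun x => a * f x)
| gclassX (i : 'I_n.+1) f : gclass xi f -> gclass xi (fun x => (x i 0)%:C * f x).

Lemma is_derive_line (g : E -> R) x v (d : R) :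
  is_derive (0 : R) 1 (fun b : R => g (b *: v + x)) d -> is_derive x v g d.
Proof.
have e : (fun h : R => h^-1 *:
    (((fun b : R => g (b *: v + x)) \o shift 0) (h *: (1 : R)) - g (0 *: v + x))) =
    (fun h : R => h^-1 *: ((g \o shift x) (h *: v) - g x)).
  by apply/funext => h /=; rewrite addr0 scale0r add0r -[h%:A]/(h * 1) mulr1.
by case; rewrite /derivable /derive e => ? ?; split.
Qed.

Definition cderive (i : 'I_n.+1) f f' := forall x,
  is_derive x (delta_mx i 0) (fun y => Re (f y)) (Re (f' x)) /\
  is_derive x (delta_mx i 0) (fun y => Im (f y)) (Im (f' x)).

Lemma cderive_partialC i f f' : cderive i f f' -> partialC i f = f'.
Proof.
by move=> ff; apply/funext => x; have [d1 d2] := ff x; apply: complexP; rewrite /= derive_val.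
Qed.

Lemma cderiveD i f g f' g' : cderive i f f' -> cderive i g g' ->
  cderive i (fun x => f x + g x) (fun x => f' x + g' x).
Proof.
move=> ff gg x; have [f1 f2] := ff x; have [g1 g2] := gg x; split.
  under [fun y => Re _]funext do rewrite cReD.
  by rewrite cReD; exact: is_deriveD.
under [fun y => Im _]funext do rewrite cImD.
by rewrite cImD; exact: is_deriveD.
Qed.

Lemma cderiveM i f g f' g' : cderive i f f' -> cderive i g g' ->
  cderive i (fun x => f x * g x) (fun x => f' x * g x + f x * g' x).
Proof.
move=> ff gg x; have [f1 f2] := ff x; have [g1 g2] := gg x; split.
  under [fun y => Re _]funext do rewrite cReM.
  apply: (is_derive_eq (is_deriveB (is_deriveM f1 g1) (is_deriveM f2 g2))).
  by rewrite cReD !cReM /GRing.scale/=; ring.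
under [fun y => Im _]funext do rewrite cImM.
apply: (is_derive_eq (is_deriveD (is_deriveM f1 g2) (is_deriveM f2 g1))).
by rewrite cImD !cImM /GRing.scale/=; ring.
Qed.

Lemma cderive_cst i (a : R[i]) : cderive i (fun=> a) (fun=> 0).
Proof. by move=> x; split; exact: is_derive_cst. Qed.

Lemma cderive_coord i j : cderive i (fun x => (x j 0)%:C) (fun=> (j == i)%:R%:C).
Proof.
move=> x; split; last exact: is_derive_cst.
apply: is_derive_line => /=.
rewrite (_ : (fun b => _) = (fun b : R => (j == i)%:R * b + x j 0)).
  by apply: is_derive_eq; rewrite addr0 /GRing.scale/= ?mulr1 ?mul1r ?mulr0 ?addr0.
by apply/funext => b; rewrite !mxE eqxx andbT mulrC.
Qed.

Lemma cderive_gauss xi i : cderive i (gauss xi)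
  (fun x => (-2)%:C * ((x i 0)%:C * gauss xi x) + (0 +i* (2 * pi * xi i 0)) * gauss xi x).
Proof.
move=> x; set q := dotv x x; set c := dotv x xi.
have qE (b : R) : dotv (b *: delta_mx i 0 + x) (b *: delta_mx i 0 + x) = q + 2 * b * x i 0 + b ^+ 2.
  rewrite dotvDl !dotvDr [dotv (b *: _) x]dotvC !dotvZr !dotv_delta !mxE !eqxx /= /q; ring.
have cE (b : R) : dotv (b *: delta_mx i 0 + x) xi = b * xi i 0 + c.
  by rewrite dotvDl (dotvC (_ *: _)) dotvZr dotv_delta.
pose w : R := 2 * pi.
have ReG y : Re (gauss xi y) = expR (- dotv y y) * cos (w * dotv y xi) by rewrite cReM/=; ring.
have ImG y : Im (gauss xi y) = expR (- dotv y y) * sin (w * dotv y xi) by rewrite cImM/=; ring.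
split; apply: is_derive_line.
  rewrite (_ : (fun b => _) = (fun b : R =>
    expR (- (q + 2 * b * x i 0 + b ^+ 2)) * cos (w * (b * xi i 0 + c)))); last first.
    by apply/funext => b; rewrite ReG qE cE.
  apply: is_derive_eq.
  rewrite cReD cReM [Re (_ * gauss xi x)]cReM cReM [Im (_ * gauss xi x)]cImM ReG ImG /=.
  by rewrite /GRing.scale/= -/q -/c -/w
  !(mul0r, mulr0, addr0, add0r, mulr1, mul1r, expr0, expr1) ?expr0n/= ?addr0; ring.
rewrite (_ : (fun b => _) = (fun b : R =>
  expR (- (q + 2 * b * x i 0 + b ^+ 2)) * sin (w * (b * xi i 0 + c)))); last first.
  by apply/funext => b; rewrite ImG qE cE.
apply: is_derive_eq.
rewrite cImD cImM [Re (_ * gauss xi x)]cReM cImM [Im (_ * gauss xi x)]cImM ReG ImG /=.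
by rewrite /GRing.scale/= -/q -/c -/w
  !(mul0r, mulr0, addr0, add0r, mulr1, mul1r, expr0, expr1) ?expr0n/= ?addr0; ring.
Qed.

Lemma gclass_derive xi i f : gclass xi f -> exists2 f', cderive i f f' & gclass xi f'.
Proof.
elim => {f} [|f g _ [f' ff cf] _ [g' gg cg]|a f fc [f' ff cf]|j f fc [f' ff cf]].
- eexists; first exact: cderive_gauss.
  by apply: gclassD; apply: gclassZ; [apply: gclassX|]; exact: gclass_gauss.
- eexists; first exact: (cderiveD ff gg).
  exact: gclassD.
- eexists; first exact: (cderiveM (@cderive_cst i a) ff).
  by apply: gclassD; exact: gclassZ.
- eexists; first exact: (cderiveM (@cderive_coord i j) ff).
  by apply: gclassD; [exact: gclassZ|exact: gclassX].
Qed.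

Lemma gclass_continuous xi f : gclass xi f ->
  continuous (fun x => Re (f x)) /\ continuous (fun x => Im (f x)).
Proof.
have cd y : continuous (fun x : E => dotv x y).
  apply: continuous_big => [|i _ x]; first exact: add_continuous.
  by apply: continuousM; [exact: coord_continuous|exact: cst_continuous].
have cq : continuous (fun x : E => dotv x x).
  apply: continuous_big => [|i _ x]; first exact: add_continuous.
  by apply: continuousM; exact: coord_continuous.
have cM (g h : E -> R) : continuous g -> continuous h -> continuous (fun x => g x * h x).
  by move=> cg ch x; apply: continuousM; [exact: cg|exact: ch].
have cD (g h : E -> R) : continuous g -> continuous h -> continuous (fun x => g x + h x).
  by move=> cg ch x; apply: continuousD; [exact: cg|exact: ch].
have cB (g h : E -> R) : continuous g -> continuous h -> continuous (fun x => g x - h x).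
  by move=> cg ch x; apply: continuousB; [exact: cg|exact: ch].
have cK (a : R) : continuous (fun _ : E => a) by move=> x; exact: cst_continuous.
have M f1 f2 : continuous (fun x => Re (f1 x)) /\ continuous (fun x => Im (f1 x)) ->
    continuous (fun x => Re (f2 x)) /\ continuous (fun x => Im (f2 x)) ->
    continuous (fun x => Re (f1 x * f2 x)) /\ continuous (fun x => Im (f1 x * f2 x)).
  move=> [? ?] [? ?]; under [fun x => Re _]funext do rewrite cReM.
  under [fun x => Im _]funext do rewrite cImM.
  by split; [apply: cB|apply: cD]; exact: cM.
elim => {f} [|f g _ [f1 f2] _ [g1 g2]|a f fc IH|j f fc IH].
- apply: M; split => //=.
  + have cq' : continuous (fun x : E => - dotv x x) by move=> x; exact: (continuousN (cq x)).
    by move=> x; apply: (continuous_comp (cq' x)); exact: continuous_expR.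
  + have cw : continuous (fun x : E => 2 * pi * dotv x xi) by exact: cM.
    by move=> x; apply: (continuous_comp (cw x)); exact: continuous_cos.
  + have cw : continuous (fun x : E => 2 * pi * dotv x xi) by exact: cM.
    by move=> x; apply: (continuous_comp (cw x)); exact: continuous_sin.
- under [fun x => Re _]funext do rewrite cReD.
  under [fun x => Im _]funext do rewrite cImD.
  by split; exact: cD.
- by apply: M.
- by apply: M => //; split=> //= x; exact: coord_continuous.
Qed.

(** For k > 0, 1 + q <= k (1 + q/k) <= k exp(q/k); then raise to the power k. *)
Lemma exp_poly_bound k : exists M : R, forall q : R, 0 <= q -> (1 + q) ^+ k * expR (- q) <= M.
Proof.
case: k => [|k].
  by exists 1 => q q0; rewrite expr0 mul1r -expR0 ler_expR oppr_le0.
exists (k.+1%:R ^+ k.+1) => q q0.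
have k0 : 0 < k.+1%:R :> R by rewrite ltr0n.
have e : expR q = expR (q / k.+1%:R) ^+ k.+1.
  by rewrite -expRM_natl mulrC divfK// gt_eqF.
rewrite expRN ler_pdivrMr ?expR_gt0// e -exprMn.
apply: lerXn2r; rewrite ?nnegrE.
- exact: addr_ge0.
- by rewrite mulr_ge0 ?expR_ge0.
apply: (@le_trans _ _ (k.+1%:R * (1 + q / k.+1%:R))).
  by rewrite mulrDr mulr1 mulrC divfK ?gt_eqF// lerD2r ler1n.
by rewrite ler_pM2l// expR_ge1Dx.
Qed.

(** A coordinate factor costs one more power of [1 + dotv x x], so the induction carries all k at
    once. *)
Lemma gclass_bound xi f : gclass xi f -> forall k, exists M : R, forall x,
  (1 + dotv x x) ^+ k * normc (f x) <= M.
Proof.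
elim => {f} [|f g _ IHf _ IHg|a f fc IH|j f fc IH] k.
- have [M HM] := exp_poly_bound k; exists M => x.
  by rewrite normcM normc_expi mulr1 normcR gtr0_norm ?expR_gt0//; exact/HM/dotv_ge0.
- have [M1 H1] := IHf k; have [M2 H2] := IHg k; exists (M1 + M2) => x.
  apply: le_trans (lerD (H1 x) (H2 x)); rewrite -mulrDr ler_wpM2l ?normcD//.
  by rewrite exprn_ge0// addr_ge0// dotv_ge0.
- have [M HM] := IH k; exists (normc a * M) => x.
  by rewrite normcM mulrCA ler_wpM2l ?normc_ge0.
- have [M HM] := IH k.+1; exists M => x; apply: le_trans (HM x).
  rewrite normcM normcR exprSr -mulrA ler_wpM2l ?exprn_ge0 ?addr_ge0 ?dotv_ge0//.
  rewrite ler_wpM2r ?normc_ge0//.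
  have : `|x j 0| ^+ 2 <= dotv x x.
    by rewrite -enorm_sqr ler_pXn2r ?nnegrE ?enorm_ge0// coord_le_enorm.
  by move: (normr_ge0 (x j 0)); nra.
Qed.

Lemma gclass_foldr xi f s : gclass xi f -> gclass xi (foldr partialC f s).
Proof.
move=> fc; elim: s => //= i s IH.
by have [f' /cderive_partialC ->] := gclass_derive i IH.
Qed.

Lemma gclass_pder xi f al : gclass xi f -> gclass xi (pder al f).
Proof. by rewrite pder_alflat; exact: gclass_foldr. Qed.

Lemma gclass_monom xi f al : gclass xi f -> gclass xi (fun x => (monom al x)%:C * f x).
Proof.
move=> fc; rewrite /monom; elim: (index_enum _) => [|i s IH].
  by under [fun x => _]funext do rewrite big_nil mul1r.
under [fun x => _]funext do rewrite big_cons rmorphM -mulrA.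
elim: (al i) => [|m IHm]; first by under [fun x => _]funext do rewrite expr0 mul1r.
under [fun x => _]funext do rewrite exprS rmorphM -mulrA.
exact: (@gclassX _ i).
Qed.

Lemma gclass_schwartz xi f : gclass xi f -> schwartz f.
Proof.
move=> fc; split.
  move=> s /=; have gc := gclass_foldr s fc.
  have [c1 c2] := gclass_continuous gc; split=> // i x.
  by have [f' ff _] := gclass_derive i gc; have [[? _] [? _]] := ff x.
move=> al be; have [M HM] := gclass_bound (gclass_monom al (gclass_pder be fc)) 0.
by exists M => x; have := HM x; rewrite expr0 mul1r.
Qed.

End Gaussian.

(** * The quasi-norm and polynomial weights *)

Section Weight.
Context {R : realType} {n : nat}.
Local Notation E := 'cV[R]_n.+1.
Context (A P : 'M[R]_n.+1) (t : R).
Context (uP : P \in unitmx) (t1 : 1 < t).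
Local Notation D := [set x : E | enorm (P *m x) < 1].
Context (tDA : [set t *: x | x in D] `<=` [set A *m x | x in D]).
Implicit Types (x y z u : E) (k : int) (phi : E -> R[i]).

Let uA : A \in unitmx := expansive_unit t1 tDA.
Let t0 : 0 < t := t_gt0 t1.
Local Notation pn := (pnorm P).
Local Notation Lam := (opA A P t).

Lemma mulmx_exprz_inv k x : A ^ k *m (A ^ (- k) *m x) = x.
Proof.
rewrite mulmxA -[A ^ k *m _]/(A ^ k * A ^ (- k)) -exprzDr// subrr expr0z.
by rewrite mul1mx.
Qed.

Lemma exprz_inv_mulmx k x : A ^ (- k) *m (A ^ k *m x) = x.
Proof. by rewrite -{2}[k]opprK mulmx_exprz_inv. Qed.

Lemma exprz_invmx m : A ^ (- (m%:Z)) = invmx (A ^+ m).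
Proof. by case: m => [|m] //; rewrite oppr0 expr0z expr0 invmx1. Qed.

Lemma BsetE k x : Bset A D k x <-> pn (A ^ (- k) *m x) < 1.
Proof.
split; first by move=> [y Dy <-]; rewrite exprz_inv_mulmx.
by move=> h; exists (A ^ (- k) *m x) => //; rewrite mulmx_exprz_inv.
Qed.

Lemma Bset_nat m x : Bset A D m%:Z x -> pn x <= Lam ^+ m.
Proof.
move=> [y /= Dy <-]; rewrite -[A ^ m%:Z]/(A ^+ m).
apply: (le_trans (pnorm_An A uP t1 _ _)).
by rewrite ler_piMr ?exprn_ge0 ?ltW// ?(lt_trans _ (opA_gt1 _ _ t1)).
Qed.

Lemma Bset_neg m x : Bset A D (- m%:Z) x -> pn x < 1.
Proof.
move=> [y /= Dy <-]; rewrite exprz_invmx.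
apply: (le_lt_trans (pnorm_invAn t1 tDA _ _)).
rewrite ltr_pdivrMr ?exprn_gt0// mul1r (lt_le_trans Dy)// exprn_ege1// ltW//.
Qed.

Lemma not_Bset_nat m x : ~ Bset A D m%:Z x -> t ^+ m <= pn x.
Proof.
move=> /BsetE /negP; rewrite -leNgt exprz_invmx => h.
have := pnorm_invAn t1 tDA m x.
by rewrite ler_pdivlMr ?exprn_gt0//; apply: le_trans; rewrite ler_peMl// exprn_ge0// ltW.
Qed.

(** The working weight: submultiplicative up to a factor 2, and tied to [rho] only through powers,
    by [SN_decay] and [rho_le]. *)
Definition pw x : R := Num.max 1 (pn x).

Lemma pw_ge1 x : 1 <= pw x. Proof. by rewrite le_max lexx. Qed.

Lemma pw_gt0 x : 0 < pw x. Proof. exact: lt_le_trans (pw_ge1 x). Qed.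

Lemma pw_ge x : pn x <= pw x. Proof. by rewrite le_max lexx orbT. Qed.

Lemma pwX_gt0 x m : 0 < pw x ^+ m. Proof. by rewrite exprn_gt0// pw_gt0. Qed.

Lemma pwX_ge1 x m : 1 <= pw x ^+ m. Proof. by rewrite exprn_ege1// pw_ge1. Qed.

Lemma pw_le x (a : R) : 1 <= a -> pn x <= a -> pw x <= a.
Proof. by move=> a1 xa; rewrite ge_max a1. Qed.

Lemma pwD x y : pw (x + y) <= 2 * pw x * pw y.
Proof.
have [x1 y1] := (pw_ge1 x, pw_ge1 y).
apply: pw_le; first by nra.
apply: (le_trans (pnormD _ _ _)); apply: (le_trans (lerD (pw_ge x) (pw_ge y))); nra.
Qed.

Lemma pwB x y : pw (x - y) <= 2 * pw x * pw y.
Proof. by apply: (le_trans (pwD _ _)); rewrite /pw pnormN. Qed.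

(** If rho x = b^m with b = [bdet A], then x lies in B_(m+1) and its gauge is at most Lam^(m+1); so
    the Q-th power of the weight is at most Lam^Q times b^(N m). *)
Lemma SN_decay (N Q : nat) phi al x : 1 < bdet A -> Lam ^+ Q <= bdet A ^+ N ->
  SN A D N phi -> (mlen al <= N)%N -> pw x ^+ Q * normc (pder al phi x) <= Lam ^+ Q.
Proof.
move=> b1 bL [_ /(_ x al) H] /H {}H.
have L1 := opA_gt1 A P t1; have L0 : 0 < Lam by exact: lt_trans L1.
have [x1|x1] := leP (pn x) 1.
  rewrite /pw max_l// expr1n mul1r; apply: (@le_trans _ _ 1); last by rewrite exprn_ege1// ltW.
  apply: le_trans H; rewrite ler_peMl ?normc_ge0//; by rewrite le_max lexx.
apply: le_trans
  (_ : Lam ^+ Q * (Num.max 1 (rho A D x ^+ N) * normc (pder al phi x)) <= _); last first.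
  by rewrite ler_piMr// exprn_ge0// ltW.
rewrite mulrA ler_wpM2r ?normc_ge0//.
have -> : pw x = pn x by rewrite /pw max_r// ltW.
suff [m mx rE] : exists2 m : nat, pn x <= Lam ^+ m.+1 & rho A D x = bdet A ^+ m.
  apply: (@le_trans _ _ (Lam ^+ Q * rho A D x ^+ N)).
    rewrite rE exprAC; apply: (@le_trans _ _ (Lam ^+ Q * (Lam ^+ Q) ^+ m)).
      rewrite -exprS exprAC; apply: lerXn2r => //; rewrite nnegrE ?pnorm_ge0//.
      exact/exprn_ge0/ltW.
    rewrite ler_pM2l ?exprn_gt0//; apply: lerXn2r => //; rewrite nnegrE; apply: exprn_ge0.
      exact: ltW.
    by rewrite normr_ge0.
  by rewrite ler_pM2l ?exprn_gt0// le_max lexx orbT.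
have x0 : x != 0 by apply: contraTneq x1 => ->; rewrite pnorm0 -leNgt ler01.
rewrite /rho (negbTE x0); set X := [set _ | _].
have [k Xk] : exists k, X k.
  (* Take the least m with x in B_m. It is positive because the gauge of x exceeds 1, and its
     predecessor is the index sought. *)
  have ex : exists m, `[< Bset A D m%:Z x >].
    have [J HJ] := @eventually_small R t t1 (pn x) 2^-1 ltac:(by rewrite invr_gt0).
    exists J; apply/asboolP/BsetE; rewrite exprz_invmx.
    apply: (le_lt_trans (pnorm_invAn t1 tDA _ _)); apply: (le_lt_trans (HJ J (leqnn J))).
    by rewrite invf_lt1// ltr1n.
  case: (ex_minnP ex) => m /asboolP Bm mmin.
  case: m Bm mmin => [/Bset_nat|m Bm mmin]; first by rewrite expr0 leNgt x1.
  exists m%:Z; split; first by rewrite -PoszD addn1.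
  by move=> Bm'; have := mmin m (asboolT Bm'); rewrite ltnn.
case: (xgetPex 0 (ex_intro _ k Xk)); set k' := xget 0 X => B1 B2.
(* A negative index [Negz m] would put x in B_(-m), where the gauge is below 1. *)
case: k' B1 B2 => m B1 B2.
  exists m => //; apply: Bset_nat; by rewrite -PoszD addn1 in B1.
have : pn x < 1.
  have e : Negz m + 1 = - m%:Z by rewrite NegzE -addn1 PoszD opprD subrK.
  by rewrite e in B1; exact: Bset_neg B1.
by move=> /(lt_trans x1); rewrite ltxx.
Qed.

(** Outside B_m the gauge is at least t^m, and [bdet A ^+ m] is at most (t^m)^d. *)
Lemma rho_le (d : nat) x : 1 < bdet A -> bdet A <= t ^+ d -> 0 <= rho A D x <= pw x ^+ d.
Proof.
move=> b1 bt; rewrite /rho; case: eqVneq => [_|x0]; first by rewrite lexx/= ltW// pwX_gt0.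
have b0 : 0 < bdet A by exact: lt_trans b1.
rewrite (exprz_ge0 _ (ltW b0))/=; set X := [set _ | _].
(* Without an admissible index, [xget] returns 0 and the value is 1. *)
case: xgetP => [k kE [_ B2]|_]; last by rewrite expr0z pwX_ge1.
case: k {kE} B2 => m B2; last first.
  rewrite NegzE -invr_expz; apply: (@le_trans _ _ 1); last exact: pwX_ge1.
  by rewrite -[_ ^ _]/(bdet A ^+ _) invf_le1 ?exprn_gt0// exprn_ege1// ltW.
rewrite -[_ ^ m]/(bdet A ^+ m); apply: (@le_trans _ _ ((t ^+ d) ^+ m)).
  by apply: lerXn2r => //; rewrite nnegrE; [exact: ltW|exact/exprn_ge0/ltW].
rewrite exprAC; apply: lerXn2r; rewrite ?nnegrE; [exact/exprn_ge0/ltW|exact/ltW/pw_gt0|].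
by rewrite (le_trans (not_Bset_nat B2))// pw_ge.
Qed.

(** Each 1 + x_i^2 is at most a constant times the square of the weight, so 2(n+1) powers of the
    weight always pay for integrability. *)
Lemma pw_bweight : exists2 Cw : R, 0 < Cw & forall x, 1 <= Cw * pw x ^+ (n.+1).*2 * bweight x.
Proof.
pose K := mxnorm1 (invmx P); have K0 : 0 <= K by exact: mxnorm1_ge0.
have K1 : 0 < 1 + K ^+ 2 by rewrite ltr_pwDl// sqr_ge0.
exists ((1 + K ^+ 2) ^+ n.+1) => [|x]; first by rewrite exprn_gt0.
rewrite /bweight prodfV ler_pdivlMr; last first.
  by apply: prodr_gt0 => i _; rewrite ltr_pwDl// sqr_ge0.
rewrite mul1r -mul2n exprM -exprMn -[X in _ ^+ X]card_ord -prodr_const.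
apply: ler_prod => i _; rewrite addr_ge0 ?sqr_ge0//=.
have h1 : `|x i 0| <= K * pw x.
  apply: (le_trans (coord_le_enorm x i)); apply: (le_trans (enorm_pnorm uP x)).
  by rewrite ler_wpM2l// pw_ge.
have := pw_ge1 x; have -> : x i 0 ^+ 2 = `|x i 0| ^+ 2 by rewrite real_normK ?num_real.
have := normr_ge0 (x i 0) => h0 h2.
have : `|x i 0| ^+ 2 <= (K * pw x) ^+ 2 by rewrite lerXn2r// nnegrE mulr_ge0// ltW// pw_gt0.
have : 1 <= pw x ^+ 2 by exact: pwX_ge1.
rewrite exprMn; nra.
Qed.

Lemma pw_dotv : exists2 C : R, 0 < C & forall x, pw x ^+ 2 <= C * (1 + dotv x x).
Proof.
pose K := mxnorm1 P; have K0 : 0 <= K by exact: mxnorm1_ge0.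
exists (1 + K ^+ 2) => [|x]; first by rewrite ltr_pwDl// sqr_ge0.
rewrite -enorm_sqr /pw; have e0 := enorm_ge0 x.
have : pn x ^+ 2 <= (K * enorm x) ^+ 2.
  by rewrite lerXn2r// ?nnegrE ?pnorm_ge0// ?mulr_ge0// pnorm_enorm.
have := mulr_ge0 (sqr_ge0 K) (sqr_ge0 (enorm x)).
have := sqr_ge0 (enorm x); have := sqr_ge0 K; rewrite exprMn.
set a := K ^+ 2; set e := enorm x ^+ 2; set c := pn x ^+ 2 => h1 h2 h3 h4.
have [h|h] : Num.max 1 (pn x) ^+ 2 = 1 \/ Num.max 1 (pn x) ^+ 2 = c.
  by case: leP => _; [right|left; rewrite expr1n].
- rewrite h; nra.
- rewrite h; nra.
Qed.

End Weight.

(** * Wave packets *)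

Section WavePacket.
Context {R : realType} {n : nat}.
Local Notation TR := (measurableTypeR R).
Local Notation E := 'cV[R]_n.+1.
Implicit Types (x y z h xi : E) (f g Phi : E -> R[i]).

Lemma sincw_ge0 d m x : 0 <= sincw d m x.
Proof. by apply: prodr_ge0 => i _; rewrite exprn_ge0// sqr_ge0. Qed.

Lemma measv_sincw d m : measv (fun x : E => sincw d m x : TR).
Proof.
apply: measurable_prod => i _.
rewrite -[fun _ => _]/(fun t => (sinc (2 * pi * d * (@vec R _ t) i 0) ^+ 2) ^+ m).
have ms : measurable_fun setT (fun t : n.+1.-tuple TR => sinc (2 * pi * d * (@vec R _ t) i 0) : TR).
  exact: measv_sinc.
by apply: measurable_funX; exact: measurable_funX.
Qed.

(** Against x_i^2 only the i-th sinc factor is used, the others being at most 1; summing over i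
    bounds (1 + |x|^2) times the product of the sinc squares, and the m-th power follows. *)
Lemma sincw_decay (P : 'M[R]_n.+1) (d : R) (m : nat) : 0 < d ->
  exists C : R, forall x, pw P x ^+ m.*2 * sincw d m x <= C.
Proof.
move=> d0; have [C C0 HC] := pw_dotv P.
pose c : R := 2 * pi * d; have c0 : 0 < c by rewrite !mulr_gt0// pi_gt0.
pose K : R := 1 + n.+1%:R * (2 / c ^+ 2).
exists ((C * K) ^+ m) => x.
have -> : sincw d m x = (\prod_i sinc (c * x i 0) ^+ 2) ^+ m by rewrite -prodrXl.
rewrite -mul2n exprM -exprMn; set p := \prod_i _.
have p01 : 0 <= p <= 1.
  rewrite prodr_ge0/=; last by move=> i _; exact: sqr_ge0.
  apply: prodr_ile1 => i _; rewrite sqr_ge0/= -real_normK ?num_real// expr_le1//.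
  exact: norm_sinc_le1.
have [p0 p1] := andP p01.
have pK : (1 + dotv x x) * p <= K.
  rewrite mulrDl mul1r; apply: lerD => //.
  rewrite /dotv mulr_suml; apply: (@le_trans _ _ (\sum_(i < n.+1) (2 / c ^+ 2))); last first.
    by rewrite sumr_const card_ord -[leLHS]mulr_natl.
  apply: ler_sum => i _; rewrite -expr2.
  have pi_ : p <= sinc (c * x i 0) ^+ 2.
    rewrite /p (bigD1 i)//= ler_piMr ?sqr_ge0//.
    apply: prodr_ile1 => j _; rewrite sqr_ge0/= -real_normK ?num_real// expr_le1//.
    exact: norm_sinc_le1.
  apply: (@le_trans _ _ (x i 0 ^+ 2 * (2 / (1 + (c * x i 0) ^+ 2)))).
    by rewrite ler_wpM2l ?sqr_ge0// (le_trans pi_)// sinc_sqr_le.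
  rewrite mulrA ler_pdivrMr; last by rewrite ltr_pwDl// sqr_ge0.
  rewrite [leRHS]mulrAC ler_pdivlMr ?exprn_gt0// (exprMn 2 c).
  by have := sqr_ge0 (x i 0); nra.
apply: lerXn2r; rewrite ?nnegrE.
- by rewrite mulr_ge0 ?exprn_ge0// ltW// pw_gt0.
- by rewrite mulr_ge0 ?(ltW C0)// addr_ge0// mulr_ge0// divr_ge0// exprn_ge0// ltW.
apply: (@le_trans _ _ (C * (1 + dotv x x) * p)); first by rewrite ler_wpM2r.
by rewrite -mulrA ler_wpM2l// ltW.
Qed.

Definition wdecay (P : 'M[R]_n.+1) (K : nat) f :=
  exists2 C : R, 0 <= C & forall x, pw P x ^+ K * normc (f x) <= C.

Lemma wdecay_diff P K h f : wdecay P K f -> wdecay P K (fdiff h f).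
Proof.
move=> [C C0 HC]; exists (C + (2 * pw P h) ^+ K * C).
  by rewrite addr_ge0// mulr_ge0// exprn_ge0// mulr_ge0// ltW// pw_gt0.
move=> x; rewrite /fdiff; apply: (@le_trans _ _ (pw P x ^+ K * (normc (f x) + normc (f (x - h))))).
  by rewrite ler_wpM2l ?normcB// exprn_ge0// ltW// pw_gt0.
rewrite mulrDr lerD//.
apply: (@le_trans _ _ ((2 * pw P h) ^+ K * (pw P (x - h) ^+ K * normc (f (x - h))))).
  rewrite mulrA -exprMn ler_wpM2r ?normc_ge0//; apply: lerXn2r.
  - by rewrite nnegrE ltW// pw_gt0.
  - by rewrite nnegrE !mulr_ge0// ltW// pw_gt0.
  - by rewrite -{1}(subrK h x) (le_trans (pwD _ _ _))// mulrAC.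
by rewrite ler_wpM2l// exprn_ge0// mulr_ge0// ltW// pw_gt0.
Qed.

Lemma wdecay_iter P K h f L : wdecay P K f -> wdecay P K (iter L (fdiff h) f).
Proof. by move=> wf; elim: L => //= L; exact: wdecay_diff. Qed.

Lemma cint_diff h f : cint f -> cint (fdiff h f).
Proof.
move=> cf; have [cs _] := cint_shift (- h) cf; have [c _] := cintB cf cs.
exact: c.
Qed.

Lemma cint_iter_diff h f L : cint f -> cint (iter L (fdiff h) f).
Proof. by move=> cf; elim: L => //= L; exact: cint_diff. Qed.

Lemma measC_reflect f y : measC f -> measC (fun z => f (y - z)).
Proof.
move=> /(@measC_mulmx _ _ _ (- 1%:M) y).
by under [X in measC X]funext do rewrite mulNmx mul1mx addrC.
Qed.

(** Summation by parts. The variable enters the test function as y - z, so the step keeps its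
    sign. *)
Lemma conv_diff G Phi h y L (K : R) : cint G -> measC Phi -> (forall x, normc (Phi x) <= K) ->
  integC (fun z => iter L (fdiff h) G z * Phi (y - z)) =
  integC (fun z => G z * iter L (fdiff h) Phi (y - z)).
Proof.
move=> cG; elim: L Phi K => // L IH Phi K mP PK.
have cF := cint_iter_diff h L cG; rewrite (iterSr L (fdiff h) Phi) (iterS L (fdiff h) G).
set F := iter L (fdiff h) G in cF *.
have mD : measC (fdiff h Phi).
  apply: measCD => //; apply: measCN.
  have := @measC_mulmx _ _ _ 1%:M (- h) mP.
  by under [X in measC X]funext do rewrite mul1mx.
rewrite -(IH _ (K + K) mD); last first.
  by move=> x; apply: (le_trans (normcB _ _)); exact: lerD.
have c1 : cint (fun z => F z * Phi (y - z)) by apply: (cintMb (K := K)) => //; exact: measC_reflect.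
have c2 : cint (fun z => F z * Phi (y - z - h)).
  apply: (cintMb (K := K)) => //.
  by have := measC_reflect (y - h) mP; under [X in measC X]funext do rewrite addrAC.
have [c3 e3] := cint_shift (- h) c2.
have [_ e4] := cintB c1 c3; have [_ e5] := cintB c1 c2.
transitivity (integC (fun x => F x * Phi (y - x) - F (x - h) * Phi (y - (x - h) - h))).
  congr integC; apply/funext => x; rewrite /fdiff -/F mulrBl; congr (_ - _ * Phi _).
  by rewrite opprB addrA addrAC addrK.
rewrite e4 e3 -e5; congr integC; apply/funext => x.
by rewrite /fdiff mulrBr.
Qed.

Definition packet xi (d : R) (m : nat) : E -> R[i] :=
  fun x => expi (2 * pi * dotv x xi) * (sincw d m x)%:C.

(** Normalised to have scalar product 1/2 with xi. *)
Definition halfwave xi : E := (2 * dotv xi xi)^-1 *: xi.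

Lemma measC_packet xi d m : measC (packet xi d m).
Proof. by apply: measCM; [exact: measC_expi|apply: measCR; exact: measv_sincw]. Qed.

Lemma normc_packet xi d m x : normc (packet xi d m x) = sincw d m x.
Proof. by rewrite normcM normc_expi mul1r normcR ger0_norm// sincw_ge0. Qed.

(* Shifting by half a wavelength changes the sign of the exponential, so the
   differences add up. *)
Lemma iter_diff_packet xi d m L : xi != 0 ->
  exists2 W : E -> R, forall x, sincw d m x <= W x &
    iter L (fdiff (halfwave xi)) (packet xi d m) = fun x => expi (2 * pi * dotv x xi) * (W x)%:C.
Proof.
move=> xi0; elim: L => [|L [W W1 W2]]; first by exists (sincw d m).
have q0 : dotv xi xi != 0.
  by apply: contra xi0 => /eqP q0; apply/eqP/enorm_eq0; rewrite /enorm q0 sqrtr0.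
exists (fun x => W x + W (x - halfwave xi)) => [x|].
  by rewrite -[leLHS]addr0 lerD// (le_trans (sincw_ge0 _ _ _) (W1 _)).
rewrite iterS W2; apply/funext => x; rewrite /fdiff.
have -> : 2 * pi * dotv (x - halfwave xi) xi = 2 * pi * dotv x xi + - pi.
  rewrite dotvDl dotvNl [dotv (halfwave xi) _]dotvC /halfwave dotvZr; field; exact: q0.
have -> : expi (2 * pi * dotv x xi + - pi) = - expi (2 * pi * dotv x xi).
  by apply: complexP; rewrite ?cReN ?cImN/= ?cosD ?sinD cosN sinN cospi sinpi; ring.
by rewrite mulNr opprK -mulrDr; congr (_ * _); apply: complexP; rewrite ?cReD ?cImD//= addr0.
Qed.

(** A zero integral would force g to vanish almost everywhere, but g is positive on the cube where
    every sinc argument is at most 1, and that cube has positive volume. *)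
Lemma integR_gt0 (g : E -> R) (d : R) (m : nat) : 0 < d ->
  rint g -> (forall x, 0 <= g x) ->
  (forall x, 0 < sincw d m x -> 0 < g x) -> 0 < integR g.
Proof.
move=> d0 ig g0 gp.
have c0 : 0 < 2 * pi * d by rewrite !mulr_gt0// pi_gt0.
rewrite lt_def Rintegral_ge0 ?andbT//; apply/eqP => I0.
have fi := integrable_fin_num measurableT ig.
have J0 : (\int[lebesgue n.+1]_x `|(g (vec x))%:E| = 0)%E.
  under eq_integral do rewrite abse_EFin ger0_norm//.
  by rewrite -(fineK fi); congr EFin.
have := (ae_eq_integral_abs (lebesgue n.+1) measurableT (measurable_int _ ig)).1 J0 => ae0.
pose K := (2 * pi * d)^-1.
have : lint (fun x : E => (cube K x)%:E) = 0%E.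
  rewrite /lint; under eq_integral do rewrite -[(cube K _)%:E]gee0_abs ?lee_fin ?cube_ge0//.
  have mc : measurable_fun setT (fun t : n.+1.-tuple TR => (cube K (vec t))%:E).
    exact: measv_cube.
  apply: ((ae_eq_integral_abs (lebesgue n.+1) measurableT mc).2).
  apply: filterS ae0 => t /= gt _; have := gt I => -[gz].
  apply/eqP; apply: contraT; rewrite eqe => /cube_neq0 ck.
  suff : 0 < g (vec t) by rewrite gz ltxx.
  apply: gp; apply: prodr_gt0 => i _; apply: exprn_gt0; apply: sinc_sqr_gt0.
  rewrite normrM (gtr0_norm c0).
  by have := ck i; rewrite /K -ler_pdivlMl// mulr1.
rewrite lint_cube ?invr_ge0 ?ltW// => -[]/eqP.
by rewrite expf_eq0/= mulrn_eq0/= invr_eq0 gt_eqF.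
Qed.

End WavePacket.

(** * Grand maximal functions *)

Section GrandMaximal.
Context {R : realType} {n : nat}.
Local Notation E := 'cV[R]_n.+1.
Context (A P : 'M[R]_n.+1) (t : R).
Context (uP : P \in unitmx) (t1 : 1 < t).
Local Notation D := [set x : E | enorm (P *m x) < 1].
Context (tDA : [set t *: x | x in D] `<=` [set A *m x | x in D]).
Context (b1 : 1 < bdet A).
Implicit Types (x y z u : E) (k : int) (phi F G : E -> R[i]).

Let uA : A \in unitmx := expansive_unit t1 tDA.
Let t0 : 0 < t := t_gt0 t1.
Let b0 : 0 < bdet A := lt_trans ltr01 b1.
Local Notation pn := (pnorm P).
Local Notation w := (pw P).
Local Notation Lam := (opA A P t).

Lemma unit_An m : A ^+ m \in unitmx.
Proof. by rewrite -[_ \in unitmx]/(A ^+ m \is a GRing.unit) unitrX. Qed.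

Lemma norm_det_An m : `|\det (A ^+ m)| = bdet A ^+ m.
Proof.
rewrite /bdet; elim: m => [|m IH]; first by rewrite !expr0 det1 normr1.
by rewrite !exprS -[A * _]/(A *m _) det_mulmx normrM IH.
Qed.

(** Common core of the two convolution estimates. [X], [a] and [c] are the weights at x and at the
    arguments of the two factors; of the q + r powers of [c], q help to dominate [X ^+ q] and r are
    spent on integrability. *)
Lemma weighted_product (X a c s f g bw Cw Cf Cg : R) (q r : nat) :
  0 < X -> 1 <= a -> 1 <= c -> 0 <= f -> 0 <= g -> 0 <= Cf -> 0 <= Cg ->
  0 <= Cw -> 0 <= bw -> 0 <= s ->
  X ^+ q <= s * (a ^+ q * c ^+ q) -> a ^+ q * f <= Cf -> c ^+ (q + r) * g <= Cg ->
  1 <= Cw * c ^+ r * bw ->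
  f * g <= (s * Cf * Cg * Cw) / X ^+ q * bw.
Proof.
move=> X0 a1 c1 f0 g0 Cf0 Cg0 Cw0 bw0 s0 XX Hf Hg Hw.
have cq : 0 <= c ^+ q by rewrite exprn_ge0// (le_trans ler01).
have aq : 0 <= a ^+ q by rewrite exprn_ge0// (le_trans ler01).
have H1 : c ^+ q * g <= Cg * Cw * bw.
  apply: (@le_trans _ _ (c ^+ q * g * (Cw * c ^+ r * bw))).
    by rewrite ler_peMr// mulr_ge0.
  rewrite (_ : _ * _ * _ = (c ^+ (q + r) * g) * (Cw * bw)); last by rewrite exprD; ring.
  by rewrite -[leRHS]mulrA ler_wpM2r// mulr_ge0.
rewrite mulrAC ler_pdivlMr ?exprn_gt0//.
apply: (@le_trans _ _ (f * g * (s * (a ^+ q * c ^+ q)))); first by rewrite ler_wpM2l// mulr_ge0.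
rewrite (_ : f * g * _ = s * ((a ^+ q * f) * (c ^+ q * g))); last by ring.
rewrite (_ : s * _ * _ * _ * _ = s * (Cf * (Cg * Cw * bw))); last by ring.
by rewrite ler_wpM2l// ler_pM// mulr_ge0.
Qed.

Lemma integRZ (a : R) (f : E -> R) : rint f -> integR (fun x => a * f x) = a * integR f.
Proof. by move=> ih; rewrite /integR RintegralZl. Qed.

(** With u = A^m (y - z) the test function becomes undilated and F is read at y - A^-m u. As A^-m
    contracts the gauge, the estimate is uniform in m without any cancellation. *)
Lemma conv_small F (q N : nat) : cint F -> wdecay P (q + n.+1.*2) F ->
  Lam ^+ (q + n.+1.*2) <= bdet A ^+ N ->
  exists2 C : R, 0 <= C & forall phi m x y, SN A D N phi -> Bset A D (- m%:Z) (y - x) ->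
    normc (Defs.conv (distr_of F) (dilate A (- m%:Z) phi) y) <= C / w x ^+ q.
Proof.
move=> cF [CF CF0 HF] LN; have [Cw Cw0 HCw] := pw_bweight uP.
have L0 : 0 < Lam by rewrite (lt_trans _ (opA_gt1 _ _ t1)).
set Q := (q + _)%N in LN HF.
pose K := 4 ^+ q * CF * Lam ^+ Q * Cw.
have I0 : 0 <= integR (@bweight R n.+1) by apply: Rintegral_ge0 => u _; exact/ltW/bweight_gt0.
exists (2 * (K * integR (@bweight R n.+1))) => [|phi m x y Sphi Bxy].
  by rewrite !mulr_ge0// ?exprn_ge0// ltW.
set B := invmx (A ^+ m).
pose H u := F (y - B *m u) * phi u.
have Hdecay u : normc (H u) <= K / w x ^+ q * bweight u.
  rewrite normcM; apply: (@weighted_product _ (w (y - B *m u)) (w u) (4 ^+ q) _ _ _ _ _ _ q n.+1.*2);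
    rewrite ?pw_gt0 ?pw_ge1 ?normc_ge0 ?exprn_ge0//; try exact: ltW.
  - exact/ltW/bweight_gt0.
  - rewrite -!exprMn; apply: lerXn2r; rewrite ?nnegrE.
    + exact/ltW/pw_gt0.
    + by rewrite !mulr_ge0// ltW// pw_gt0.
    (* Two quasi-triangle inequalities give the 4; y - x has weight 1, and B does not increase the
       weight of u. *)
    have -> : x = (y - B *m u) + (B *m u - (y - x)) by rewrite opprB addrA subrK addrC subrK.
    apply: (le_trans (pwD _ _ _)); rewrite (_ : 4 = 2 * 2 :> R); last by ring.
    rewrite -!mulrA ler_wpM2l// mulrCA ler_wpM2l ?(ltW (pw_gt0 _ _))//.
    apply: (le_trans (pwB _ _ _)); rewrite -mulrA ler_wpM2l//.
    have -> : w (y - x) = 1.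
      by rewrite /pw max_l// ltW// (Bset_neg t1 tDA Bxy).
    rewrite mulr1; apply: pw_le; first exact: pw_ge1.
    apply: le_trans (pw_ge _ _); apply: (le_trans (pnorm_invAn t1 tDA _ _)).
    by rewrite ler_pdivrMr ?exprn_gt0// ler_peMr ?pnorm_ge0// exprn_ege1// ltW.
  - apply: le_trans (HF (y - B *m u)); rewrite ler_wpM2r ?normc_ge0// /Q exprD.
    by rewrite ler_peMr ?pwX_ge1// ltW// pwX_gt0.
  - have := @SN_decay _ _ _ _ _ uP t1 tDA N Q phi (fun=> 0%N) u b1 LN Sphi.
    by rewrite pder0; apply; rewrite /mlen big1.
have mphi : measC phi by apply: schwartz_measC; have [] := Sphi.
have mH : measC H.
  apply: measCM => //; have := @measC_mulmx _ _ _ (- B) y (cint_measC cF).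
  by under [X in measC X]funext do rewrite mulNmx addrC.
have rw : rint (fun u => K / w x ^+ q * bweight u) by apply: rintZ; exact: rint_bweight.
have cH : cint H by exact: cint_dom mH Hdecay rw.
(* The substitution u = A^m (y - z) has linear part -A^m. *)
have uN : - (A ^+ m) \in unitmx.
  by rewrite -scaleN1r unitmxZ ?unit_An// unitrN1.
have [_ e] := cint_mulmx (A ^+ m *m y) uN cH.
have dN : `|\det (- A ^+ m)| = bdet A ^+ m.
  by rewrite -scaleN1r detZ normrM normrX normrN1 expr1n mul1r norm_det_An.
have bm0 : 0 < bdet A ^+ m by rewrite exprn_gt0.
have -> : Defs.conv (distr_of F) (dilate A (- m%:Z) phi) y = integC H.
  have [_ e2] := cintZ (bdet A ^+ m)%:C cH.
  rewrite /Defs.conv /distr_of; transitivity ((bdet A ^+ m)%:C *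
      integC (fun z => H (- A ^+ m *m z + A ^+ m *m y))).
    have [c3 _] := cint_mulmx (A ^+ m *m y) uN cH.
    have [_ <-] := cintZ (bdet A ^+ m)%:C c3.
    congr integC; apply/funext => z; rewrite /H /dilate opprK -[_ ^ m%:Z]/(bdet A ^+ m).
    rewrite -[A ^ m%:Z]/(A ^+ m) (_ : - A ^+ m *m z + A ^+ m *m y = A ^+ m *m (y - z)); last first.
      by rewrite mulmxBr mulNmx addrC.
    by rewrite /B mulKmx ?unit_An// subKr; ring.
  rewrite e dN mulrA -rmorphM/= mulfV ?gt_eqF//.
  by rewrite -[LHS]/(1 * _) mul1r.
apply: (le_trans (normc_integC mH Hdecay rw)).
rewrite integRZ; last exact: rint_bweight.
by rewrite le_eqVlt; apply/orP; left; apply/eqP; ring.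
Qed.

Lemma iter_diff_mulmx (B : 'M[R]_n.+1) (e : R[i]) h phi L :
  iter L (fdiff h) (fun v => e * phi (B *m v)) = fun v => e * iter L (fdiff (B *m h)) phi (B *m v).
Proof.
elim: L => //= L ->; apply/funext => v; rewrite /fdiff mulrBr; congr (_ - _ * _).
by rewrite mulmxBr.
Qed.

(** The step A^-m h has size at most a constant over t^m, so L differences gain t^(-L m). *)
Lemma iter_diff_decay (N L Q : nat) h : (L <= N)%N -> Lam ^+ Q <= bdet A ^+ N ->
  exists2 K : R, 0 <= K & forall phi m v, SN A D N phi ->
    w v ^+ Q * normc (iter L (fdiff (invmx (A ^+ m) *m h)) phi v) <= K / (t ^+ L) ^+ m.
Proof.
move=> LN LamN.
have L0 : 0 < Lam by rewrite (lt_trans _ (opA_gt1 _ _ t1)).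
pose H0 := mxnorm1 (invmx P) * pn h.
have H00 : 0 <= H0 by rewrite mulr_ge0 ?mxnorm1_ge0 ?pnorm_ge0.
(* Bounds the weight of v - u for u in the box where derivatives are evaluated, uniformly in m since
   no coordinate of A^-m h exceeds [H0]. *)
pose W0 := 1 + mxnorm1 P * (n.+1%:R * (L.*2%:R * H0)).
have W01 : 1 <= W0.
  rewrite /W0 lerDl mulr_ge0 ?mxnorm1_ge0//.
  by apply: mulr_ge0; rewrite ?ler0n//; apply: mulr_ge0; rewrite ?ler0n.
have W00 : 0 < W0 by exact: lt_le_trans W01.
exists ((n.+1%:R * (2 * H0)) ^+ L * (Lam ^+ Q * (2 * W0) ^+ Q)).
  apply: mulr_ge0; first by apply/exprn_ge0/mulr_ge0; rewrite ?ler0n// mulr_ge0.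
  by apply: mulr_ge0; apply: exprn_ge0; [exact: ltW|rewrite mulr_ge0// ltW].
move=> phi m v Sphi; set B := invmx (A ^+ m).
have tm0 : 0 < t ^+ m by rewrite exprn_gt0.
have tm1 : 1 <= t ^+ m by rewrite exprn_ege1// ltW.
have HB i : `|(B *m h) i 0| <= H0 / t ^+ m.
  apply: (le_trans (coord_le_enorm _ _)); apply: (le_trans (enorm_pnorm uP _)).
  rewrite /H0 -mulrA ler_wpM2l ?mxnorm1_ge0//; exact: pnorm_invAn t1 tDA _ _.
have HB0 i : `|(B *m h) i 0| <= H0.
  by apply: (le_trans (HB i)); rewrite ler_pdivrMr// ler_peMr.
have sphi : smooth phi by have [[]] := Sphi.
have bound al u : mlen al = L -> box v (B *m h) L.*2 u ->
    normc (pder al phi u) <= Lam ^+ Q * (2 * W0) ^+ Q / w v ^+ Q.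
  move=> alL uv; rewrite ler_pdivlMr ?pwX_gt0//.
  have dec : w u ^+ Q * normc (pder al phi u) <= Lam ^+ Q.
    by apply: (@SN_decay _ _ _ _ _ uP t1 tDA N Q phi al u b1 LamN Sphi); rewrite alL.
  have wv : w v <= 2 * W0 * w u.
    have vu : w (v - u) <= W0.
      apply: pw_le => //.
      apply: (@le_trans _ _ (mxnorm1 P * (n.+1%:R * (L.*2%:R * H0)))); last by rewrite lerDr.
      apply: (le_trans (pnorm_enorm _ _)); rewrite ler_wpM2l ?mxnorm1_ge0//.
      apply: (le_trans (enorm_le_sum _)).
      apply: (@le_trans _ _ (\sum_(i < n.+1) (L.*2%:R * H0))); last first.
        by rewrite sumr_const card_ord -[leLHS]mulr_natl.
      apply: ler_sum => i _; rewrite !mxE distrC (le_trans (uv i))// ler_wpM2l//.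
    rewrite -{1}(subrK u v); apply: (le_trans (pwD _ _ _)).
    by rewrite ler_wpM2r ?(ltW (pw_gt0 _ _))// ler_wpM2l.
  rewrite mulrC; apply: (@le_trans _ _ ((2 * W0 * w u) ^+ Q * normc (pder al phi u))).
    rewrite ler_wpM2r ?normc_ge0//; apply: lerXn2r => //; rewrite nnegrE.
      exact/ltW/pw_gt0.
    by rewrite !mulr_ge0// ltW// pw_gt0.
  rewrite exprMn -mulrA mulrC ler_wpM2r ?exprn_ge0 ?mulr_ge0 ?(ltW W00)//.
rewrite mulrC -ler_pdivlMr ?pwX_gt0//.
apply: (le_trans (iter_diff_le sphi HB bound)).
rewrite le_eqVlt; apply/orP; left; apply/eqP.
rewrite (exprAC t) !exprMn exprVn; ring.
Qed.

(* Moved onto the dilated test function, the differences have step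
   [invmx (A ^+ m) *m h], which compensates the growth of [A ^+ m]. *)
Lemma conv_large G h (q L N : nat) : cint G -> wdecay P (q + n.+1.*2) G ->
  (L <= N)%N -> Lam ^+ (q + n.+1.*2) <= bdet A ^+ N -> Lam ^+ q <= t ^+ L ->
  exists2 C : R, 0 <= C & forall phi m x y, SN A D N phi -> Bset A D m%:Z (y - x) ->
    normc (Defs.conv (distr_of (iter L (fdiff h) G)) (dilate A m%:Z phi) y) <= C / w x ^+ q.
Proof.
move=> cG [CG CG0 HG] LN LamN LamL; have [Cw Cw0 HCw] := pw_bweight uP.
have L1 := opA_gt1 A P t1; have L0 : 0 < Lam by exact: lt_trans L1.
set Q := (q + _)%N in LamN HG.
have [K K0 HK] := iter_diff_decay h LN LamN.
pose K' := 4 ^+ q * K * CG * Cw.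
have K'0 : 0 <= K' by rewrite !mulr_ge0 ?exprn_ge0// ltW.
have I0 : 0 <= integR (@bweight R n.+1) by apply: Rintegral_ge0 => u _; exact/ltW/bweight_gt0.
exists (2 * (K' * integR (@bweight R n.+1))) => [|phi m x y Sphi Bxy].
  by rewrite !mulr_ge0// ?exprn_ge0// ltW.
set B := invmx (A ^+ m).
have bm0 : 0 < bdet A ^+ m by rewrite exprn_gt0.
(* The normalisation of the dilation is merely bounded by 1; the gain in m comes from the
   differences. *)
have bm1 : (bdet A ^+ m)^-1 <= 1 by rewrite invf_le1// exprn_ege1// ltW.
have dilE : dilate A m%:Z phi = fun v => ((bdet A ^+ m)^-1)%:C * phi (B *m v).
  apply/funext => v; rewrite /dilate exprz_invmx//; congr (_%:C * _).
  by case: (m) => [|m'] //; rewrite oppr0 expr0z expr0 invr1.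
have ssphi : schwartz phi by have [] := Sphi.
have mphi : measC phi by exact: schwartz_measC.
have [Cb Cb0 Hb] := schwartz_bweight ssphi.
have mdil : measC (dilate A m%:Z phi).
  rewrite dilE; apply: measCM; first exact: measC_cst.
  by have := @measC_mulmx _ _ _ B 0 mphi; under [X in measC X]funext do rewrite addr0.
pose H z := G z * iter L (fdiff h) (dilate A m%:Z phi) (y - z).
have -> : Defs.conv (distr_of (iter L (fdiff h) G)) (dilate A m%:Z phi) y = integC H.
  apply: (@conv_diff _ _ _ _ _ _ _ (1 * Cb)) => // u.
  rewrite dilE normcM normcR ger0_norm ?invr_ge0 ?(ltW bm0)//.
  apply: ler_pM; rewrite ?normc_ge0 ?invr_ge0 ?(ltW bm0)//.
  by apply: (le_trans (Hb _)); rewrite ler_piMr// bweight_le1.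
have Hdecay z : normc (H z) <= K' / w x ^+ q * bweight z.
  rewrite /H dilE iter_diff_mulmx mulrC normcM.
  set v := B *m (y - z); set psi := iter L _ phi.
  have HKv : w v ^+ Q * normc (psi v) <= K / (t ^+ L) ^+ m by exact: HK.
  have tLm : 0 < (t ^+ L) ^+ m by rewrite !exprn_gt0.
  (* Multiplying and dividing by t^(L m) lets the gain of the differences absorb the loss Lam^(q m)
     incurred when the weight at x is bounded by the weight at B x. *)
  rewrite /K' (_ : 4 ^+ q * K * CG * Cw =
      (4 ^+ q * (t ^+ L) ^+ m) * (K / (t ^+ L) ^+ m) * CG * Cw); last first.
    by field; rewrite gt_eqF.
  apply: (@weighted_product _ (w v) (w z) _ _ _ _ _ _ _ q n.+1.*2);
    rewrite ?pw_gt0 ?pw_ge1 ?normc_ge0//; try exact: ltW.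
  - by rewrite divr_ge0// ltW.
  - exact/ltW/bweight_gt0.
  - by rewrite mulr_ge0 ?exprn_ge0// ltW.
  - apply: (@le_trans _ _ ((4 * (w v * w z)) ^+ q * (Lam ^+ m) ^+ q)).
      rewrite -exprMn; apply: lerXn2r; rewrite ?nnegrE.
      + exact/ltW/pw_gt0.
      + by rewrite !mulr_ge0 ?exprn_ge0// ltW// pw_gt0.
      have Bx : w (B *m x) <= 4 * (w v * w z).
        have -> : B *m x = v + (B *m z - B *m (y - x)).
          by rewrite /v -mulmxBr -mulmxDr; congr (_ *m _); rewrite subrKA subKr.
        apply: (le_trans (pwD _ _ _)); rewrite (_ : 4 = 2 * 2 :> R); last by ring.
        rewrite -!mulrA ler_wpM2l// mulrCA ler_wpM2l ?(ltW (pw_gt0 _ _))//.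
        apply: (le_trans (pwB _ _ _)); rewrite -mulrA ler_wpM2l//.
        have -> : w (B *m (y - x)) = 1.
          have := (BsetE t1 tDA m%:Z (y - x)).1 Bxy; rewrite exprz_invmx// => Bxy'.
          by rewrite /pw max_l// ltW.
        rewrite mulr1; apply: pw_le; first exact: pw_ge1.
        apply: le_trans (pw_ge _ _); apply: (le_trans (pnorm_invAn t1 tDA _ _)).
        by rewrite ler_pdivrMr ?exprn_gt0// ler_peMr ?pnorm_ge0// exprn_ege1// ltW.
      have Lm1 : 1 <= Lam ^+ m by rewrite exprn_ege1// ltW.
      apply: (@le_trans _ _ (w (B *m x) * Lam ^+ m)); last by rewrite ler_wpM2r// (le_trans ler01).
      apply: pw_le; first by rewrite mulr_ege1 ?pw_ge1.
      rewrite -{1}(mulKVmx (unit_An m) x); apply: (le_trans (pnorm_An A uP t1 _ _)).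
      by rewrite mulrC ler_wpM2r ?(le_trans ler01)// pw_ge.
    rewrite exprMn exprMn mulrAC ler_wpM2r ?mulr_ge0 ?exprn_ge0 ?(ltW (pw_gt0 _ _))//.
    rewrite ler_wpM2l ?exprn_ge0// (exprAC Lam); apply: lerXn2r => //.
      by rewrite nnegrE exprn_ge0// ltW.
    by rewrite nnegrE exprn_ge0// ltW.
  - rewrite normcM normcR ger0_norm ?invr_ge0 ?(ltW bm0)//; apply: le_trans HKv.
    rewrite mulrCA; apply: (@le_trans _ _ (1 * (w v ^+ q * normc (psi v)))).
      by rewrite ler_wpM2r// mulr_ge0 ?normc_ge0// exprn_ge0// ltW// pw_gt0.
    rewrite mul1r ler_wpM2r ?normc_ge0// /Q exprD.
    by rewrite ler_peMr ?pwX_ge1// ltW// pwX_gt0.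
have mI l (Phi : E -> R[i]) : measC Phi -> measC (iter l (fdiff h) Phi).
  move=> mP; elim: l => //= l IH; apply: measCD => //; apply: measCN.
  have := @measC_mulmx _ _ _ 1%:M (- h) IH.
  by under [X in measC X]funext do rewrite mul1mx.
have mH : measC H.
  by apply: measCM; [exact: cint_measC|apply: measC_reflect; exact: mI].
have rw : rint (fun u => K' / w x ^+ q * bweight u) by apply: rintZ; exact: rint_bweight.
apply: (le_trans (normc_integC mH Hdecay rw)).
rewrite integRZ; last exact: rint_bweight.
by rewrite le_eqVlt; apply/orP; left; apply/eqP; ring.
Qed.

Lemma grand_max_decay G h (q L N : nat) : cint G -> wdecay P (q + n.+1.*2) G ->
  (L <= N)%N -> Lam ^+ (q + n.+1.*2) <= bdet A ^+ N -> Lam ^+ q <= t ^+ L ->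
  exists2 C : R, 0 <= C & forall x,
    (grand_max A D N (distr_of (iter L (fdiff h) G)) x <= (C / w x ^+ q)%:E)%E.
Proof.
move=> cG wG LN LamN LamL.
have [C1 C10 H1] := conv_small (cint_iter_diff h L cG) (wdecay_iter h L wG) LamN.
have [C2 C20 H2] := conv_large h cG wG LN LamN LamL.
exists (C1 + C2); first exact: addr_ge0.
move=> x; apply: ge_ereal_sup => _ [phi [k [y [Sphi Bk ->]]]]; rewrite lee_fin mulrDl.
case: k Bk => m Bk.
  by rewrite (le_trans (H2 _ _ _ _ Sphi Bk))// lerDr divr_ge0// ltW// pwX_gt0.
rewrite NegzE in Bk *.
by rewrite (le_trans (H1 _ _ _ _ Sphi Bk))// lerDl divr_ge0// ltW// pwX_gt0.
Qed.

End GrandMaximal.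

(** * Finiteness and positivity of Hardy quasi-norms *)

Section HardyNorm.
Context {R : realType} {n : nat}.
Local Notation E := 'cV[R]_n.+1.
Implicit Types (x y z u xi eta kappa : E) (k : int) (phi psi F G : E -> R[i]).

(* Avoids proving that the grand maximal function is measurable. *)
Lemma ge0_le_integral_nonmeas d (T : measurableType d) (mu : {measure set T -> \bar R})
    (f g : T -> \bar R) : (forall s, 0 <= f s)%E -> (forall s, f s <= g s)%E ->
  (\int[mu]_s f s <= \int[mu]_s g s)%E.
Proof.
move=> f0 fg; have g0 s : (0 <= g s)%E by exact: le_trans (fg s).
rewrite !ge0_integralTE//; apply: le_ereal_sup => _ [h /= hf <-].
by exists h => // x; exact: le_trans (fg x).
Qed.

Lemma gclass_pderZ xi f (a : R[i]) al : gclass xi f ->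
  pder al (fun x => a * f x) = fun x => a * pder al f x.
Proof.
move=> fc; rewrite !pder_alflat; elim: (alflat al) => //= i s ->.
have [f' ff _] := gclass_derive i (gclass_foldr s fc).
rewrite (cderive_partialC ff) (cderive_partialC (cderiveM (@cderive_cst _ _ i a) ff)).
by apply/funext => x; rewrite mul0r add0r.
Qed.

Section Ellipsoid.
Context (A P : 'M[R]_n.+1) (t : R).
Context (uP : P \in unitmx) (t1 : 1 < t).
Local Notation D := [set x : E | enorm (P *m x) < 1].
Context (tDA : [set t *: x | x in D] `<=` [set A *m x | x in D]).
Context (vD : vol D = 1%E).
Let b1 : 1 < bdet A := bdet_gt1 t1 tDA vD.
Local Notation w := (pw P).

(** Finite functions into 'I_N.+1 include every multi-index of length at most N, so finitely many
    Gaussian bounds yield a single scaling constant. *)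
Lemma gauss_SN (N : nat) xi : exists2 e : R, 0 < e & SN A D N (fun x => e%:C * gauss xi x).
Proof.
have [d bd] : exists d, bdet A <= t ^+ d.
  have [d Hd] := eventually_small t1 (bdet A) ltr01; exists d.
  by have := Hd d (leqnn d); rewrite ler_pdivrMr ?mul1r// exprn_gt0// (t_gt0 t1).
have [C C0 HC] := pw_dotv P.
have gx := gclass_gauss xi.
have /choice[M HM] : forall al : {ffun 'I_n.+1 -> 'I_N.+1}, exists M : R, forall x,
    Num.max 1 (rho A D x ^+ N) * normc (pder (fun i => al i : nat) (gauss xi) x) <= M.
  move=> al; have [M HM] := gclass_bound (gclass_pder (fun i => al i : nat) gx) (d * N).
  exists (C ^+ (d * N) * M) => x.
  have Q0 : 0 <= 1 + dotv x x by rewrite addr_ge0// dotv_ge0.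
  have CQ0 : 0 <= C * (1 + dotv x x) by rewrite mulr_ge0// ltW.
  have wX0 (l : nat) : 0 <= w x ^+ l by rewrite ltW// pwX_gt0.
  apply: (@le_trans _ _ ((C * (1 + dotv x x)) ^+ (d * N) *
      normc (pder (fun i => al i : nat) (gauss xi) x))).
    rewrite ler_wpM2r ?normc_ge0// ge_max; apply/andP; split.
      apply: (@le_trans _ _ ((w x ^+ 2) ^+ (d * N))); first by rewrite -exprM pwX_ge1.
      by apply: lerXn2r => //; rewrite nnegrE.
    have /andP[r0 r1] := rho_le t1 tDA x b1 bd.
    apply: (@le_trans _ _ ((w x ^+ d) ^+ N)).
      by apply: lerXn2r => //; rewrite nnegrE.
    rewrite -exprM; apply: (@le_trans _ _ ((w x ^+ 2) ^+ (d * N))).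
      by apply: lerXn2r; rewrite ?nnegrE// ?(ltW (pw_gt0 _ _))// ler_eXnr// pw_ge1.
    by apply: lerXn2r => //; rewrite nnegrE.
  by rewrite exprMn -mulrA ler_wpM2l// exprn_ge0// ltW.
have M0 al : 0 <= M al.
  apply: le_trans (HM al 0); rewrite mulr_ge0 ?normc_ge0//.
  by rewrite le_max ler01.
have S0 : 0 < 1 + \sum_al M al by rewrite ltr_pwDl// sumr_ge0.
exists (1 + \sum_al M al)^-1; first by rewrite invr_gt0.
split; first by apply: (@gclass_schwartz _ _ xi); exact: gclassZ.
move=> x al alN; rewrite (gclass_pderZ _ _ gx) normcM normcR ger0_norm ?invr_ge0 ?(ltW S0)//.
have al_lt i : (al i < N.+1)%N.
  by rewrite ltnS (leq_trans _ alN)// /mlen (bigD1 i)//= leq_addr.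
pose al' := [ffun i => Ordinal (al_lt i)].
have -> : al = (fun i => al' i : nat) by apply/funext => i; rewrite ffunE.
rewrite mulrCA mulrC ler_pdivrMr// mul1r (le_trans (HM al' x))//.
by rewrite (bigD1 al')//= addrCA lerDl addr_ge0// sumr_ge0.
Qed.

(** The condition on q makes the p-th power of the decay at least as strong as 2(n+1) inverse powers
    of the weight, which [bweight] dominates. *)
Lemma Hnorm_lty (N q : nat) (p C : R) (f : distr) : 0 < p -> (n.+1).*2%:R <= q%:R * p -> 0 <= C ->
  (forall x, (grand_max A D N f x <= (C / w x ^+ q)%:E)%E) -> (Hnorm A D N p f < +oo)%E.
Proof.
move=> p0 qp C0 HC; have [Cw Cw0 HCw] := pw_bweight uP.
rewrite /Hnorm unlock; apply: poweR_lty.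
apply: (@le_lt_trans _ _ (\int[lebesgue n.+1]_u (C `^ p * Cw * bweight (vec u))%:E)%E); last first.
  by have /integrable_lty := rintZ (C `^ p * Cw) (@rint_bweight R n.+1); apply.
apply: ge0_le_integral_nonmeas => u; first exact: poweR_ge0.
(* Needs a test function: the supremum over an empty set would be -oo, and its absolute value
   infinite. *)
have g0 : (0 <= grand_max A D N f (vec u))%E.
  have [e e0 Se] := gauss_SN N 0.
  apply: le_ereal_sup_tmp.
  exists (normc (Defs.conv f (dilate A 0 (fun x => e%:C * gauss 0 x)) (vec u)))%:E.
    exists (fun x => e%:C * gauss 0 x), 0, (vec u); split => //.
    by rewrite subrr; exists 0; rewrite ?mulmx0//= mulmx0 enorm0.
  by rewrite lee_fin normc_ge0.
rewrite /comp gee0_abs//; set x := vec u.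
apply: (@le_trans _ _ ((C / w x ^+ q)%:E `^ p)%E).
  apply: gt0_ler_poweR => //; first exact: ltW.
  - by rewrite in_itv/= g0 leey.
  - by rewrite in_itv/= lee_fin divr_ge0 ?leey// ltW// pwX_gt0.
rewrite poweR_EFin lee_fin powRM ?invr_ge0 ?(ltW (pwX_gt0 _ _ _))//.
rewrite -mulrA ler_wpM2l ?powR_ge0//.
have wX : 0 < w x ^+ n.+1.*2 by exact: pwX_gt0.
apply: (@le_trans _ _ (w x ^+ n.+1.*2)^-1); last first.
  by rewrite -[leLHS]mul1r ler_pdivrMr// mulrAC HCw.
rewrite -powR_inv1 ?(ltW (pwX_gt0 _ _ _))// -powRrM mulN1r powRN.
rewrite lef_pV2 ?posrE ?powR_gt0 ?pwX_gt0//.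
rewrite -!powR_mulrn ?(ltW (pw_gt0 _ _))// -powRrM.
by rewrite ler_powR// pw_ge1.
Qed.

(** D has measure 1, so a positive lower bound on D alone keeps the integral positive. *)
Lemma Hnorm_neq0 (N : nat) (p c : R) (f : distr) : 0 < p -> 0 < c ->
  (forall x, pnorm P x < 1 -> (c%:E <= grand_max A D N f x)%E) -> Hnorm A D N p f != 0%E.
Proof.
move=> p0 c0 Hc; rewrite /Hnorm unlock.
suff : (0 < \int[lebesgue n.+1]_u `|(grand_max A D N f \o @vec R n.+1) u| `^ p)%E.
  by move=> I0; rewrite poweR_eq0 ?(ltW I0)// (gt_eqF I0).
have mB := measurable_pball P 0 1.
set X := [set _ | _] in mB.
apply: (@lt_le_trans _ _ (\int[lebesgue n.+1]_u ((c `^ p)%:E * (\1_X u)%:E))%E).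
  rewrite ge0_integralZl//; last 2 first.
  - by apply/measurable_EFinP; exact: measurable_indic.
  - by rewrite lee_fin powR_ge0.
  rewrite integral_indic//= setIT (lebesgue_pball 0 vD) mule1 lte_fin powR_gt0//.
apply: ge0_le_integral_nonmeas => u; first by rewrite mule_ge0// lee_fin ?powR_ge0// indicE.
rewrite indicE; have [uX|_] := boolP (u \in X); last by rewrite mule0 poweR_ge0.
rewrite mule1 -poweR_EFin; apply: gt0_ler_poweR; first exact: ltW.
- by rewrite in_itv/= lee_fin (ltW c0) leey.
- by rewrite in_itv/= abse_ge0 leey.
- apply: le_trans (lee_abs _); apply: Hc; move: uX; rewrite inE /X/= subr0; exact.
Qed.

End Ellipsoid.
End HardyNorm.

(** * Orthogonality to the affine system *)

Section Orthogonality.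
Context {R : realType} {n : nat}.
Local Notation E := 'cV[R]_n.+1.
Implicit Types (x y z u xi eta kappa h : E) (phi psi F G : E -> R[i]).

Lemma packet_bweight (P : 'M[R]_n.+1) xi (d : R) (q : nat) : P \in unitmx -> 0 < d ->
  wdecay P (q + n.+1.*2) (packet xi d (q + n.+1.*2)).
Proof.
move=> uP d0; have [C HC] := sincw_decay P (q + n.+1.*2) d0.
exists (Num.max 0 C) => [|x]; first by rewrite le_max lexx.
rewrite normc_packet le_max; apply/orP; right; apply: le_trans (HC x).
rewrite ler_wpM2r ?sincw_ge0// ler_weXn2l ?pw_ge1//.
by have := leq_addr (q + n.+1.*2) (q + n.+1.*2); rewrite [X in (_ <= X)%N]addnn.
Qed.

Lemma wdecay_bweight (P : 'M[R]_n.+1) (q : nat) G : P \in unitmx ->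
  wdecay P (q + n.+1.*2) G ->
  exists2 C : R, 0 <= C & forall x, normc (G x) <= C * bweight x.
Proof.
move=> uP [C C0 HC]; have [Cw Cw0 HCw] := pw_bweight uP.
exists (C * Cw) => [|x]; first by rewrite mulr_ge0// ltW.
have H : pw P x ^+ n.+1.*2 * normc (G x) <= C.
  apply: le_trans (HC x); rewrite ler_wpM2r ?normc_ge0// ler_weXn2l ?pw_ge1//.
  exact: leq_addl.
apply: (@le_trans _ _ (normc (G x) * (Cw * pw P x ^+ n.+1.*2 * bweight x))).
  by rewrite ler_peMr ?normc_ge0.
have -> : normc (G x) * (Cw * pw P x ^+ n.+1.*2 * bweight x) =
    pw P x ^+ n.+1.*2 * normc (G x) * (Cw * bweight x) by ring.
by rewrite -[leRHS]mulrA ler_wpM2r// mulr_ge0 ?(ltW Cw0)// ltW// bweight_gt0.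
Qed.

(** Translating by h replaces kappa by kappa - M h, which leaves the integer lattice; this is why
    kappa ranges over all real vectors. *)
Lemma iter_diff_orthogonal psi (M : 'M[R]_n.+1) G h L : cint G -> measC psi ->
  (exists K : R, forall x, normc (psi x) <= K) ->
  (forall kappa, integC (fun x => G x * conjc (psi (M *m x - kappa))) = 0) ->
  forall kappa, integC (fun x => iter L (fdiff h) G x * conjc (psi (M *m x - kappa))) = 0.
Proof.
move=> cG mpsi [K HK] H0; elim: L => // L IH kappa.
have cF := cint_iter_diff h L cG; set F := iter L (fdiff h) G in IH cF *.
have c kap : cint (fun x => F x * conjc (psi (M *m x - kap))).
  apply: (cintMb (K := K)) => //; first by apply: measCJ; exact: measC_mulmx.
  by move=> x; rewrite normcJE.
have [c2 e2] := cint_shift (- h) (c (kappa - M *m h)).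
have [_ e] := cintB (c kappa) c2.
rewrite IH e2 IH subr0 in e; rewrite -[RHS]e; congr integC; apply/funext => x.
rewrite iterS /fdiff mulrBl; congr (_ - _ * conjc (psi _)).
by rewrite mulmxBr opprB addrA subrK.
Qed.

(** F is integrable, so continuity already follows from uniform convergence, the Schwartz seminorm
    with both multi-indices zero. *)
Lemma tempered_distr_of F (C : R) : measC F -> (forall x, normc (F x) <= C * bweight x) ->
  tempered (distr_of F).
Proof.
move=> mF HF.
have cF : cint F by apply: cint_dom mF HF _; apply: rintZ; exact: rint_bweight.
have C0 : 0 <= C.
  by have := le_trans (normc_ge0 _) (HF 0); rewrite pmulr_lge0// bweight_gt0.
have cFphi phi : schwartz phi -> cint (fun x => F x * phi x).
  move=> sphi; have [K K0 HK] := schwartz_bweight sphi.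
  apply: (cintMb (K := K)) => //; first exact: schwartz_measC.
  move=> x; by apply: (le_trans (HK x)); rewrite ler_piMr// bweight_le1.
split=> [a phi psi sphi spsi|phi_ phi sphi_ sphi cvg].
  have [c1 e1] := cintZ a (cFphi _ sphi); have [_ e2] := cintD c1 (cFphi _ spsi).
  rewrite /distr_of -e1 -e2; congr integC; apply/funext => x; ring.
have I0 : 0 <= integR (@bweight R n.+1) by apply: Rintegral_ge0 => u _; exact/ltW/bweight_gt0.
have B (m : nat) (e : R) : (forall x, normc ((phi_ m \- phi) x) <= e) ->
    normc (distr_of F (phi_ m) - distr_of F phi) <= e * (2 * (C * integR (@bweight R n.+1))).
  move=> He; have [c e1] := cintB (cFphi _ (sphi_ m)) (cFphi _ sphi).
  have rw : rint (fun x => (e * C) * bweight x) by apply: rintZ; exact: rint_bweight.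
  rewrite /distr_of -e1; have -> : e * (2 * (C * integR (@bweight R n.+1))) =
      2 * integR (fun x => e * C * @bweight R n.+1 x).
    by rewrite integRZ; [ring|exact: rint_bweight].
  apply: normc_integC rw; first exact: cint_measC.
  move=> x; rewrite -mulrBr normcM mulrC -mulrA; apply: ler_pM; rewrite ?normc_ge0//.
  exact: He.
apply/cvgrPdist_le => e e0.
pose K := 2 * (C * integR (@bweight R n.+1)).
have K0 : 0 <= K by rewrite !mulr_ge0.
have K1 : 0 < K + 1 by rewrite ltr_wpDl.
have := cvg (fun=> 0%N) (fun=> 0%N) (e / (K + 1)) (divr_gt0 e0 K1).
apply: filterS => m Hm.
have {}Hm : forall x, normc ((phi_ m \- phi) x) <= e / (K + 1).
  move=> x; have := Hm x; rewrite pder0 normcM normcR /monom.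
  by rewrite big1 ?normr1 ?mul1r// => i _; rewrite expr0.
rewrite sub0r normrN ger0_norm ?normc_ge0//; apply: (le_trans (B m _ Hm)).
by rewrite -/K -mulrA ler_piMr ?(ltW e0)// mulrC ler_pdivrMr// mul1r lerDl.
Qed.

End Orthogonality.

(** * A wave packet annihilated by the frame operator *)

Section Counterexample.
Context {R : realType} {n : nat}.
Local Notation E := 'cV[R]_n.+1.
Local Notation Re := complex.Re.
Implicit Types (x y z u xi eta kappa h : E) (phi psi F G : E -> R[i]).
Context (A P : 'M[R]_n.+1) (t : R).
Context (uP : P \in unitmx) (t1 : 1 < t).
Local Notation D := [set x : E | enorm (P *m x) < 1].
Context (tDA : [set t *: x | x in D] `<=` [set A *m x | x in D]).
Context (vD : vol D = 1%E).
Let b1 : 1 < bdet A := bdet_gt1 t1 tDA vD.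
Local Notation w := (pw P).
Local Notation Lam := (opA A P t).

Lemma fourier_gap (lambda : R) (v : E) psi (r Rout : R) : v != 0 -> A^T *m v = lambda *: v ->
  0 < r -> r < Rout -> supp (fourier psi) `<=` [set xi | r <= enorm xi <= Rout] ->
  Rout / r < `|lambda| ->
  exists2 xi : E, xi != 0 & exists2 a : R, 0 < a &
    forall eta, (forall i, `|eta i 0 - xi i 0| <= a) -> forall j : int,
      fourier psi ((invmx (A ^ j))^T *m eta) = 0.
Proof.
move=> v0 Av r0 rR sp lR.
have [xi xi0 [a a0 Ha]] := spectral_gap uP t1 tDA v0 Av r0 rR lR.
exists xi => //; exists a => // eta /Ha {}Ha j.
have F0 z : ~~ (r <= enorm z <= Rout) -> fourier psi z = 0.
  move=> zr; apply/eqP; apply: contraNT zr => z0; apply: (sp z).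
  exact: subset_closure.
(* The two families of [spectral_gap] cover each j once: powers of the transpose give j <= 0, their
   inverses j > 0. *)
apply: F0; case: j => [[|m]|m].
- by have [_] := Ha 0; rewrite expr0z invmx1 expr0.
- by have [] := Ha m.
- have [_] := Ha m.+1; rewrite NegzE -invr_expz -[invmx _]/(GRing.inv _) invrK.
  by [].
Qed.

(** The modulation -xi cancels the oscillation of F, leaving the nonnegative function W times a
    Gaussian. *)
Lemma packet_gauss_gt0 xi (d : R) (m : nat) F (W : E -> R) : 0 < d ->
  cint F -> F = (fun x => expi (2 * pi * dotv x xi) * (W x)%:C) ->
  (forall x, sincw d m x <= W x) ->
  0 < Re (integC (fun z => F z * gauss (- xi) z)).
Proof.
move=> d0 cF FE HW.
have cFg : cint (fun z => F z * gauss (- xi) z).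
  have sg := gclass_schwartz (gclass_gauss (- xi)).
  have [M HM] := gclass_bound (gclass_gauss (- xi)) 0.
  apply: (cintMb (K := M)) => //; first exact: schwartz_measC.
  by move=> x; have := HM x; rewrite expr0 mul1r.
have RE z : Re (F z * gauss (- xi) z) = W z * expR (- dotv z z).
  have -> : F z * gauss (- xi) z = (W z * expR (- dotv z z))%:C.
    rewrite FE /gauss -[- xi]scaleN1r dotvZr mulN1r mulrN.
    rewrite (_ : _ * _ = expi (2 * pi * dotv z xi) * expi (- (2 * pi * dotv z xi)) *
      ((W z)%:C * (expR (- dotv z z))%:C)); last by ring.
    by rewrite -expiD subrr expi0 mul1r -rmorphM.
  by [].
rewrite Re_integC; apply: (@integR_gt0 _ _ _ d m) => //.
- by have [] := cFg.
- by move=> z; rewrite RE mulr_ge0 ?expR_ge0// (le_trans (sincw_ge0 d m z)).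
- by move=> z z0; rewrite RE mulr_gt0 ?expR_gt0// (lt_le_trans z0).
Qed.

Lemma frame_series_orthogonal psi F : (exists C : R, forall x, normc (F x) <= C * bweight x) ->
  (forall (j : int) kappa, integC (fun x => F x * conjc (psi (A ^ j *m x - kappa))) = 0) ->
  cint F -> schwartz psi -> (forall j : int, A ^ j \in unitmx) ->
  frame_op A psi (distr_of F) (fun=> 0).
Proof.
move=> [C HF] H0 cF spsi uAj; split.
  split=> [a phi chi _ _|phi_ phi _ _ _]; first by rewrite mulr0 addr0.
  by rewrite subr0 normc0E; exact: cvg_cst.
move=> phi sphi.
have pair0 j k : pairing (distr_of F) (psi_jk A psi j k) = 0.
  rewrite /pairing /distr_of /psi_jk.
  set c : R := _ `^ _; set kappa := map_mx _ k.
  have [K K0 HK] := schwartz_bweight spsi.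
  have cc : cint (fun x => F x * conjc (psi (A ^ j *m x - kappa))).
    apply: (cintMb (K := K)) => //.
      by apply: measCJ; apply: measC_mulmx; exact: schwartz_measC.
    by move=> x; rewrite normcJE (le_trans (HK _))// ler_piMr// bweight_le1.
  have [_ e] := cintZ c%:C cc; rewrite H0 mulr0 in e; rewrite -[RHS]e.
  congr integC; apply/funext => x.
  rewrite conjc_mul (_ : conjc c%:C = c%:C); last exact: conjc_real.
  by rewrite mulrCA.
rewrite [X in X @ _ --> _](_ : _ = fun=> 0); last first.
  apply/funext => J; rewrite /summability.partial_sum big1 ?subrr ?normc0E//.
  by move=> i _; rewrite pair0 mul0r.
by apply: cvg_cst; exact: summability.totally_filter.
Qed.

Lemma Hnorm_opp (N : nat) (p : R) (f : distr) : Hnorm A D N p ((fun=> 0) \- f) = Hnorm A D N p f.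
Proof.
rewrite /Hnorm; congr (Lnorm _ _ _); apply/funext => u /=; rewrite /grand_max; congr ereal_sup.
by apply/seteqP; split=> z [phi [k [y [S B ->]]]]; exists phi, k, y; split=> //;
  congr EFin; rewrite /Defs.conv/= sub0r normcNE.
Qed.

Lemma exists_pow_ge (b x : R) : 1 < b -> exists N, forall m, (N <= m)%N -> x <= b ^+ m.
Proof.
move=> hb; have [J HJ] := eventually_small hb x ltr01; exists J => m Jm.
have := HJ m Jm; rewrite ler_pdivrMr ?mul1r// exprn_gt0// (lt_trans _ hb)//.
Qed.

(** The ratio at F is exactly 1, once its quasi-norm is known to be finite and nonzero. *)
Lemma opnorm_ge1 (p : R) (hp : 0 < p <= 1) :
  exists N0 : nat, forall N : nat, (N0 <= N)%N ->
  forall (lambda : R) (v : E) psi (r Rout : R),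
    v != 0 -> A^T *m v = lambda *: v -> schwartz psi -> 0 < r -> r < Rout ->
    supp (fourier psi) `<=` [set xi | r <= enorm xi <= Rout] ->
    Rout / r < `|lambda| ->
    (1 <= opnorm A D N p (frame_defect A psi))%E.
Proof.
have /andP[p0 _] := hp.
have uA : A \in unitmx := expansive_unit t1 tDA.
pose nn := n.+1.*2.
have [q Hq] : exists q : nat, nn%:R <= q%:R * p.
  exists (Num.trunc (nn%:R / p)).+1; rewrite -ler_pdivrMr// ltW//.
  exact: truncnS_gt.
have [L HL] := exists_pow_ge (Lam ^+ q) t1.
have [N1 HN1] := exists_pow_ge (Lam ^+ (q + nn)) b1.
exists (maxn L N1) => N; rewrite geq_max => /andP[LN N1N].
move=> lambda v psi r Rout v0 Av spsi r0 rR sp lR.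
have [xi xi0 [a a0 gap]] := fourier_gap v0 Av r0 rR sp lR.
(* The m sinc squares supply 2m powers of decay, covering q for the maximal function and [nn] for
   integrability. *)
pose m := (q + nn)%N.
have m0 : 0 < (n.+1 * m.*2)%:R :> R.
  by rewrite ltr0n muln_gt0/= double_gt0 /m /nn addn_gt0 double_gt0 orbT.
(* The (n+1) 2m sinc factors together use up exactly the half-side a of the spectral hole. *)
pose d := a / (n.+1 * m.*2)%:R.
have d0 : 0 < d by rewrite divr_gt0.
pose G := packet xi d m; pose h := halfwave xi; pose F := iter L (fdiff h) G.
have wG : wdecay P (q + n.+1.*2) G by exact: packet_bweight.
have mG : measC G by exact: measC_packet.
have [CG CG0 HG] := wdecay_bweight uP wG.
have cG : cint G by apply: cint_dom mG HG _; apply: rintZ; exact: rint_bweight.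
have cF : cint F by exact: cint_iter_diff.
have wF : wdecay P (q + n.+1.*2) F by exact: wdecay_iter.
have [CF CF0 HF] := wdecay_bweight uP wF.
have uAj (j : int) : A ^ j \in unitmx.
  by rewrite -[_ \in unitmx]/(A ^ j \is a GRing.unit) unitrXz.
have [K K0 HK] := schwartz_bweight spsi.
have orth (j : int) kappa : integC (fun x => F x * conjc (psi (A ^ j *m x - kappa))) = 0.
  apply: iter_diff_orthogonal => //; first exact: schwartz_measC.
    by exists K => x; rewrite (le_trans (HK _))// ler_piMr// bweight_le1.
  move=> kap.
  have aff eta : (forall i, `|eta i 0 - xi i 0| <= a) ->
      cint (fun x => conjc (psi (A ^ j *m x - kap))) /\
      integC (fun x => conjc (psi (A ^ j *m x - kap)) * expi (2 * pi * dotv x eta)) = 0.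
    by move=> etaP; apply: fourier_affine => //; exact: gap.
  have [cP _] := aff xi (fun i => ltac:(by rewrite subrr normr0 ltW)).
  apply: (@vanish_sincw _ _ _ _ a) => //; first exact: ltW.
    by rewrite /d mulrC divfK// gt_eqF.
  by move=> eta /aff[].
have fop : frame_op A psi (distr_of F) (fun=> 0).
  by apply: frame_series_orthogonal => //; exists CF.
have tF : tempered (distr_of F) by exact: tempered_distr_of (cint_measC cF) HF.
have [W HW FW] := iter_diff_packet d m L xi0.
have Ipos := packet_gauss_gt0 d0 cF FW HW.
set I := integC _ in Ipos.
have [C C0 HC] := grand_max_decay uP t1 tDA b1 h cG wG LN (HN1 N N1N) (HL L (leqnn L)).
have Hfin : (Hnorm A D N p (distr_of F) < +oo)%E.
  exact: (Hnorm_lty uP t1 tDA vD p0 Hq C0 HC).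
have [e e0 Se] := gauss_SN t1 tDA vD N xi.
have Hn0 : Hnorm A D N p (distr_of F) != 0%E.
  apply: (@Hnorm_neq0 _ _ A P vD N p (e * Re I)) => //; first exact: mulr_gt0.
  (* At scale 0 and y = 0 the condition reads -x in D, so one value of the convolution bounds the
     grand maximal function on all of D. *)
  move=> x x1; apply: le_ereal_sup_tmp.
  exists (normc (Defs.conv (distr_of F) (dilate A 0 (fun x => e%:C * gauss xi x)) 0))%:E.
    exists (fun x => e%:C * gauss xi x), 0, 0; split=> //.
    exists (- x); last by rewrite expr0z mul1mx sub0r.
    by rewrite /= -/(pnorm P (- x)) pnormN.
  rewrite lee_fin.
  (* The reflection in the convolution turns the modulation xi into the -xi of
     [packet_gauss_gt0]. *)
  have -> : Defs.conv (distr_of F) (dilate A 0 (fun x => e%:C * gauss xi x)) 0 = e%:C * I.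
    have sg := gclass_schwartz (gclass_gauss (- xi)).
    have [M HM] := gclass_bound (gclass_gauss (- xi)) 0.
    have cFg : cint (fun z => F z * gauss (- xi) z).
      apply: (cintMb (K := M)) => //; first exact: schwartz_measC.
      by move=> z; have := HM z; rewrite expr0 mul1r.
    have [_ <-] := cintZ e%:C cFg; rewrite /Defs.conv /distr_of.
    congr integC; apply/funext => z; rewrite /dilate oppr0 !expr0z mul1mx sub0r mul1r mulrCA.
    congr (_ * (_ * _)); rewrite /gauss dotvNl dotvC dotvNl opprK.
    by rewrite [dotv (- z) _]dotvNl [dotv z (- xi)]dotvC dotvNl [dotv xi z]dotvC.
  rewrite normcM normcR gtr0_norm// ler_pM2l// (le_trans (ler_norm _))//.
  exact: normRe_le.
have Hge0 : (0 <= Hnorm A D N p (distr_of F))%E by exact: Lnorm_ge0.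
apply: ereal_sup_ubound; exists (distr_of F), ((fun=> 0) \- distr_of F); split.
- by split.
- move=> /(_ (gauss (- xi)) (gclass_schwartz (gclass_gauss (- xi)))).
  by rewrite /distr_of -/I => I0; move: Ipos; rewrite I0 ltxx.
- by exists (fun=> 0).
- by rewrite Hnorm_opp divee// ge0_fin_numE.
Qed.

End Counterexample.

Theorem theorem1 (R : realType) (n : nat) (A : 'M[R]_n.+1)
    (D : set 'cV[R]_n.+1) (hA : expansive A) (hD : step_ellipsoid A D)
    (p : R) (hp : 0 < p <= 1) :
  exists N0 : nat, forall N : nat, (N0 <= N)%N ->
  forall (lambda : R) (v : 'cV[R]_n.+1) (psi : 'cV[R]_n.+1 -> R[i])
    (r Rout : R),
    v != 0 -> A^T *m v = lambda *: v ->
    radial psi -> standing A D psi ->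
    0 < r -> r < Rout ->
    supp (fourier psi) `<=` [set xi | r <= enorm xi <= Rout] ->
    `|lambda| > Rout / r ->
    (1 <= opnorm A D N p (frame_defect A psi))%E.
Proof.
have [[P uP DE] vD [t t1 [_ tDA]]] := hD; rewrite {D hD}DE in vD tDA *.
have [N0 H] := opnorm_ge1 uP t1 tDA vD hp.
exists N0 => N NN0 lambda v psi r Rout v0 Av _ [spsi _ _] r0 rR sp lR.
exact: (H N NN0 lambda v psi r Rout).
Qed.
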